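(* Let $(M,g_M)$ be a complete Riemannian manifold on which a compact Lie group $G$ acts by isometries, and let $g_{\mathrm{bi}}$ be a bi-invariant metric on $G$. Let $\mathcal U$ be a $G$-invariant, pre-compact open subset of the union $M^{\mathrm{reg}}$ of the principal orbits (that is, the closure of $\mathcal U$ in $M^{\mathrm{reg}}$ is compact), and let $\tilde g=\lim_{l\to0}\tilde g_l|_{\mathcal U}$ be the limit metric on $\mathcal U$ of the rescaled Cheeger deformations $\tilde g_l$. For any $x\in\mathcal U$ with isotropy group $G_x$, let $\Phi_x:G/G_x\to G(x)$ be the $G$-equivariant diffeomorphism $\Phi_x(gG_x)=gx$, and let $g_{\mathrm{nh},x}$ be the normal homogeneous metric on $G/G_x$ induced by the submersion $(G,g_{\mathrm{bi}})\to G/G_x$. Then $\Phi_x:(G/G_x,\ g_{\mathrm{nh},x})\to(\mathcal U,\tilde g)$ is a Riemannian embedding whose image is totally geodesic.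
   Context: Cheeger deformation: for $l>0$ the group $G$ acts freely and isometrically on $(G\times M,\ l^2g_{\mathrm{bi}}+g_M)$ by $g(p,m)=(pg^{-1},gm)$. The quotient map of this action is identified with $q:G\times M\to M$, $q(p,m)=pm$, and $g_l$ denotes the Riemannian metric on $M\cong(G\times M)/G$ for which $q:(G\times M,\ l^2g_{\mathrm{bi}}+g_M)\to(M,g_l)$ is a Riemannian submersion. For $x\in M^{\mathrm{reg}}$, $G(x)$ is the orbit of $x$, $T_xG(x)$ is its tangent space and $T_xG(x)^{\perp}$ its orthogonal complement (it is the same for $g_l$ and $g_M$). The rescaled metric on $M^{\mathrm{reg}}$ is $$\tilde g_l\equiv\frac1{l^2}\,g_l|_{T_xG(x)}+g_l|_{T_xG(x)^{\perp}}.$$ For every non-negative integer $p$, as $l\to0$ the metrics $\tilde g_l|_{\mathcal U}$ converge in the $C^p$-topology (uniform convergence of components and their partial derivatives up to order $p$ with respect to a fixed finite atlas) to a $G$-invariant Riemannian metric on $\mathcal U$; this limit is denoted $\tilde g$. The metric $g_{\mathrm{nh},x}$ is the metric on $G/G_x$ for which the quotient map $(G,g_{\mathrm{bi}})\to G/G_x$ is a Riemannian submersion. ''Riemannian embedding'' means an embedding which pulls the metric $\tilde g$ back to $g_{\mathrm{nh},x}$ (not an isometry in the sense of metric spaces). *)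

(* Defs.v *)
(* A smooth manifold is a topological space with a smooth atlas modelled on a
   normed space E. Its tangent space at x is E itself, read in the preferred
   chart [chart_at A x]; differentials, metrics and geodesics are expressed
   through this identification. *)
From HB Require Import structures.
From mathcomp Require Import all_boot all_order all_algebra.
From mathcomp Require Import all_classical all_reals all_analysis.
Set Implicit Arguments.
Unset Strict Implicit.
Unset Printing Implicit Defensive.
Import Order.TTheory GRing.Theory Num.Theory numFieldNormedType.Exports.
Local Open Scope classical_set_scope.
Local Open Scope ring_scope.

(* The two structures are unrelated here: [lie_group] makes the operations
   smooth, hence continuous. *)
#[short(type="topGroupType")]
HB.structure Definition TopGroup := {G of Group G & Topological G}.

Section Smooth.
Context {R : realType}.
Implicit Types E F : normedModType R.

(* Only used for D open and E finite-dimensional, where it is the usual class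
   C^k: directional derivatives then account for all partial derivatives. *)
Fixpoint Ck_on E F (k : nat) (D : set E) (f : E -> F) : Prop :=
  match k with
  | 0 => forall x, D x -> {for x, continuous f}
  | k'.+1 => (forall x, D x -> differentiable f x) /\
             (forall v, Ck_on k' D ('D_v f))
  end.

Definition smooth_on E F (D : set E) (f : E -> F) : Prop :=
  forall k, Ck_on k D f.

Lemma near_eq_differentiable E F (f g : E -> F) (x : E) :
  (\forall y \near x, f y = g y) -> differentiable f x -> differentiable g x.
Proof.
move=> fg df; have fgx := nbhs_singleton fg; have [dfc dfE] := (diff_locallyP _ _).1 df.
have gE : g \o shift x = cst (g x) + 'd f x +o_ 0 id.
  move/eqaddoP in dfE; apply/eqaddoP => e e0.
  move: fg; rewrite (near_shift 0 x) subr0 => fg0.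
  apply: filterS2 fg0 (dfE e e0) => h /= fgh.
  by rewrite !fctE /= fgh /cst /= fgx.
apply/diff_locallyP.
by rewrite (diff_unique dfc gE).
Qed.

Let fst_cont E F : continuous (fst : (E * F)%type -> E).
Proof. by move=> z; exact: cvg_fst. Qed.

Let snd_cont E F : continuous (snd : (E * F)%type -> F).
Proof. by move=> z; exact: cvg_snd. Qed.

Lemma Ck_on_prod E F E' F' k (A : set E) (B : set F) (f : E -> E') (g : F -> F')
    (h : (E * F)%type -> (E' * F')%type) :
  open A -> open B ->
  (forall z, A z.1 -> B z.2 -> h z = (f z.1, g z.2)) ->
  Ck_on k A f -> Ck_on k B g -> Ck_on k (A `*` B) h.
Proof.
move=> oA oB.
have nAB z : A z.1 -> B z.2 -> \forall w \near z, A w.1 /\ B w.2.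
  case: z => a b /= Aa Bb; exists (A, B) => //=.
  by split; apply: open_nbhs_nbhs.
elim: k f g h => [|k IH] f g h hfg /=.
  move=> fc gc [a b] [/= Aa Bb].
  have nh : \forall w \near (a, b), (f w.1, g w.2) = h w.
    by apply: filterS (nAB (a,b) Aa Bb) => w [Aw Bw]; rewrite hfg.
  have hab : h (a, b) = (f a, g b) by rewrite hfg.
  suff: (fun w : (E * F)%type => (f w.1, g w.2)) @ (a, b) --> (f a, g b).
    rewrite -hab => /(cvg_trans (near_eq_cvg nh)).
    exact.
  apply: cvg_pair => /=.
    by apply: (cvg_comp fst f); [exact: cvg_fst|exact: fc].
  by apply: (cvg_comp snd g); [exact: cvg_snd|exact: gc].
move=> [fd fD] [gd gD].
have nh z : A z.1 -> B z.2 -> \forall w \near z, (f w.1, g w.2) = h w.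
  by move=> Az Bz; apply: filterS (nAB z Az Bz) => w [Aw Bw]; rewrite hfg.
have d1 (z : (E * F)%type) : differentiable (fst : (E * F)%type -> E) z.
  exact/linear_differentiable/fst_cont.
have d2 (z : (E * F)%type) : differentiable (snd : (E * F)%type -> F) z.
  exact/linear_differentiable/snd_cont.
have df1 (z : (E * F)%type) : A z.1 -> differentiable (f \o fst) z.
  by move=> Az; apply: differentiable_comp; [exact: d1|exact: fd].
have dg1 (z : (E * F)%type) : B z.2 -> differentiable (g \o snd) z.
  by move=> Bz; apply: differentiable_comp; [exact: d2|exact: gd].
split=> [z [Az Bz]|v].
  apply: near_eq_differentiable (nh z Az Bz) _.
  by apply: differentiable_pair; [exact: df1|exact: dg1].
apply: (IH _ _ _ _ (fD v.1) (gD v.2)) => z Az Bz.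
rewrite -(near_eq_derive v (nh z Az Bz)).
rewrite deriveE; last by apply: differentiable_pair; [exact: df1|exact: dg1].
rewrite (@diff_pair _ _ _ _ (f \o fst) (g \o snd)); [|exact: df1|exact: dg1].
rewrite (@diff_comp _ _ _ _ fst f); [|exact: d1|exact: fd].
rewrite (@diff_comp _ _ _ _ snd g); [|exact: d2|exact: gd].
rewrite /= (diff_lin _ (@fst_cont E F)) (diff_lin _ (@snd_cont E F)).
by rewrite !deriveE//; [exact: gd|exact: fd].
Qed.
End Smooth.

Section Atlas.
Context {R : realType}.

(* The functions are total; [cfwd] is meaningful on [cdom] and [cbwd] on the
   image of [cdom]. *)
Record chart (E : normedModType R) (T : topologicalType) := Chart {
  cdom : set T;
  cfwd : T -> E;
  cbwd : E -> T;
  cdom_open : open cdom;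
  ccod_open : open (cfwd @` cdom);
  cfwdK : forall x, cdom x -> cbwd (cfwd x) = x;
  cfwd_continuous : forall x, cdom x -> {for x, continuous cfwd};
  cbwd_continuous : forall y, (cfwd @` cdom) y -> {for y, continuous cbwd} }.

Definition smooth_transition E T (c d : chart E T) : Prop :=
  smooth_on (cfwd c @` (cdom c `&` cdom d)) (cfwd d \o cbwd c).

Record atlas (E : normedModType R) (T : topologicalType) := Atlas {
  charts : set (chart E T);
  chart_at : T -> chart E T;
  charts_chart_at : forall x, charts (chart_at x);
  cdom_chart_at : forall x, cdom (chart_at x) x;
  charts_transition : forall c d, charts c -> charts d ->
    smooth_transition c d }.

(* c belongs to the maximal atlas generated by A *)
Definition compatible E T (A : atlas E T) (c : chart E T) : Prop :=
  forall d, charts A d -> smooth_transition c d /\ smooth_transition d c.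

Definition manifold_space (T : topologicalType) : Prop :=
  hausdorff_space T /\ @second_countable T.

Lemma cfwd_open E S (c : chart E S) (V : set S) :
  open V -> open (cfwd c @` (cdom c `&` V)).
Proof.
move=> oV; rewrite openE => _ [x [cx Vx] <-].
have cfx : (cfwd c @` cdom c) (cfwd c x) by exists x.
have nV : nbhs (cfwd c x) (cbwd c @^-1` V).
  apply: (cbwd_continuous cfx).
  by rewrite cfwdK//; exact: open_nbhs_nbhs.
have nD : nbhs (cfwd c x) (cfwd c @` cdom c).
  by apply: open_nbhs_nbhs; split => //; exact: ccod_open.
apply: filterS2 nV nD => y /= Vy [z cz yE]; rewrite -yE in Vy *.
by exists z => //; split => //; move: Vy; rewrite cfwdK.
Qed.

Section Product.
Context {E F : normedModType R} {S T : topologicalType}.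

Let pfwd (c : chart E S) (d : chart F T) (z : S * T) : (E * F)%type :=
  (cfwd c z.1, cfwd d z.2).
Let pbwd (c : chart E S) (d : chart F T) (z : (E * F)%type) : S * T :=
  (cbwd c z.1, cbwd d z.2).

Let pfwd_image c d (A : set S) (B : set T) :
  pfwd c d @` (A `*` B) = (cfwd c @` A) `*` (cfwd d @` B).
Proof.
apply/seteqP; split => [_ [[a b] [/= Aa Bb] <-]|[y z] [/= [a Aa <-] [b Bb <-]]].
  by split => /=; [exists a|exists b].
by exists (a, b).
Qed.

Let setX_open (U V : topologicalType) (A : set U) (B : set V) :
  open A -> open B -> open (A `*` B).
Proof.
move=> oA oB; rewrite openE => -[u v] [/= Au Bv].
by exists (A, B) => //=; split; exact: open_nbhs_nbhs.
Qed.

Let pdom_open (c : chart E S) (d : chart F T) : open (cdom c `*` cdom d).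
Proof. by apply: setX_open; exact: cdom_open. Qed.

Let pcod_open (c : chart E S) (d : chart F T) :
  open (pfwd c d @` (cdom c `*` cdom d)).
Proof. by rewrite pfwd_image; apply: setX_open; exact: ccod_open. Qed.

Let pfwdK (c : chart E S) (d : chart F T) z :
  (cdom c `*` cdom d) z -> pbwd c d (pfwd c d z) = z.
Proof. by case: z => a b [/= ca db]; rewrite /pbwd/= !cfwdK. Qed.

Let pfwd_continuous (c : chart E S) (d : chart F T) z :
  (cdom c `*` cdom d) z -> {for z, continuous (pfwd c d)}.
Proof.
case: z => a b [/= ca db]; apply: cvg_pair => /=.
  by apply: (cvg_comp fst (cfwd c)); [exact: cvg_fst|exact: cfwd_continuous].
by apply: (cvg_comp snd (cfwd d)); [exact: cvg_snd|exact: cfwd_continuous].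
Qed.

Let pbwd_continuous (c : chart E S) (d : chart F T) z :
  (pfwd c d @` (cdom c `*` cdom d)) z -> {for z, continuous (pbwd c d)}.
Proof.
rewrite pfwd_image; case: z => a b [/= ca db]; apply: cvg_pair => /=.
  by apply: (cvg_comp fst (cbwd c)); [exact: cvg_fst|exact: cbwd_continuous].
by apply: (cvg_comp snd (cbwd d)); [exact: cvg_snd|exact: cbwd_continuous].
Qed.

Definition prod_chart (c : chart E S) (d : chart F T) :
    chart (E * F)%type (S * T)%type :=
  Chart (@pdom_open c d) (@pcod_open c d) (@pfwdK c d)
    (@pfwd_continuous c d) (@pbwd_continuous c d).

Variables (A : atlas E S) (B : atlas F T).

Let pcharts : set (chart (E * F)%type (S * T)%type) :=
  [set e | exists c d, [/\ charts A c, charts B d & e = prod_chart c d]].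

Let pchart_at (z : S * T) := prod_chart (chart_at A z.1) (chart_at B z.2).

Let pcharts_chart_at z : pcharts (pchart_at z).
Proof.
exists (chart_at A z.1), (chart_at B z.2).
by split => //; exact: charts_chart_at.
Qed.

Let pcdom_chart_at z : cdom (pchart_at z) z.
Proof. by split; exact: cdom_chart_at. Qed.

Let pcharts_transition e e' : pcharts e -> pcharts e' ->
  smooth_transition e e'.
Proof.
move=> [c [d [Ac Bd ->]]] [c' [d' [Ac' Bd' ->]]] k /=.
have -> : (cdom c `*` cdom d) `&` (cdom c' `*` cdom d') =
    (cdom c `&` cdom c') `*` (cdom d `&` cdom d').
  by rewrite setXI.
rewrite pfwd_image.
apply: (@Ck_on_prod _ _ _ _ _ _ _ _ (cfwd c' \o cbwd c) (cfwd d' \o cbwd d)).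
- by apply: cfwd_open; exact: cdom_open.
- by apply: cfwd_open; exact: cdom_open.
- by [].
- exact: (charts_transition Ac Ac').
- exact: (charts_transition Bd Bd').
Qed.

Definition prod_atlas : atlas (E * F)%type (S * T)%type :=
  Atlas pcharts_chart_at pcdom_chart_at pcharts_transition.

End Product.
End Atlas.

Section Geometry.
Context {R : realType}.

Definition smooth_map (E F : normedModType R) (S T : topologicalType)
    (A : atlas E S) (B : atlas F T) (f : S -> T) : Prop :=
  continuous f /\
  forall c d, charts A c -> charts B d ->
    smooth_on (cfwd c @` (cdom c `&` f @^-1` cdom d)) (cfwd d \o f \o cbwd c).

(* differential of f at x, as a map between tangent spaces *)
Definition dmap (E F : normedModType R) (S T : topologicalType)
    (A : atlas E S) (B : atlas F T) (f : S -> T) (x : S) : E -> F :=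
  'd (cfwd (chart_at B (f x)) \o f \o cbwd (chart_at A x))
     (cfwd (chart_at A x) x).

Section Metric.
Context {E : normedModType R} {T : topologicalType} (A : atlas E T).
Implicit Types (g : T -> E -> E -> R) (c : chart E T) (y : E) (W : set T).

(* the tangent vector at [cbwd c y] whose components in the chart c are u *)
Definition tangent_of_chart c y (u : E) : E :=
  'd (cfwd (chart_at A (cbwd c y)) \o cbwd c) y u.

Definition chart_metric c g y (u v : E) : R :=
  g (cbwd c y) (tangent_of_chart c y u) (tangent_of_chart c y v).

(* g is a Riemannian metric on the open set W; its values outside W are
   irrelevant. *)
Record riemannian_metric W g : Prop := RiemannianMetric {
  metric_linear : forall x, W x -> forall (k : R) u v w,
    g x (k *: u + v) w = k * g x u w + g x v w;
  metric_sym : forall x, W x -> forall u v, g x u v = g x v u;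
  metric_gt0 : forall x, W x -> forall u, u != 0 -> 0 < g x u u;
  metric_smooth : forall c, charts A c -> forall u v,
    smooth_on (cfwd c @` (cdom c `&` W)) (fun y => chart_metric c g y u v) }.

(* Christoffel symbols of the first kind at x, in the chart [chart_at A x] *)
Definition christoffel g (x : T) (u v w : E) : R :=
  let D (a b d : E) := 'D_a (fun y => chart_metric (chart_at A x) g y b d)
                         (cfwd (chart_at A x) x) in
  (D u v w + D v u w - D w u v) / 2.

Definition smooth_curve (I : set R) (gamma : R -> T) : Prop :=
  (forall t, I t -> {for t, continuous gamma}) /\
  forall c, charts A c ->
    smooth_on (I `&` gamma @^-1` cdom c : set R^o) (cfwd c \o gamma).

Definition velocity (gamma : R -> T) (t : R) : E :=
  derive1 (cfwd (chart_at A (gamma t)) \o gamma) t.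

Definition acceleration (gamma : R -> T) (t : R) : E :=
  derive1n 2 (cfwd (chart_at A (gamma t)) \o gamma) t.

(* I is meant to be open. The left-hand side of the equation is
   g(nabla_(gamma') gamma', w), for the Levi-Civita connection nabla of g:
   this is the geodesic equation x''^k + Gamma^k_ij x'^i x'^j = 0 with the
   index k lowered. *)
Definition geodesic g (I : set R) (gamma : R -> T) : Prop :=
  smooth_curve I gamma /\
  forall t, I t -> forall w : E,
    g (gamma t) (acceleration gamma t) w
    + christoffel g (gamma t) (velocity gamma t) (velocity gamma t) w = 0.

(* geodesic completeness *)
Definition complete_metric g : Prop :=
  forall (x : T) (v : E), exists gamma : R -> T,
    [/\ geodesic g setT gamma, gamma 0 = x & velocity gamma 0 = v].

End Metric.

Section Maps.
Context {E F : normedModType R} {S T : topologicalType}.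
Variables (A : atlas E S) (B : atlas F T).
Implicit Types (f : S -> T) (g : S -> E -> E -> R) (h : T -> F -> F -> R).

Definition pullback_metric f h (x : S) (u v : E) : R :=
  h (f x) (dmap A B f x u) (dmap A B f x v).

Definition isometric f g h : Prop :=
  forall x u v, pullback_metric f h x u v = g x u v.

Definition submersion f : Prop :=
  smooth_map A B f /\
  forall (x : S) (w : F), exists u : E, dmap A B f x u = w.

Definition horizontal f g (x : S) : set E :=
  [set u | forall v, dmap A B f x v = 0 -> g x u v = 0].

Definition riemannian_submersion f g h : Prop :=
  submersion f /\
  forall x u v, horizontal f g x u -> horizontal f g x v ->
    h (f x) (dmap A B f x u) (dmap A B f x v) = g x u v.

Definition embedding f : Prop :=
  [/\ smooth_map A B f,
      forall x, injective (dmap A B f x),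
      injective f &
      forall O : set S, open O ->
        exists2 O' : set T, open O' & f @` O = range f `&` O'].

(* f is a Riemannian embedding of (S, g) into the open submanifold W of T
   endowed with the metric h *)
Definition riemannian_embedding (W : set T) f g h : Prop :=
  [/\ embedding f, range f `<=` W & isometric f g h].

(* For an embedding f whose image lies where h is a metric: every geodesic of
   the image, for the metric induced by h, is a geodesic of h. The image is
   parametrized by f, and the induced metric is then the pullback of h. *)
Definition totally_geodesic_image f h : Prop :=
  forall (I : set R) (gamma : R -> S), open I -> is_interval I ->
    geodesic A (pullback_metric f h) I gamma -> geodesic B h I (f \o gamma).

End Maps.

(* l^2 g + h on the product *)
Definition scaled_prod_metric (E F : normedModType R) (S T : topologicalType)
    (l : R) (g : S -> E -> E -> R) (h : T -> F -> F -> R)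
    (z : S * T) (u v : E * F) : R :=
  l ^+ 2 * g z.1 u.1 v.1 + h z.2 u.2 v.2.

(* the b-orthogonal projection of v on the subspace S *)
Definition orth_proj (E : normedModType R) (b : E -> E -> R) (S : set E)
    (v : E) : E :=
  xget 0 [set u | S u /\ forall w, S w -> b (v - u) w = 0].

Definition partial_derivs n (f : 'rV[R]_n -> R) (s : seq 'I_n) :
    'rV[R]_n -> R :=
  foldr (fun i (h : 'rV[R]_n -> R) y => 'D_(delta_mx 0 i) h y) f s.

(* c is a finite atlas of the open set U *)
Definition finite_atlas n (T : topologicalType) (A : atlas 'rV[R]_n T)
    (U : set T) N (c : 'I_N -> chart 'rV[R]_n T) : Prop :=
  (forall i, compatible A (c i)) /\ U `<=` \bigcup_i cdom (c i).

(* C^p convergence on U of the metrics [gl l] to g as l tends to 0+: uniform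
   convergence of the components in the charts c i, and of their partial
   derivatives up to order p *)
Definition Cp_converges n (T : topologicalType) (A : atlas 'rV[R]_n T)
    (U : set T) N (c : 'I_N -> chart 'rV[R]_n T) (p : nat)
    (gl : R -> T -> 'rV[R]_n -> 'rV[R]_n -> R)
    (g : T -> 'rV[R]_n -> 'rV[R]_n -> R) : Prop :=
  forall (i : 'I_N) (j k : 'I_n) (s : seq 'I_n), (size s <= p)%N ->
    let comp h y := chart_metric A (c i) h y (delta_mx 0 j) (delta_mx 0 k) in
    forall e : R, 0 < e -> \forall l \near 0^'+,
      forall y, (cfwd (c i) @` (cdom (c i) `&` U)) y ->
        `|partial_derivs (comp (gl l)) s y - partial_derivs (comp g) s y| < e.

End Geometry.

Definition lie_group (R : realType) (E : normedModType R) (G : topGroupType)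
    (A : atlas E G) : Prop :=
  [/\ manifold_space G,
      smooth_map (prod_atlas A A) A (fun z : G * G => (z.1 * z.2)%g) &
      smooth_map A A (fun g : G => (g^-1)%g)].

Definition bi_invariant (R : realType) (E : normedModType R)
    (G : topGroupType) (A : atlas E G) (b : G -> E -> E -> R) : Prop :=
  forall g : G, isometric A A (fun h => (g * h)%g) b b /\
                isometric A A (fun h => (h * g)%g) b b.

Record group_action (G : groupType) (M : Type) := GroupAction {
  gact :> G -> M -> M;
  gact1 : forall x, gact 1%g x = x;
  gactM : forall g h x, gact (g * h)%g x = gact g (gact h x) }.

Section Action.
Context {G : topGroupType} {M : topologicalType} (a : group_action G M).

Definition isotropy (x : M) : set G := [set g | a g x = x].

Definition coset_rel (x : M) : rel G :=
  fun g h => `[< isotropy x (g^-1 * h)%g >].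

Lemma coset_relP x g h : reflect (a g x = a h x) (coset_rel x g h).
Proof.
apply: (iffP (asboolP _)); rewrite /isotropy/= gactM => e.
  by rewrite -[in LHS]e -gactM mulgV gact1.
by rewrite -e -gactM mulVg gact1.
Qed.

Lemma coset_rel_equiv x : equiv_class_of (coset_rel x).
Proof.
split=> [g|g h|g h k]; first exact/coset_relP.
- by apply/coset_relP/coset_relP.
- by move=> /coset_relP e1 /coset_relP e2; apply/coset_relP; rewrite e1.
Qed.

Definition coset_equiv x : equiv_rel G := EquivRelPack (coset_rel_equiv x).

Local Notation cosets x := {eq_quot (coset_equiv x)}%qT.

(* G / G_x, with the quotient topology *)
Definition coset_space (x : M) : topologicalType :=
  quotient_topology (cosets x).

Definition coset_proj (x : M) (g : G) : coset_space x :=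
  (\pi_(cosets x) g)%qT.

Definition orbit_map (x : M) (q : coset_space x) : M :=
  a (repr (q : cosets x)) x.

Lemma orbit_map_proj x g : orbit_map (coset_proj x g) = a g x.
Proof.
apply/coset_relP/(@eqmodP _ (coset_equiv x)).
by rewrite /coset_proj reprK.
Qed.

(* x lies on a principal orbit: up to conjugation, G_x is contained in the
   isotropy group G_y of every y close to x. When M / G is connected this is
   equivalent to the same condition for all y, but M need not be connected. *)
Definition principal (x : M) : Prop :=
  \forall y \near x, exists g : G, isotropy x `<=` isotropy (a g y).

Definition invariant_set (U : set M) : Prop := forall g x, U x -> U (a g x).

Context {R : realType} {E F : normedModType R}.
Variables (AG : atlas E G) (AM : atlas F M).

Definition smooth_action : Prop :=
  smooth_map (prod_atlas AG AM) AM (fun z : G * M => a z.1 z.2).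

Definition acts_by_isometries (g : M -> F -> F -> R) : Prop :=
  forall h : G, isometric AM AM (a h) g g.

(* T_xG(x): image of the differential at 1 of the orbit map of x *)
Definition orbit_tangent (x : M) : set F :=
  range (dmap AG AM (fun g : G => a g x) 1%g).

Definition rescaled_metric (l : R) (g : M -> F -> F -> R)
    (x : M) (u v : F) : R :=
  let P := orth_proj (g x) (orbit_tangent x) in
  l ^- 2 * g x (P u) (P v) + g x (u - P u) (v - P v).

End Action.

Arguments coset_proj {G M} a x g.
Arguments orbit_map {G M} a x q.

(* Main.v *)
(* Write X_M for the vector field on M induced by X in the Lie algebra of G. The
   action map (G * M, l^2 g_bi + g_M) -> (M, g_l) being a Riemannian submersion,
   linear algebra at (1, z) gives l^-2 g_l(X_M, X_M) <= g_bi(X, X) at z, with an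
   O(l^2) defect when X is orthogonal to the isotropy algebra of z. Hence the
   limit metric satisfies |X_M|^2 <= |X|^2 at every z, with equality when X is
   orthogonal to the isotropy algebra; this is the metric of G / G_x pushed to
   the orbit. At such an X and z, the function |X_M|^2 is maximal, so all its
   derivatives vanish. As the vectors normal to the orbits are preserved by the
   isometries of G, the geodesic curvature of exp(tX) z has no normal part,
   i.e. the second fundamental form of the orbit vanishes. That G / G_x -> M is
   an immersion comes from the constant rank of the equivariant map g |-> g x:
   a vector killed by its differential is tangent to a curve in G_x. *)
From HB Require Import structures.
Require Import Defs.
From mathcomp Require Import all_boot all_order all_algebra.
From mathcomp Require Import ring lra.
From mathcomp Require Import all_classical all_reals all_analysis.
Set Implicit Arguments.
Unset Strict Implicit.
Unset Printing Implicit Defensive.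
Import Order.TTheory GRing.Theory Num.Theory numFieldNormedType.Exports.
Local Open Scope classical_set_scope.
Local Open Scope ring_scope.

(** * Maps of class C^k *)

(** No exponential map is built: exp(tX) z is replaced by the image of a straight chart line of G
    through 1. Both curves have the same velocity, so their second derivatives differ by a vector
    tangent to the orbit, which the normal part does not see. No connection is built either: the
    geodesic equation with its index lowered is a functional linear in a test vector w. A w tangent
    to the orbit gives the equation of the induced metric. A gM-normal w = N is treated in a chart
    of G x M, where the partial derivatives of the action map commute. The mixed derivative D_X D_N
    of that map occurs once when g(X_M, hN) = 0 is differentiated along the orbit, and twice when
    |X_M|^2 is differentiated along N at its maximum; eliminating it leaves the lowered geodesic
    equation. Symmetry of second derivatives thus does the work of a torsion-free connection.
    Normality is always meant for gM, which is fixed while g_l varies; the limit inherits it because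
    (0, N) is horizontal for every l. *)

Section Calculus.
Context {R : realType}.
Implicit Types E F H : normedModType R.

Lemma derive_comp E F H (f : E -> F) (g : F -> H) x v :
  differentiable f x -> differentiable g (f x) ->
  'D_v (g \o f) x = 'D_('D_v f x) g (f x).
Proof.
move=> df dg; rewrite !deriveE//; last exact: differentiable_comp.
by rewrite diff_comp.
Qed.

(** Scaling is packed as a continuous bilinear map so that the differential of a bilinear map
    applies; [R^o] is R as a normed space. *)
Lemma derive_scalar_mul E (a : E -> R) F (f : E -> F) x :
  differentiable a x -> differentiable f x ->
  differentiable (fun y => a y *: f y) x /\
  forall v, 'D_v (fun y => a y *: f y) x = 'D_v a x *: f x + a x *: 'D_v f x.
Proof.
move=> da df.
pose b (k : R^o) (w : F) : F := k *: w.
have bb : bilinear_for (GRing.Scale.Law.clone _ _ *:%R _)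
    (GRing.Scale.Law.clone _ _ *:%R _) b.
  split=> [u'|u] c y z /=; rewrite /b.
    by rewrite scalerDl scalerA.
  by rewrite scalerDr !scalerA mulrC.
pose bM := bilinear_isBilinear.Build R R^o F F _ _ b bb.
pose B : {bilinear R^o -> F -> F} := HB.pack b bM.
have Bc : continuous (fun p : R^o * F => B p.1 p.2) by move=> p; exact: scale_continuous.
have dp : differentiable (fun y => (a y : R^o, f y)) x by exact: differentiable_pair.
have dB : differentiable (fun p : R^o * F => B p.1 p.2) (a x, f x).
  exact: differentiable_bilin.
split; first exact: (differentiable_comp dp dB).
move=> v.
have -> : (fun y => a y *: f y) = (fun p : R^o * F => B p.1 p.2) \o (fun y => (a y : R^o, f y)) by [].
rewrite derive_comp// (deriveE _ dB) diff_bilin//= /b deriveE// diff_pair//=.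
by rewrite addrC !deriveE.
Qed.

Lemma derive_lin_comp E F H (f : E -> F) (L : {linear F -> H}) x :
  continuous L -> differentiable f x ->
  differentiable (L \o f) x /\ forall v, 'D_v (L \o f) x = L ('D_v f x).
Proof.
move=> cL df; have dL : differentiable L (f x) by exact: linear_differentiable.
split; first exact: differentiable_comp.
by move=> v; rewrite derive_comp// deriveE// diff_lin.
Qed.

(** Lets [rewrite] unfold one level of the fixpoint without simplifying the rest of the goal. *)
Lemma Ck_on_succ E F k (D : set E) (f : E -> F) :
  Ck_on k.+1 D f = ((forall x, D x -> differentiable f x) /\
                    (forall v, Ck_on k D ('D_v f))).
Proof. by []. Qed.

Lemma Ck_on_sub E F k (D D' : set E) (f : E -> F) :
  D' `<=` D -> Ck_on k D f -> Ck_on k D' f.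
Proof.
move=> DD; elim: k f => [|k IH] f; rewrite ?Ck_on_succ; first by move=> fc x /DD/fc.
by move=> [fd fD]; split=> [x /DD/fd//|v]; exact: IH.
Qed.

Lemma Ck_on_near E F k (D : set E) (f g : E -> F) :
  (forall x, D x -> \forall y \near x, f y = g y) ->
  Ck_on k D f -> Ck_on k D g.
Proof.
elim: k f g => [|k IH] f g fg /=.
  move=> fc x Dx; have fgx := fg x Dx.
  rewrite /prop_for /continuous_at -(nbhs_singleton fgx).
  exact: cvg_trans (near_eq_cvg fgx) (fc x Dx).
move=> [fd fD]; split=> [x Dx|v].
  by apply: near_eq_differentiable (fg x Dx) _; exact: fd.
apply: IH (fD v) => x Dx.
have : nbhs x (fun y => \forall z \near y, f z = g z).
  exact/nbhs_interior/fg.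
by apply: filterS => y fgy; exact: near_eq_derive.
Qed.

Lemma Ck_on_eq E F k (D : set E) (f g : E -> F) :
  open D -> (forall x, D x -> f x = g x) -> Ck_on k D f -> Ck_on k D g.
Proof.
move=> oD fg; apply: Ck_on_near => x Dx.
by apply: filterS (open_nbhs_nbhs (conj oD Dx)) => y; exact: fg.
Qed.

Lemma Ck_on_local E F k (D : set E) (f : E -> F) :
  (forall x, D x -> exists2 D', D' x & Ck_on k D' f) -> Ck_on k D f.
Proof.
elim: k f => [|k IH] f loc; rewrite ?Ck_on_succ.
  by move=> x /loc [D' D'x /(_ x D'x)].
split=> [x /loc [D' D'x [/(_ x D'x)]]//|v].
by apply: IH => x /loc [D' D'x [_ /(_ v)]]; exists D'.
Qed.

Lemma Ck_on_pred E F k (D : set E) (f : E -> F) :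
  Ck_on k.+1 D f -> Ck_on k D f.
Proof.
elim: k f => [|k IH] f.
  by move=> /= [fd _] x Dx; exact/differentiable_continuous/fd.
by rewrite Ck_on_succ => -[fd fD]; rewrite Ck_on_succ; split=> // v; apply: IH; exact: fD.
Qed.

Lemma Ck_on_cst E F k (D : set E) (w : F) : Ck_on k D (fun=> w).
Proof.
elim: k w => [|k IH] w; rewrite ?Ck_on_succ; first by move=> x _; exact: cst_continuous.
split=> [x _|v]; first exact: differentiable_cst.
suff -> : 'D_v (fun _ : E => w) = fun=> 0 by exact: IH.
by apply/funext => x; rewrite derive_cst.
Qed.

Lemma Ck_on_add E F k (D : set E) (f g : E -> F) : open D ->
  Ck_on k D f -> Ck_on k D g -> Ck_on k D (fun x => f x + g x).
Proof.
move=> oD; elim: k f g => [|k IH] f g; rewrite ?Ck_on_succ.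
  by move=> fc gc x Dx; apply: continuousD; [exact: fc|exact: gc].
move=> [fd fD] [gd gD]; split=> [x Dx|v].
  by apply: differentiableD; [exact: fd|exact: gd].
apply: Ck_on_eq oD _ (IH _ _ (fD v) (gD v)) => x Dx.
by rewrite -deriveD//; apply: diff_derivable; [exact: fd|exact: gd].
Qed.

Lemma Ck_on_sum E F k (D : set E) (I : finType) (P : pred I) (f : I -> E -> F) :
  open D -> (forall i, Ck_on k D (f i)) ->
  Ck_on k D (fun x => \sum_(i | P i) f i x).
Proof.
move=> oD fC; elim: (index_enum I) => [|i s IH].
  by under eq_fun do rewrite big_nil; exact: Ck_on_cst.
under eq_fun do rewrite big_cons.
by case: (P i) => //; exact: Ck_on_add.
Qed.

Lemma Ck_on_scale E F k (D : set E) (a : E -> R) (f : E -> F) : open D ->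
  Ck_on k D a -> Ck_on k D f -> Ck_on k D (fun x => a x *: f x).
Proof.
move=> oD; elim: k a f => [|k IH] a f.
  by move=> ac fc x Dx; apply: cvgZ; [exact: ac|exact: fc].
move=> aS fS; have [aP fP] := (Ck_on_pred aS, Ck_on_pred fS).
move: aS fS; rewrite !Ck_on_succ => -[ad aD] [fd fD]; split=> [x Dx|v].
  by have [] := derive_scalar_mul (ad x Dx) (fd x Dx).
apply: (@Ck_on_eq _ _ _ _ (fun x => 'D_v a x *: f x + a x *: 'D_v f x) _ oD).
  by move=> x Dx; have [_ ->] := derive_scalar_mul (ad x Dx) (fd x Dx).
by apply: Ck_on_add => //; apply: IH.
Qed.

Lemma Ck_on_lin_comp E F H k (D : set E) (f : E -> F) (L : {linear F -> H}) :
  open D -> continuous L -> Ck_on k D f -> Ck_on k D (L \o f).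
Proof.
move=> oD cL; elim: k f => [|k IH] f; rewrite ?Ck_on_succ.
  by move=> fc x Dx; apply: continuous_comp; [exact: fc|exact: cL].
move=> [fd fD]; split=> [x Dx|v].
  by have [] := derive_lin_comp cL (fd x Dx).
apply: Ck_on_eq oD _ (IH _ (fD v)) => x Dx.
by have [_ ->] := derive_lin_comp cL (fd x Dx).
Qed.

Lemma Ck_on_id E k (D : set E) : Ck_on k D id.
Proof.
case: k => [|k]; rewrite ?Ck_on_succ; first by move=> x _; exact: cvg_id.
split=> [x _|v]; first exact: ex_diff.
have -> : 'D_v (id : E -> E) = fun=> v by apply/funext => x; rewrite derive_id.
exact: Ck_on_cst.
Qed.

(* Finite bases, in a form which covers both row vectors and their products. *)
Definition framed E := exists (I : finType) (e : I -> E)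
    (xi : I -> {linear E -> R^o}),
  (forall i, continuous (xi i)) /\ forall x, x = \sum_i xi i x *: e i.

Definition row_coord n (j : 'I_n) (v : 'rV[R]_n) : R^o := v ord0 j.

Fact row_coord_is_linear n (j : 'I_n) : linear (row_coord j).
Proof. by move=> k u v; rewrite /row_coord !mxE. Qed.

HB.instance Definition _ n (j : 'I_n) :=
  GRing.isLinear.Build R 'rV[R]_n R^o _ (row_coord j) (row_coord_is_linear j).

Lemma row_coord_continuous n (j : 'I_n) : continuous (row_coord j).
Proof. exact: coord_continuous. Qed.

Lemma framed_rV n : framed 'rV[R]_n.
Proof.
exists 'I_n, (fun j => delta_mx 0 j), (fun j => row_coord j : {linear _ -> _}).
split; first by move=> j; exact: row_coord_continuous.
by move=> x; rewrite [LHS]row_sum_delta.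
Qed.

Lemma framed_prod E F : framed E -> framed F -> framed (E * F)%type.
Proof.
move=> [I [e [xi [cxi sxi]]]] [J [f [eta [ceta seta]]]].
have l1 : linear (fst : E * F -> E) by [].
have l2 : linear (snd : E * F -> F) by [].
pose L1 : {linear (E * F)%type -> E} := HB.pack (fst : E * F -> E) (GRing.isLinear.Build _ _ _ _ _ l1).
pose L2 : {linear (E * F)%type -> F} := HB.pack (snd : E * F -> F) (GRing.isLinear.Build _ _ _ _ _ l2).
exists (I + J)%type, (fun k => match k with inl i => (e i, 0) | inr j => (0, f j) end),
  (fun k => match k with inl i => (xi i \o L1 : {linear _ -> _}) | inr j => (eta j \o L2 : {linear _ -> _}) end).
split=> [[i|j] z|z].
- by apply: (cvg_comp fst (xi i)); [exact: cvg_fst|exact: cxi].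
- by apply: (cvg_comp snd (eta j)); [exact: cvg_snd|exact: ceta].
rewrite big_sumType/=.
have s1 (s : seq I) : \sum_(i <- s) xi i z.1 *: (e i, 0 : F) = (\sum_(i <- s) xi i z.1 *: e i, 0).
  elim: s => [|i s IH]; first by rewrite !big_nil.
  by rewrite !big_cons IH; congr pair; rewrite /= ?scaler0 ?addr0.
have s2 (s : seq J) : \sum_(i <- s) eta i z.2 *: (0 : E, f i) = (0, \sum_(i <- s) eta i z.2 *: f i).
  elim: s => [|i s IH]; first by rewrite !big_nil.
  by rewrite !big_cons IH; congr pair; rewrite /= ?scaler0 ?addr0.
rewrite s1 s2 -sxi -seta; clear; case: z => a b; congr pair; rewrite /= ?addr0 ?add0r//.
Qed.

Lemma derive_sum_dir E F (I : finType) (f : E -> F) x (k : I -> R) (e : I -> E) :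
  differentiable f x ->
  'D_(\sum_i k i *: e i) f x = \sum_i k i *: 'D_(e i) f x.
Proof.
move=> df; rewrite deriveE// linear_sum; apply: eq_bigr => i _.
by rewrite linearZ deriveE.
Qed.

(** The chain rule differentiates g in the direction D_v f x, which moves with x. The frame of F
    expands it into finitely many fixed directions with C^k coefficients, and the induction
    hypothesis applies to each derivative of g. *)
Lemma Ck_on_comp E F H k (D : set E) (D' : set F) (f : E -> F) (g : F -> H) :
  framed F -> open D -> (forall x, D x -> D' (f x)) ->
  Ck_on k D f -> Ck_on k D' g -> Ck_on k D (g \o f).
Proof.
move=> [I [e [xi [cxi sxi]]]] oD DD; elim: k f g DD => [|k IH] f g DD.
  move=> fc gc x Dx; apply: continuous_comp; first exact: fc.
  by apply: gc; exact: DD.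
move=> fS gS; have [fP gP] := (Ck_on_pred fS, Ck_on_pred gS).
move: fS gS; rewrite !Ck_on_succ => -[fd fD] [gd gD]; split=> [x Dx|v].
  by apply: differentiable_comp; [exact: fd|exact/gd/DD].
apply: (@Ck_on_eq _ _ _ _ (fun x => \sum_i xi i ('D_v f x) *: 'D_(e i) g (f x)) _ oD).
  move=> x Dx; rewrite derive_comp; [|exact: fd|exact/gd/DD].
  rewrite [in RHS](sxi ('D_v f x)) derive_sum_dir//; exact/gd/DD.
apply: Ck_on_sum => // i; apply: Ck_on_scale => //.
  exact: (Ck_on_lin_comp oD (cxi i) (fD v)).
exact: (IH f ('D_(e i) g)).
Qed.

Lemma smooth_on_comp E F H (D : set E) (D' : set F) (f : E -> F) (g : F -> H) :
  framed F -> open D -> (forall x, D x -> D' (f x)) ->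
  smooth_on D f -> smooth_on D' g -> smooth_on D (g \o f).
Proof. by move=> fF oD DD sf sg k; exact: (Ck_on_comp fF oD DD). Qed.

Lemma smooth_on_diff E F (D : set E) (f : E -> F) x :
  smooth_on D f -> D x -> differentiable f x.
Proof. by move=> /(_ 1%N) [+ _]; exact. Qed.

Lemma smooth_on_cont E F (D : set E) (f : E -> F) x :
  smooth_on D f -> D x -> {for x, continuous f}.
Proof. by move=> /(_ 0%N); exact. Qed.

Lemma smooth_on_derive E F (D : set E) (f : E -> F) v :
  smooth_on D f -> smooth_on D ('D_v f).
Proof. by move=> sf k; have [_] := sf k.+1; exact. Qed.

Lemma Ck_on_inv E k (D : set E) (a : E -> R) : open D ->
  (forall x, D x -> a x != 0) -> Ck_on k D a -> Ck_on k D (fun x => (a x)^-1).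
Proof.
move=> oD a0; elim: k => [|k IH].
  by move=> ac x Dx; apply: cvgV; [exact: a0|exact: ac].
move=> aS; have aP := Ck_on_pred aS; move: aS; rewrite !Ck_on_succ => -[ad aD]; split=> [x Dx|v].
  by apply: differentiableV; [exact: ad|exact: a0].
apply: (@Ck_on_eq _ _ _ _ (fun x => (- 1) *: ((a x)^-1 *: ((a x)^-1 *: ('D_v a x : R^o)))) _ oD).
  move=> x Dx; rewrite deriveV; [|exact: a0|exact/diff_derivable/ad].
  by rewrite scaleN1r scaleNr scalerA -invfM -expr2.
have Ia := IH aP.
apply: Ck_on_scale => //; first exact: Ck_on_cst.
by apply: Ck_on_scale => //; apply: Ck_on_scale.
Qed.

Lemma Ck_on_mul E k (D : set E) (a b : E -> R) : open D ->
  Ck_on k D a -> Ck_on k D b -> Ck_on k D (fun x => a x * b x).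
Proof. exact: (@Ck_on_scale E R^o). Qed.

Lemma Ck_on_prod_ord E k (D : set E) (I : finType) (f : I -> E -> R) :
  open D -> (forall i, Ck_on k D (f i)) ->
  Ck_on k D (fun x => \prod_i f i x).
Proof.
move=> oD fC; elim: (index_enum I) => [|i s IH].
  by under eq_fun do rewrite big_nil; exact: Ck_on_cst.
under eq_fun do rewrite big_cons.
exact: Ck_on_mul.
Qed.

Lemma Ck_on_det E k (D : set E) n (A : E -> 'M[R]_n) : open D ->
  (forall i j, Ck_on k D (fun x => A x i j)) -> Ck_on k D (fun x => \det (A x)).
Proof.
move=> oD AC; rewrite /determinant; apply: Ck_on_sum => // s.
by apply: Ck_on_mul => //; [exact: Ck_on_cst|exact: Ck_on_prod_ord].
Qed.

Lemma Ck_on_invmx E k (D : set E) n (A : E -> 'M[R]_n) i j : open D ->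
  (forall x, D x -> A x \in unitmx) ->
  (forall i j, Ck_on k D (fun x => A x i j)) ->
  Ck_on k D (fun x => invmx (A x) i j).
Proof.
move=> oD Au AC.
apply: (@Ck_on_eq _ _ _ _ (fun x => (\det (A x))^-1 * \adj (A x) i j) _ oD).
  by move=> x Dx; rewrite /invmx Au// !mxE.
apply: Ck_on_mul => //.
  apply: Ck_on_inv => //; last exact: Ck_on_det.
  by move=> x /Au; rewrite unitmxE unitfE.
under eq_fun do rewrite !mxE /cofactor.
apply: Ck_on_mul => //; first exact: Ck_on_cst.
apply: Ck_on_det => // i' j'.
by under eq_fun do rewrite !mxE.
Qed.

Lemma Ck_on_row E n k (D : set E) (f : E -> 'rV[R]_n) : open D ->
  (forall j, Ck_on k D (fun x => f x 0 j)) -> Ck_on k D f.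
Proof.
move=> oD fC.
apply: (@Ck_on_eq _ _ _ _ (fun x => \sum_j f x 0 j *: delta_mx 0 j) _ oD).
  by move=> x _; rewrite -row_sum_delta.
apply: Ck_on_sum => // j; apply: Ck_on_scale => //; exact: Ck_on_cst.
Qed.

Lemma Ck_on_coord E n k (D : set E) (f : E -> 'rV[R]_n) j : open D ->
  Ck_on k D f -> Ck_on k D (fun x => f x 0 j).
Proof.
move=> oD; exact: (@Ck_on_lin_comp _ _ R^o k D f (row_coord j) oD (@row_coord_continuous n j)).
Qed.

Lemma Ck_on_pair E F H k (D : set E) (f : E -> F) (g : E -> H) : open D ->
  Ck_on k D f -> Ck_on k D g -> Ck_on k D (fun x => (f x, g x)).
Proof.
move=> oD; elim: k f g => [|k IH] f g; rewrite ?Ck_on_succ.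
  by move=> fc gc x Dx; apply: cvg_pair; [exact: fc|exact: gc].
move=> [fd fD] [gd gD]; split=> [x Dx|v].
  by apply: differentiable_pair; [exact: fd|exact: gd].
apply: Ck_on_eq oD _ (IH _ _ (fD v) (gD v)) => x Dx.
rewrite [in RHS]deriveE; last by apply: differentiable_pair; [exact: fd|exact: gd].
rewrite diff_pair; [|exact: fd|exact: gd].
by rewrite !deriveE//; [exact: gd|exact: fd].
Qed.

End Calculus.

(** * Symmetry of second derivatives and strict differentiability *)

Section Inverse.
Context {R : realType}.
Implicit Types E F H : normedModType R.

Lemma nbhs_normltP E (x : E) (P : set E) :
  nbhs x P <-> exists2 r : R, 0 < r & forall y, `|y - x| < r -> P y.
Proof.
split=> [/nbhs_ballP [r r0 rP]|[r r0 rP]].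
  by exists r => // y yx; apply: rP; rewrite -ball_normE/= distrC.
by apply/nbhs_ballP; exists r => // y; rewrite -ball_normE/= distrC => /rP.
Qed.

Lemma derive_line E F (g : E -> F) y w (t : R) :
  differentiable g (y + t *: w) ->
  differentiable (fun s : R => g (y + s *: w)) t /\
  'D_1 (fun s : R => g (y + s *: w)) t = 'D_w g (y + t *: w).
Proof.
move=> dg.
have dl : is_diff t (fun s : R => y + s *: w) (0 + *:%R^~ w) by exact: is_diffD.
have dl' : differentiable (fun s : R => y + s *: w) t by exact: ex_diff.
split; first exact: (differentiable_comp dl').
rewrite (@derive_comp _ _ _ _ (fun s : R => y + s *: w) g)//.
by rewrite (deriveE _ dl') diff_val/= !fctE add0r scale1r.
Qed.

Lemma derive_line0 E F (g : E -> F) y w : differentiable g y ->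
  differentiable (fun s : R => g (y + s *: w)) 0 /\
  'D_1 (fun s : R => g (y + s *: w)) 0 = 'D_w g y.
Proof.
move=> dg; have := @derive_line E F g y w 0.
by rewrite scale0r addr0; exact.
Qed.

Lemma derive0_at_max (f : R -> R) : differentiable f 0 ->
  (\forall s \near (0 : R), f s <= f 0) -> 'D_1 f 0 = 0.
Proof.
move=> df fmax; set d := 'D_1 f 0; apply/eqP/negPn/negP => d0.
have dE (h : R) : 'd f 0 h = h * d.
  rewrite /d deriveE// -[in LHS](mulr1 h).
  by rewrite -[h * 1]/(h *: (1 : R^o)) linearZ.
have [_ fE] := (diff_locallyP _ _).1 df.
have e0 : 0 < `|d| / 2 by rewrite divr_gt0// normr_gt0.
move/eqaddoP : fE => /(_ _ e0) fE.
have : nbhs (0 : R) (fun h : R => `|f h - f 0 - h * d| <= `|d| / 2 * `|h| /\ f h <= f 0).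
  apply: filterI fmax; apply: filterS fE => h.
  by rewrite /= !fctE /= addr0 dE opprD addrA.
move=> /nbhs_normltP[r r0 rP].
(* A step along the sign of d gains |d| |h| to first order, and the error is at most half of that,
   so f h > f 0. *)
pose h := Num.sg d * (r / 2).
have hn : `|h| = r / 2.
  by rewrite normrM normr_sg d0 mul1r ger0_norm// divr_ge0// ltW.
have hd : h * d = `|h| * `|d|.
  by rewrite hn (normrEsg d) /h mulrAC mulrC.
have [|] := rP h; first by rewrite subr0 hn ltr_pdivrMr// mulr_natr mulr2n ltrDl.
rewrite hd => /ler_normlP[a1 _] a2.
have : 0 < `|d| / 2 * `|h| by rewrite mulr_gt0// hn divr_gt0.
lra.
Qed.

Lemma line_mvt E (g : E -> R) y w (h : R) : 0 < h ->
  (forall t, 0 <= t <= h -> differentiable g (y + t *: w)) ->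
  exists2 t, 0 < t < h & g (y + h *: w) - g y = h * 'D_w g (y + t *: w).
Proof.
move=> h0 dg.
have [|t|t th E1] := @MVT R (fun s => g (y + s *: w))
    (fun t => 'D_w g (y + t *: w)) 0 h h0.
- move=> t; rewrite in_itv/= => /andP[t0 th].
  have [] := derive_line (dg t _); first by rewrite !ltW.
  by move=> dt <-; split => //; exact: diff_derivable.
- apply: continuous_in_subspaceT => s; rewrite inE/= in_itv/= => sh.
  by have [/differentiable_continuous] := derive_line (dg s sh).
exists t; first by move: th; rewrite in_itv.
by move: E1; rewrite scale0r addr0 subr0 mulrC.
Qed.

Lemma row_norm_le n (v : 'rV[R]_n) c :
  0 <= c -> (forall j, `|v 0 j| <= c) -> `|v| <= c.
Proof.
move=> c0 vc; rewrite [leLHS]/Num.Def.normr/= mx_normrE.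
by apply: bigmax_le => // -[i j] _ /=; rewrite ord1.
Qed.

Lemma coord_norm_le n (v : 'rV[R]_n) j : `|v 0 j| <= `|v|.
Proof.
rewrite [leRHS]/Num.Def.normr/= mx_normrE.
exact: (le_bigmax _ (fun ij : 'I_1 * 'I_n => `|v ij.1 ij.2|) (0, j)).
Qed.

(** Mean value theorem twice: along a for y |-> f (y + h b) - f y, then along b for D_a f. The
    left-hand side is symmetric in a and b, whence Schwarz's theorem. The choice of h keeps the
    parallelogram in the ball of radius r; the 1 avoids a zero denominator. *)
Lemma second_difference E (D : set E) (f : E -> R) x a b (r : R) :
  (forall y, D y -> differentiable f y) ->
  (forall y, D y -> differentiable ('D_a f) y) ->
  0 < r -> (forall y, `|y - x| < r -> D y) ->
  let h := r / (2 * (`|a| + `|b| + 1)) in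
  exists2 p, `|p - x| < r &
    f (x + h *: a + h *: b) - f (x + h *: a) - f (x + h *: b) + f x =
    h * (h * 'D_b ('D_a f) p).
Proof.
move=> fd fad r0 rD h.
pose c := `|a| + `|b| + 1; have c0 : 0 < c by rewrite /c ltr_wpDl// addr_ge0.
have h0 : 0 < h by rewrite divr_gt0// mulr_gt0.
have small (s t : R) : 0 <= s <= h -> 0 <= t <= h -> `|x + s *: a + t *: b - x| < r.
  move=> /andP[s0 sh] /andP[t0 th].
  have -> : x + s *: a + t *: b - x = s *: a + t *: b.
    by rewrite addrAC (addrAC x) subrr add0r.
  have : `|s *: a + t *: b| <= h * c.
    apply: le_trans (ler_normD _ _) _; rewrite !normrZ (ger0_norm s0) (ger0_norm t0).
    rewrite /c 2!mulrDr mulr1; apply: ler_wpDr; first exact: ltW.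
    by apply: lerD; exact: ler_wpM2r.
  move/le_lt_trans; apply.
  rewrite /h -/c invfM mulrA -mulrA mulVf ?gt_eqF// mulr1.
  by rewrite ltr_pdivrMr// mulr_natr mulr2n ltrDl.
pose g y := f (y + h *: b) - f y.
have hh : 0 <= h <= h by rewrite lexx ltW.
have z0 : 0 <= (0:R) <= h by rewrite lexx ltW.
have dgs (s : R) : 0 <= s <= h -> differentiable g (x + s *: a) /\
    'D_a g (x + s *: a) = 'D_a f (x + s *: a + h *: b) - 'D_a f (x + s *: a).
  move=> sh.
  have D1 : differentiable f (x + s *: a + h *: b) by apply: fd; apply: rD; exact: small.
  have D2 : differentiable f (x + s *: a).
    by apply: fd; apply: rD; move: (small s 0 sh z0); rewrite scale0r addr0.
  have dsh : is_diff (x + s *: a) (fun y => y + h *: b) (id + 0) by exact: is_diffD.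
  have dsh' : differentiable (fun y => y + h *: b) (x + s *: a) by exact: ex_diff.
  have D3 : differentiable (f \o (fun y => y + h *: b)) (x + s *: a) by exact: differentiable_comp.
  split; first exact: (differentiableB D3 D2).
  rewrite -[g]/((f \o (fun y => y + h *: b)) - f) deriveB; [|exact: diff_derivable..].
  rewrite derive_comp//; congr ('D_ _ _ _ - _).
  by rewrite deriveE// diff_val/= !fctE addr0.
have [s sh E1] : exists2 s, 0 < s < h & g (x + h *: a) - g x = h * 'D_a g (x + s *: a).
  by apply: line_mvt => // t th; have [] := dgs t th.
have sh' : 0 <= s <= h by case/andP: sh => ? ?; rewrite !ltW.
have fab t : 0 <= t <= h -> differentiable ('D_a f) (x + s *: a + t *: b).
  by move=> th; apply: fad; apply: rD; exact: small.
have [t th E2] := line_mvt h0 fab.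
have th' : 0 <= t <= h by case/andP: th => ? ?; rewrite !ltW.
exists (x + s *: a + t *: b); first exact: small.
rewrite -E2; have [_ <-] := dgs s sh'; rewrite -E1 /g.
by rewrite opprB addrA addrAC.
Qed.

(** The mean value theorem gives the two mixed derivatives at different points p and q; continuity
    brings both back to x. *)
Lemma continuous_eq_of_near_points E (P Q : E -> R) (D : set E) x :
  open D -> D x -> {for x, continuous P} -> {for x, continuous Q} ->
  (forall r : R, 0 < r -> (forall y, `|y - x| < r -> D y) ->
    exists p q, [/\ `|p - x| < r, `|q - x| < r & P p = Q q]) -> P x = Q x.
Proof.
move=> oD Dx cP cQ key.
apply/eqP/negP => /negP ne.
pose e : R := `|P x - Q x| / 2.
have e0 : 0 < e by rewrite divr_gt0// normr_gt0 subr_eq0.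
have n1 : nbhs x (fun y => `|P x - P y| < e) by move/cvgrPdist_lt : cP; apply.
have n2 : nbhs x (fun y => `|Q x - Q y| < e) by move/cvgrPdist_lt : cQ; apply.
have n3 : nbhs x (D `&` ((fun y => `|P x - P y| < e) `&` (fun y => `|Q x - Q y| < e))).
  by apply: filterI; [exact: open_nbhs_nbhs|exact: filterI].
move: n3 => /nbhs_normltP[r r0 rP].
have [p [q [/rP[_ [p1 _]] /rP[_ [_ q2]] pq]]] := key r r0 (fun y yr => (rP y yr).1).
move: (ltrD p1 q2); rewrite pq (distrC (Q x)).
move=> /(le_lt_trans (ler_normD _ _)).
by rewrite /e -splitr addrA subrK ltxx.
Qed.

Lemma schwarz_scalar E (D : set E) (f : E -> R) x u v :
  open D -> D x -> Ck_on 2 D f -> 'D_u ('D_v f) x = 'D_v ('D_u f) x.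
Proof.
move=> oD Dx [fd fD]; have [fud fuD] := fD u; have [fvd fvD] := fD v.
apply: (continuous_eq_of_near_points oD Dx (fvD u x Dx) (fuD v x Dx)) => r r0 rD.
have [p pr Ep] := @second_difference E D f x v u r fd fvd r0 rD.
have [q qr Eq] := @second_difference E D f x u v r fd fud r0 rD.
exists p, q; split; [exact: pr|exact: qr|]; move: Ep Eq.
(* Commuting |u| + |v| identifies the steps h of the two calls, so the same second difference is h^2
   times either mixed derivative. *)
move: ('D_u ('D_v f)) ('D_v ('D_u f)) => fuv fvu; rewrite (addrC `|u|).
set h := r / _; have h0 : h != 0.
  by rewrite gt_eqF// divr_gt0// mulr_gt0// ltr_wpDl// addr_ge0.
have alg (A B C F s t : R) : A - B - C + F = h * (h * s) ->
    A - C - B + F = h * (h * t) -> s = t.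
  by move=> Es Et; apply: (mulfI h0); apply: (mulfI h0); rewrite -Es -Et [X in X + _ = _]addrAC.
by rewrite (addrAC x); exact: alg.
Qed.

Lemma derive_coord E n (f : E -> 'rV[R]_n) x u j : differentiable f x ->
  ('D_u f x) 0 j = 'D_u (fun y => f y 0 j) x.
Proof.
move=> df.
by have [_ /(_ u)] := @derive_lin_comp R E _ R^o f (row_coord j) x (@row_coord_continuous R n j) df.
Qed.

Lemma schwarz E n (D : set E) (f : E -> 'rV[R]_n) x u v :
  open D -> D x -> Ck_on 2 D f -> 'D_u ('D_v f) x = 'D_v ('D_u f) x.
Proof.
move=> oD Dx fC; have [fd fD] := fC.
have [fud _] := fD u; have [fvd _] := fD v.
apply/rowP => j.
have nD : \forall y \near x, D y by exact: open_nbhs_nbhs.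
have e1 := @derive_coord E n ('D_v f) x u j (fvd _ Dx).
have e2 := @derive_coord E n ('D_u f) x v j (fud _ Dx).
have n1 w : \forall y \near x, ('D_w f y) 0 j = 'D_w (fun y => f y 0 j) y.
  by apply: filterS nD => y Dy; apply: derive_coord; exact: fd.
apply: (etrans e1); apply: (etrans _ (esym e2)).
apply: (etrans (near_eq_derive u (n1 v))).
apply: (etrans _ (esym (near_eq_derive v (n1 u)))).
by apply: (schwarz_scalar _ _ oD Dx); exact: Ck_on_coord.
Qed.

Lemma row_sum_bound m (w : 'rV[R]_m) (a : 'I_m -> R) (e : R) :
  (forall i, `|a i| <= e) -> `|\sum_i w 0 i * a i| <= m%:R * e * `|w|.
Proof.
move=> ae; apply: le_trans (ler_norm_sum _ _ _) _.
apply: (@le_trans _ _ (\sum_(i < m) e * `|w|)).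
  apply: ler_sum => i _; rewrite normrM mulrC.
  by apply: ler_pM => //; exact: coord_norm_le.
by rewrite sumr_const card_ord -[leLHS]mulr_natl mulrA.
Qed.

Lemma derive_row_coord m n (f : 'rV[R]_m -> 'rV[R]_n) x (w : 'rV[R]_m) j :
  differentiable f x ->
  ('D_w f x) 0 j = \sum_i w 0 i * ('D_(delta_mx 0 i) f x) 0 j.
Proof.
move=> df; rewrite {1}(row_sum_delta w) derive_sum_dir// summxE.
by apply: eq_bigr => i _; rewrite mxE.
Qed.

(** On a small ball the partial derivatives are close to those at x, and the mean value theorem is
    applied to each coordinate on the segment from z to y, which stays in the ball by convexity. *)
Lemma strict_diff m n (D : set 'rV[R]_m) (f : 'rV[R]_m -> 'rV[R]_n) x (e : R) :
  open D -> D x -> Ck_on 1 D f -> 0 < e ->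
  exists r : R, [/\ 0 < r, forall y, `|y - x| < r -> D y &
    forall y z, `|y - x| < r -> `|z - x| < r ->
      `|f y - f z - 'D_(y - z) f x| <= e * `|y - z|].
Proof.
move=> oD Dx fC e0; have [fd fD] := fC.
(* Summing over m directions costs a factor m; m + 1 also covers m = 0. *)
pose e' := e / m.+1%:R; have e'0 : 0 < e' by rewrite divr_gt0.
have : nbhs x (fun y => D y /\ forall i : 'I_m, forall j : 'I_n,
   `|'D_(delta_mx 0 i) f x 0 j - 'D_(delta_mx 0 i) f y 0 j| < e').
  near=> y; split; near: y; first exact: open_nbhs_nbhs.
  apply: filter_forall => i; apply: filter_forall => j.
  have : {for x, continuous (fun y => 'D_(delta_mx 0 i) f y 0 j : R)}.
    by apply: (@Ck_on_coord _ _ _ 0 D) => //; exact: (fD _).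
  by move/cvgrPdist_lt; apply.
move=> /nbhs_normltP [r r0 rP]; exists r; split => // [y /rP[]//|y z yr zr].
apply: row_norm_le => [|j]; first by rewrite mulr_ge0// ltW.
have cvx t : 0 <= t <= 1 -> `|z + t *: (y - z) - x| < r.
  move=> /andP[t0 t1].
  have -> : z + t *: (y - z) - x = (1 - t) *: (z - x) + t *: (y - x).
    by rewrite !scalerBr !scalerBl !scale1r; apply/rowP=> k; rewrite !mxE; ring.
  apply: le_lt_trans (ler_normD _ _) _; rewrite !normrZ (ger0_norm t0) ger0_norm ?subr_ge0//.
  have [->|tn0] := eqVneq t 0; first by rewrite subr0 mul1r mul0r addr0.
  have -> : r = (1 - t) * r + t * r by rewrite -mulrDl subrK mul1r.
  apply: ler_ltD; first by rewrite ler_wpM2l ?subr_ge0// ltW.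
  by rewrite ltr_pM2l// lt_neqAle eq_sym tn0.
have dfj p : D p -> differentiable (fun y => f y 0 j : R) p.
  by move=> Dp; have [] := @derive_lin_comp R _ _ R^o f (row_coord j) p (@row_coord_continuous R n j) (fd p Dp).
have [t /andP[t0 t1]] := @line_mvt _ (fun y => f y 0 j) z (y - z) 1 ltr01
    (fun t th => dfj _ (rP _ (cvx t th)).1).
rewrite (_ : z + 1 *: (y - z) = y); last by rewrite scale1r addrC subrK.
rewrite mul1r => fyz.
have tD := cvx t _; rewrite !ltW// in tD; have {tD}/rP[Dp dp] := tD isT.
have E1 : (f y - f z - 'D_(y - z) f x) 0 j = \sum_i (y - z) 0 i *
    ('D_(delta_mx 0 i) f (z + t *: (y - z)) 0 j - 'D_(delta_mx 0 i) f x 0 j).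
  have e1 := @derive_coord _ _ f _ (y - z) j (fd _ Dp).
  have e2 := @derive_row_coord _ _ f _ (y - z) j (fd _ Dp).
  have e3 := @derive_row_coord _ _ f _ (y - z) j (fd _ Dx).
  have := congr2 (fun s t : R => s - t) (etrans fyz (etrans (esym e1) e2)) e3.
  move: ('D_(y - z) f x) => d; rewrite -sumrB => e4.
  have -> : (f y - f z - d) 0 j = f y 0 j - f z 0 j - d 0 j by rewrite !mxE.
  by rewrite e4; apply: eq_bigr => i _; rewrite mulrBr.
rewrite E1; apply: (le_trans (@row_sum_bound _ _ _ e' _)).
  by move=> i; rewrite distrC; apply: ltW; exact: dp.
apply: ler_wpM2r => //; rewrite /e' mulrCA ler_piMr ?ltW//.
by rewrite ltr_pdivrMr// mul1r ltr_nat.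
Unshelve. all: by end_near. Qed.

End Inverse.

(** * Local inverses and local sections *)

Section LocalInverse.
Context {R : realType}.
Implicit Types E F H : normedModType R.

Lemma linear_rV_continuous m F (L : {linear 'rV[R]_m -> F}) : continuous L.
Proof.
have LE : L = (fun x => \sum_i x 0 i *: L (delta_mx 0 i)) :> ('rV[R]_m -> F).
  apply/funext => x; rewrite {1}(row_sum_delta x) linear_sum.
  by apply: eq_bigr => i _; rewrite linearZ.
have : @Ck_on R _ F 0 setT (fun x : 'rV[R]_m => \sum_i x 0 i *: L (delta_mx 0 i)).
  apply: Ck_on_sum; first exact: openT.
  move=> i; apply: Ck_on_scale; first exact: openT.
    by apply: Ck_on_coord; [exact: openT|exact: Ck_on_id].
  exact: Ck_on_cst.
by rewrite -LE => c x; exact: c.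
Qed.

(** Jacobian matrix for row vectors, the transpose of the usual one: the differential is v |-> v *m
    [jmx f y]. *)
Definition jmx m n (f : 'rV[R]_m -> 'rV[R]_n) (y : 'rV[R]_m) : 'M[R]_(m, n) :=
  \matrix_(i, j) ('D_(delta_mx 0 i) f y) 0 j.

Lemma jmxE m n (f : 'rV[R]_m -> 'rV[R]_n) y i j :
  jmx f y i j = ('D_(delta_mx 0 i) f y) 0 j.
Proof. by rewrite mxE. Qed.

Lemma derive_jmx m n (f : 'rV[R]_m -> 'rV[R]_n) y v :
  differentiable f y -> 'D_v f y = v *m jmx f y.
Proof.
move=> df; apply/rowP => j; have := derive_row_coord v j df.
move=> e; apply: (etrans e); rewrite [RHS]mxE.
by apply: eq_bigr => i _; rewrite [X in _ = _ * X]mxE.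
Qed.

Lemma Ck_on_jmx k m n (D : set 'rV[R]_m) (f : 'rV[R]_m -> 'rV[R]_n) i j :
  open D -> Ck_on k.+1 D f -> Ck_on k D (fun y => jmx f y i j).
Proof.
move=> oD [_ fD]; under eq_fun do rewrite mxE.
exact: (Ck_on_coord j oD (fD _)).
Qed.

Lemma mulmxr_lipschitz m n (L : 'M[R]_(m, n)) :
  exists2 C : R, 0 < C & forall v : 'rV[R]_m, `|v *m L| <= C * `|v|.
Proof.
have [C C0 CP] := linear_lipschitz (@linear_rV_continuous m _ (mulmxr L)).
by exists C.
Qed.

Lemma diff_of_linear_approx E F (g : E -> F) (M : {linear E -> F}) w :
  continuous M ->
  (forall e : R, 0 < e -> \forall h \near (0 : E), `|g (h + w) - g w - M h| <= e * `|h|) ->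
  differentiable g w /\ forall v, 'D_v g w = M v.
Proof.
move=> cM gP.
have gE : g \o shift w = cst (g w) + M +o_ 0 id.
  apply/eqaddoP => e e0; apply: filterS (gP e e0) => h.
  by rewrite /= !fctE /= opprD addrA.
have dE : 'd g w = M :> (_ -> _) by exact: diff_unique.
have dg : differentiable g w by apply/diff_locallyP; rewrite dE.
by split=> // v; rewrite deriveE// dE.
Qed.

Lemma diff_of_mx_approx m n (g : 'rV[R]_m -> 'rV[R]_n) w (L : 'M[R]_(m, n)) :
  (forall e : R, 0 < e -> \forall h \near (0 : 'rV[R]_m), `|g (h + w) - g w - h *m L| <= e * `|h|) ->
  differentiable g w /\ forall v, 'D_v g w = v *m L.
Proof.
exact: (diff_of_linear_approx (@linear_rV_continuous m _ (mulmxr L))).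
Qed.

Lemma diff_mx_approx m n (f : 'rV[R]_m -> 'rV[R]_n) y : differentiable f y ->
  forall e : R, 0 < e -> \forall h \near (0 : 'rV[R]_m), `|f (h + y) - f y - h *m jmx f y| <= e * `|h|.
Proof.
move=> df e e0; have [_ dE] := (diff_locallyP _ _).1 df.
move/eqaddoP : dE => /(_ e e0); apply: filterS => h.
by rewrite /= !fctE /= -derive_jmx// deriveE// opprD addrA.
Qed.

Lemma norm_le_double E (a b : E) : `|a - b| <= 2^-1 * `|b| -> `|b| <= 2 * `|a|.
Proof.
have := ler_normD (b - a) a; rewrite subrK (distrC b) => a1 a2.
rewrite -(ler_pM2l (_ : 0 < 2^-1 :> R)) ?invr_gt0// mulrA mulVf ?mul1r ?pnatr_eq0//.
have := le_trans a1 (lerD a2 (lexx _)); rewrite -lerBlDl => /(le_trans _); apply.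
by rewrite {2}(splitr `|b|) mulrC addrK.
Qed.

(* The preimage of w is found as a minimiser of |f y - w| over a closed ball:
   the step y - (f y - w) would decrease a nonzero minimum. *)
Lemma local_surjectivity m (f : 'rV[R]_m -> 'rV[R]_m) x (r : R) w : 0 < r ->
  (forall y, `|y - x| < r -> {for y, continuous f}) ->
  (forall y z, `|y - x| < r -> `|z - x| < r ->
    `|f y - f z - (y - z)| <= 2^-1 * `|y - z|) ->
  `|w - f x| < r / 16 -> exists2 y, `|y - x| < r & f y = w.
Proof.
move=> r0 fc fP wx.
pose K := [set y : 'rV[R]_m | `|y - x| <= r / 2].
have Kr y : K y -> `|y - x| < r.
  by move=> /le_lt_trans; apply; rewrite ltr_pdivrMr// mulr_natr mulr2n ltrDl.
have Kx : K x by rewrite /K/= subrr normr0 divr_ge0 ?ltW.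
have KE : K = closed_ball x (r / 2).
  rewrite closed_ballE ?divr_gt0//; apply/seteqP; split => y; rewrite /K /closed_ball_/=.
    by rewrite distrC.
  by rewrite distrC.
have cK : compact K.
  apply: bounded_closed_compact; last by rewrite KE; exact: closed_ball_closed.
  exists (`|x| + r / 2); split; first exact: num_real.
  move=> M MK y Ky; apply: le_trans (ltW MK).
  by rewrite -(subrK x y) addrC (le_trans (ler_normD _ _))// lerD2l.
have [y + ymin] : exists2 c, c \in K & forall t, t \in K -> `|f c - w| <= `|f t - w|.
  apply: (@EVT_min_rV R m (fun y => `|f y - w|)) => //; first by exists x.
  apply: continuous_in_subspaceT => y; rewrite inE => Ky.
  have c1 : {for y, continuous (fun z => f z - w)}.
    by apply: continuousB; [exact/fc/Kr|exact: cst_continuous].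
  exact: (continuous_comp c1 (@norm_continuous _ _ _)).
rewrite inE => Ky; exists y; first exact: Kr.
have xx : `|x - x| < r by rewrite subrr normr0.
apply/eqP/negPn/negP => fyw.
have n0 : 0 < `|f y - w| by rewrite normr_gt0 subr_eq0.
have ywx : `|f y - w| <= `|w - f x| by rewrite (distrC w); apply: ymin; rewrite inE.
have yx : `|y - x| <= 2 * `|f y - f x|.
  exact/norm_le_double/fP/xx/Kr.
have fyx : `|f y - f x| <= `|f y - w| + `|w - f x|.
  by have := ler_normD (f y - w) (w - f x); rewrite addrA subrK.
pose y' := y - (f y - w).
have y'y : y' - y = - (f y - w) by rewrite /y' addrAC subrr add0r.
(* The bound r / 16 gives |f y - w| < r / 16 and |y - x| < r / 4, so y' is within r / 2 of x. *)
have Ky' : K y'.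
  rewrite /K/= /y' addrAC; have := ler_normB (y - x) (f y - w).
  by move=> a1; lra.
have : `|f y' - w| <= 2^-1 * `|f y - w|.
  have := fP y' y (Kr _ Ky') (Kr _ Ky).
  rewrite y'y normrN opprK.
  by rewrite addrA subrK.
have := ymin y'; rewrite inE => /(_ Ky') a1 a2.
by lra.
Qed.

(** Inverse function theorem, normalized to the identity as differential at x: then f - id is
    1/2-Lipschitz near x, which gives injectivity with constant 2 and, by [local_surjectivity], the
    preimages. *)
Lemma local_inverse m (D : set 'rV[R]_m) (f : 'rV[R]_m -> 'rV[R]_m) x :
  open D -> D x -> smooth_on D f -> (forall v, 'D_v f x = v) ->
  exists B g, [/\ open B, B (f x), smooth_on B g, g (f x) = x &
    forall w, B w -> D (g w) /\ f (g w) = w].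
Proof.
move=> oD Dx fS fx.
have fd y : D y -> differentiable f y by exact: smooth_on_diff.
have Jx : jmx f x = 1%:M.
  apply/row_matrixP => i; rewrite rowE -derive_jmx ?fx; last exact: fd.
  by rewrite rowE mulmx1.
have [D1 [oD1 D1x] D1P] : exists2 U, open_nbhs x U & U `<=` (fun y => D y /\ jmx f y \in unitmx).
  suff : nbhs x (fun y => D y /\ jmx f y \in unitmx) by rewrite nbhsE.
  apply: filterI; first exact: open_nbhs_nbhs.
  have : {for x, continuous (fun y => \det (jmx f y) : R^o)}.
    apply: (@Ck_on_det _ _ 0 D _ (fun y => jmx f y)) => // i j.
    by apply: Ck_on_jmx => //; exact: fS.
  rewrite /prop_for/continuous_at Jx det1.
  move=> /cvgrPdist_lt/(_ 1 ltr01); apply: filterS => y dy.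
  rewrite unitmxE unitfE; apply: contraPneq dy => ->.
  by rewrite subr0 normr1 ltxx.
have D1D : D1 `<=` D by move=> y /D1P[].
have D1u y : D1 y -> jmx f y \in unitmx by move=> /D1P[].
have h2 : 0 < 2^-1 :> R by rewrite invr_gt0.
have [r [r0 rD rP]] := strict_diff oD1 D1x (Ck_on_sub D1D (fS 1%N)) h2.
have {}rP y z : `|y - x| < r -> `|z - x| < r ->
    `|f y - f z - (y - z)| <= 2^-1 * `|y - z|.
  by move=> yr zr; rewrite -{1}(fx (y - z)); exact: rP.
have lip y z : `|y - x| < r -> `|z - x| < r -> `|y - z| <= 2 * `|f y - f z|.
  by move=> yr zr; apply: norm_le_double; exact: rP.
pose B := [set w : 'rV[R]_m | `|w - f x| < r / 16].
have BE : B = ball (f x) (r / 16).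
  by rewrite -ball_normE; apply/seteqP; split => w; rewrite /B/= distrC.
have r16 : 0 < r / 16 by rewrite divr_gt0.
have oB : open B by rewrite BE; exact: ball_open.
have surj w : B w -> exists y, `|y - x| < r /\ f y = w.
  move=> Bw; have [|y yr <-] := local_surjectivity r0 _ rP Bw; last by exists y.
  by move=> y /rD/D1D/fd/differentiable_continuous.
pose g w := xget x [set y | `|y - x| < r /\ f y = w].
have gP w : B w -> `|g w - x| < r /\ f (g w) = w.
  by move=> /surj[y yP]; rewrite /g; case: xgetP => [z _ //|/(_ y)]; exact: contra_notP.
have Bfx : B (f x) by rewrite /B/= subrr normr0.
have gd w : B w -> differentiable g w /\ forall v, 'D_v g w = v *m invmx (jmx f (g w)).
  move=> Bw; have [gr fg] := gP w Bw.
  have Ju := D1u _ (rD _ gr).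
  set J := jmx f (g w) in Ju *.
  apply: diff_of_mx_approx => e e0.
  have [C C0 CP] := mulmxr_lipschitz (invmx J).
  (* The expansion of f at g w is multiplied by the inverse of J, which costs C, and its increment
     dl is at most 2 |h|. *)
  pose e' := e / (2 * C); have e'0 : 0 < e' by rewrite divr_gt0// mulr_gt0.
  have dfg : differentiable f (g w) by exact/fd/D1D/rD.
  have /nbhs_normltP[d d0 dP] := diff_mx_approx dfg e'0.
  have nB : \forall h \near (0 : 'rV[R]_m), B (h + w).
    have /nbhs_normltP[d' d'0 d'P] := open_nbhs_nbhs (conj oB Bw).
    by apply/nbhs_normltP; exists d' => // h; rewrite subr0 => hd; apply: d'P; rewrite addrK.
  have nd : \forall h \near (0 : 'rV[R]_m), `|h| < d / 2.
    by apply/nbhs_normltP; exists (d / 2); [rewrite divr_gt0|move=> y; rewrite subr0].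
  apply: filterS2 nB nd => h Bh hd.
  have [gr' fg'] := gP _ Bh.
  set dl := g (h + w) - g w.
  have dlh : `|dl| <= 2 * `|h|.
    by have := lip _ _ gr' gr; rewrite fg fg' addrK.
  have dld : `|dl - 0| < d by rewrite subr0; lra.
  have := dP dl dld; rewrite -/J {1}/dl subrK fg fg' addrK => hJ.
  have -> : dl - h *m invmx J = - ((h - dl *m J) *m invmx J).
    by rewrite mulmxBl -mulmxA mulmxV// mulmx1 opprB.
  rewrite normrN; apply: (le_trans (CP _)).
  apply: (@le_trans _ _ (C * (e' * (2 * `|h|)))).
    apply: ler_wpM2l; first exact: ltW.
    by apply: (le_trans hJ); apply: ler_wpM2l => //; exact: ltW.
  rewrite !mulrA ler_wpM2r// /e' invfM.
  by rewrite [leLHS](_ : _ = e) //; field; rewrite gt_eqF.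
have gfx : g (f x) = x.
  have [gr fg] := gP _ Bfx; apply/eqP; rewrite -subr_eq0 -normr_le0.
  have xx : `|x - x| < r by rewrite subrr normr0.
  have := lip _ _ gr xx; rewrite fg (subrr (f x)) normr0 mulr0.
  exact.
exists B, g; split => // [|w /gP[/rD/D1D]//].
(* Bootstrapping: the derivative of g is an expression in g, hence C^k when g is. *)
elim=> [|k IH].
  by move=> w /gd[/differentiable_continuous].
split=> [w /gd[]//|v].
apply: (@Ck_on_eq _ _ _ _ _ (fun w => v *m invmx (jmx f (g w))) _ oB).
  by move=> w /gd[_ ->].
apply: Ck_on_row => // j; under eq_fun do rewrite mxE.
apply: Ck_on_sum => // i; apply: Ck_on_mul => //; first exact: Ck_on_cst.
apply: (@Ck_on_invmx _ _ _ _ _ (fun w => jmx f (g w))) => // [w /gP[/rD/D1u]//|i' j'].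
apply: (@Ck_on_comp _ _ _ _ k B D g (fun y => jmx f y i' j')) => //.
- exact: framed_rV.
- by move=> w /gP[/rD/D1D].
- by apply: Ck_on_jmx => //; exact: fS.
Unshelve. all: by end_near. Qed.

(** Precomposing f with an affine map h whose linear part is a right inverse of the Jacobian makes
    the differential the identity; the section is h after the local inverse of f o h. *)
Lemma local_section m n (D : set 'rV[R]_m) (f : 'rV[R]_m -> 'rV[R]_n) x :
  open D -> D x -> smooth_on D f -> (forall w, exists v, 'D_v f x = w) ->
  exists B s, [/\ open B, B (f x), smooth_on B s, s (f x) = x &
    forall y, B y -> D (s y) /\ f (s y) = y].
Proof.
move=> oD Dx fS fs.
have fd y : D y -> differentiable f y by exact: smooth_on_diff.
have [A AP] : exists A : 'M[R]_(n, m), A *m jmx f x = 1%:M.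
  pose a (i : 'I_n) := sval (cid (fs (delta_mx 0 i))).
  exists (\matrix_(i < n) a i); apply/row_matrixP => i.
  rewrite row_mul rowK -derive_jmx; last exact: fd.
  by rewrite /a; case: cid => v /= ->; rewrite rowE mulmx1.
pose h (y : 'rV[R]_n) : 'rV[R]_m := x + (y - f x) *m A.
have hd y : differentiable h y /\ forall v, 'D_v h y = v *m A.
  apply: diff_of_mx_approx => e e0; near=> d.
  have -> : h (d + y) - h y - d *m A = 0.
    rewrite /h !mulmxBl mulmxDl; move: (d *m A) (y *m A) (f x *m A) => a b c.
    by apply/rowP => j; rewrite !mxE; ring.
  by rewrite normr0 mulr_ge0// ltW.
have hx : h (f x) = x by rewrite /h subrr mul0mx addr0.
have hS D' : open D' -> smooth_on D' h.
  move=> oD' k; apply: Ck_on_add => //; first exact: Ck_on_cst.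
  have : Ck_on k D' (mulmxr A \o (fun y => y - f x)).
    apply: Ck_on_lin_comp => //; first exact: linear_rV_continuous.
    by apply: Ck_on_add => //; [exact: Ck_on_id|exact: Ck_on_cst].
  by [].
have oD' : open (h @^-1` D).
  apply: open_comp => // y _; exact/differentiable_continuous/(hd y).1.
have D'x : (h @^-1` D) (f x) by rewrite /= hx.
have fhS : smooth_on (h @^-1` D) (f \o h).
  exact: (@smooth_on_comp _ _ _ _ (h @^-1` D) D h f (framed_rV m) oD' (fun y Dy => Dy) (hS _ oD') fS).
have fhx v : 'D_v (f \o h) (f x) = v.
  rewrite derive_comp; [|exact: (hd _).1|by rewrite hx; exact: fd].
  by rewrite ((hd (f x)).2 v) hx (derive_jmx _ (fd x Dx)) -mulmxA AP mulmx1.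
have [B [g [oB Bfx gS gfx gP]]] := local_inverse oD' D'x fhS fhx.
move: Bfx gfx; rewrite /= hx => Bfx gfx.
exists B, (h \o g); split=> //.
- exact: (smooth_on_comp (framed_rV n) oB (fun w Bw => (gP w Bw).1) gS (hS _ oD')).
- by rewrite /= gfx.
Unshelve. all: by end_near. Qed.

End LocalInverse.

(** * Smooth maps between manifolds *)

Section Manifold.
Context {R : realType}.
Implicit Types (E F H : normedModType R) (S T V : topologicalType).

(** The local representative of f; as charts are total functions, it is meaningful only on
    [lrep_dom c d f]. *)
Definition lrep E F S T (c : chart E S) (d : chart F T) (f : S -> T) : E -> F :=
  cfwd d \o f \o cbwd c.

Lemma cbwd_cdom E S (c : chart E S) y : (cfwd c @` cdom c) y -> cdom c (cbwd c y).
Proof. by move=> [x cx <-]; rewrite cfwdK. Qed.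

Lemma cbwdK E S (c : chart E S) y : (cfwd c @` cdom c) y -> cfwd c (cbwd c y) = y.
Proof. by move=> [x cx <-]; rewrite cfwdK. Qed.

Lemma cfwd_image E S (c : chart E S) (A : set S) y :
  (cfwd c @` (cdom c `&` A)) y <-> (cfwd c @` cdom c) y /\ A (cbwd c y).
Proof.
split=> [[x [cx Ax] <-]|[[x cx <-] Ax]].
  by split; [exists x|rewrite cfwdK].
by exists x => //; split => //; rewrite cfwdK in Ax.
Qed.

Lemma cdom_image E S (c : chart E S) x : cdom c x -> (cfwd c @` cdom c) (cfwd c x).
Proof. by move=> cx; exists x. Qed.

Definition lrep_dom E F S T (c : chart E S) (d : chart F T) (f : S -> T) : set E :=
  cfwd c @` (cdom c `&` f @^-1` cdom d).

Lemma lrep_dom_open E F S T (c : chart E S) (d : chart F T) (f : S -> T) :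
  continuous f -> open (lrep_dom c d f).
Proof.
by move=> fc; apply: cfwd_open; apply: open_comp; [move=> x _; exact: fc|exact: cdom_open].
Qed.

Lemma lrep_domP E F S T (c : chart E S) (d : chart F T) (f : S -> T) y :
  lrep_dom c d f y <-> (cfwd c @` cdom c) y /\ cdom d (f (cbwd c y)).
Proof. exact: cfwd_image. Qed.

Lemma smooth_map_lrep E F S T (A : atlas E S) (B : atlas F T) f c d :
  smooth_map A B f -> charts A c -> charts B d -> smooth_on (lrep_dom c d f) (lrep c d f).
Proof. by move=> [_ fS] Ac Bd; exact: fS. Qed.

Lemma lrep_diff E F S T (A : atlas E S) (B : atlas F T) f c d y :
  smooth_map A B f -> charts A c -> charts B d -> lrep_dom c d f y ->
  differentiable (lrep c d f) y.
Proof. by move=> fS Ac Bd yD; exact: smooth_on_diff (smooth_map_lrep fS Ac Bd) yD. Qed.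

Lemma lrep_cfwd E F S T (c : chart E S) (d : chart F T) (f : S -> T) x :
  cdom c x -> lrep c d f (cfwd c x) = cfwd d (f x).
Proof. by move=> cx; rewrite /lrep/= cfwdK. Qed.

Lemma lrep_dom_cfwd E F S T (c : chart E S) (d : chart F T) (f : S -> T) x :
  cdom c x -> cdom d (f x) -> lrep_dom c d f (cfwd c x).
Proof. by move=> cx dx; exists x. Qed.

Lemma lrep_comp E F H S T V (c : chart E S) (d : chart F T) (e : chart H V)
    (f : S -> T) (g : T -> V) y :
  lrep_dom c d f y -> lrep c e (g \o f) y = lrep d e g (lrep c d f y).
Proof. by move=> [x [cx dx] <-]; rewrite /lrep/= !cfwdK. Qed.

Lemma lrep_dom_comp E F H S T V (c : chart E S) (d : chart F T) (e : chart H V)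
    (f : S -> T) (g : T -> V) y :
  lrep_dom c d f y -> lrep_dom c e (g \o f) y -> lrep_dom d e g (lrep c d f y).
Proof.
move=> [x [cx dx] <-] /lrep_domP[_ /=]; rewrite cfwdK// => ex.
by rewrite lrep_cfwd//; exact: lrep_dom_cfwd.
Qed.

Lemma near_lrep_comp E F H S T V (c : chart E S) (d : chart F T) (e : chart H V)
    (f : S -> T) (g : T -> V) y : continuous f ->
  lrep_dom c d f y ->
  \forall z \near y, lrep d e g (lrep c d f z) = lrep c e (g \o f) z.
Proof.
move=> fc yD.
have oD := @lrep_dom_open _ _ _ _ c d f fc.
by apply: filterS (open_nbhs_nbhs (conj oD yD)) => z zD; rewrite -lrep_comp.
Qed.

(** No single chart of T contains the image of f, so the intermediate chart depends on the point and
    smoothness is checked locally. *)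
Lemma smooth_map_comp E F H S T V (A : atlas E S) (B : atlas F T)
    (C : atlas H V) f g : framed F ->
  smooth_map A B f -> smooth_map B C g -> smooth_map A C (g \o f).
Proof.
move=> fF fS gS; split.
  by move=> x; apply: continuous_comp; [exact: fS.1|exact: gS.1].
move=> c e Ac Ce k; rewrite -[_ @` _]/(lrep_dom c e (g \o f)).
apply: Ck_on_local => y yD.
pose d := chart_at B (f (cbwd c y)).
have Bd : charts B d by exact: charts_chart_at.
have /lrep_domP[cy ey] := yD.
have fc := fS.1; have gfc : continuous (g \o f).
  by move=> x; apply: continuous_comp; [exact: fS.1|exact: gS.1].
pose D' := lrep_dom c e (g \o f) `&` lrep_dom c d f.
have oD' : open D' by apply: openI; exact: lrep_dom_open.
exists D'.
  by split=> //; apply/lrep_domP; split=> //; exact: cdom_chart_at.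
apply: (@Ck_on_eq _ _ _ k D' (lrep d e g \o lrep c d f)) => //.
  by move=> z [z1 z2]; rewrite /= -lrep_comp.
apply: (@Ck_on_comp _ _ _ _ k D' (lrep_dom d e g)) => //.
- by move=> z [z1 z2]; exact: (lrep_dom_comp z2 z1).
- by apply: Ck_on_sub (smooth_map_lrep fS Ac Bd k) => z [].
- exact: (smooth_map_lrep gS Bd Ce k).
Qed.

Lemma smooth_map_id E S (A : atlas E S) : smooth_map A A id.
Proof.
split; first by move=> x; exact: cvg_id.
by move=> c d Ac Ad; exact: (charts_transition Ac Ad).
Qed.

Lemma derive_lrep_comp E F H S T V (A : atlas E S) (B : atlas F T)
    (C : atlas H V) f g c d e y u :
  smooth_map A B f -> smooth_map B C g ->
  charts A c -> charts B d -> charts C e ->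
  lrep_dom c d f y -> lrep_dom c e (g \o f) y ->
  'D_u (lrep c e (g \o f)) y = 'D_('D_u (lrep c d f) y) (lrep d e g) (lrep c d f y).
Proof.
move=> fS gS Ac Bd Ce y1 y2.
rewrite -(near_eq_derive _ (near_lrep_comp e g fS.1 y1)).
rewrite -[X in 'D_u X y]/(lrep d e g \o lrep c d f) derive_comp//.
  exact: (lrep_diff fS Ac Bd).
apply: (lrep_diff gS Bd Ce); exact: lrep_dom_comp.
Qed.

Lemma dmapE E F S T (A : atlas E S) (B : atlas F T) f x u :
  smooth_map A B f ->
  dmap A B f x u = 'D_u (lrep (chart_at A x) (chart_at B (f x)) f) (cfwd (chart_at A x) x).
Proof.
move=> fS; rewrite deriveE//.
apply: (lrep_diff fS); try exact: charts_chart_at.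
by apply: lrep_dom_cfwd; exact: cdom_chart_at.
Qed.

Lemma dmap_comp E F H S T V (A : atlas E S) (B : atlas F T)
    (C : atlas H V) f g x u :
  framed F -> smooth_map A B f -> smooth_map B C g ->
  dmap A C (g \o f) x u = dmap B C g (f x) (dmap A B f x u).
Proof.
move=> fF fS gS; rewrite !dmapE//; last exact: smooth_map_comp gS.
have [c1 c2 c3] : [/\ charts A (chart_at A x), charts B (chart_at B (f x)) &
    charts C (chart_at C (g (f x)))] by split; exact: charts_chart_at.
rewrite (derive_lrep_comp _ fS gS c1 c2 c3).
- by rewrite lrep_cfwd//; exact: cdom_chart_at.
- by apply: lrep_dom_cfwd; exact: cdom_chart_at.
- by apply: lrep_dom_cfwd; exact: cdom_chart_at.
Qed.

Lemma dmap_near E F S T (A : atlas E S) (B : atlas F T) f (x : S) (L : E -> F) u :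
  smooth_map A B f ->
  (\forall y \near cfwd (chart_at A x) x,
     L y = lrep (chart_at A x) (chart_at B (f x)) f y) ->
  dmap A B f x u = 'D_u L (cfwd (chart_at A x) x).
Proof. by move=> fS LE; rewrite dmapE// -(near_eq_derive _ LE). Qed.

Lemma near_chart_cod E S (A : atlas E S) x :
  \forall y \near cfwd (chart_at A x) x, (cfwd (chart_at A x) @` cdom (chart_at A x)) y.
Proof.
apply: open_nbhs_nbhs; split; first exact: ccod_open.
exact/cdom_image/cdom_chart_at.
Qed.

Lemma dmap_id E S (A : atlas E S) x u : dmap A A id x u = u.
Proof.
rewrite (@dmap_near _ _ _ _ A A id x id); first exact: derive_id.
  exact: smooth_map_id.
by apply: filterS (near_chart_cod A x) => y yc; rewrite /lrep/= cbwdK.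
Qed.

Lemma smooth_map_cst E F S T (A : atlas E S) (B : atlas F T) (t : T) :
  smooth_map A B (fun=> t).
Proof.
split; first by move=> x; exact: cst_continuous.
by move=> c d _ _ k; exact: Ck_on_cst.
Qed.

Lemma dmap_cst E F S T (A : atlas E S) (B : atlas F T) (t : T) x u :
  dmap A B (fun=> t) x u = 0.
Proof. by rewrite dmapE ?derive_cst//; exact: smooth_map_cst. Qed.

Lemma tangent_of_chartE E S (A : atlas E S) c y u : compatible A c ->
  (cfwd c @` cdom c) y ->
  tangent_of_chart A c y u = 'D_u (lrep c (chart_at A (cbwd c y)) id) y.
Proof.
move=> cA cy; rewrite deriveE//.
have [+ _] := cA _ (charts_chart_at A (cbwd c y)); move=> cS.
apply: (smooth_on_diff cS); apply/cfwd_image; split=> //; exact: cdom_chart_at.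
Qed.

Lemma charts_compatible E S (A : atlas E S) c : charts A c -> compatible A c.
Proof. by move=> Ac d Ad; split; [exact: (charts_transition Ac Ad)|exact: (charts_transition Ad Ac)]. Qed.

Lemma tangent_of_chart_at E S (A : atlas E S) x u :
  tangent_of_chart A (chart_at A x) (cfwd (chart_at A x) x) u = u.
Proof.
have cx := cdom_chart_at A x.
rewrite tangent_of_chartE; [|exact/charts_compatible/charts_chart_at|exact: cdom_image].
rewrite cfwdK// -[RHS](derive_id (cfwd (chart_at A x) x) u); apply: near_eq_derive.
by apply: filterS (near_chart_cod A x) => y yc; rewrite /lrep/= cbwdK.
Qed.

Lemma chart_metric_at E S (A : atlas E S) g x u v :
  chart_metric A (chart_at A x) g (cfwd (chart_at A x) x) u v = g x u v.
Proof.
by rewrite /chart_metric !tangent_of_chart_at cfwdK//; exact: cdom_chart_at.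
Qed.

(** Frees [dmap] from the preferred charts. Both sides are the derivative of the representative of f
    from c to the preferred chart at f x, factored through a change of chart in S on the left and in
    T on the right. *)
Lemma tangent_lrep E F S T (A : atlas E S) (B : atlas F T) f c d y u :
  framed E -> framed F ->
  smooth_map A B f -> charts A c -> charts B d -> lrep_dom c d f y ->
  dmap A B f (cbwd c y) (tangent_of_chart A c y u) =
  tangent_of_chart B d (lrep c d f y) ('D_u (lrep c d f) y).
Proof.
move=> fE fF fS Ac Bd yD; have /lrep_domP[cy dy] := yD.
set x := cbwd c y in dy *.
have dx : cbwd d (lrep c d f y) = f x by rewrite /lrep/= cfwdK.
have dcod : (cfwd d @` cdom d) (lrep c d f y) by rewrite /lrep/=; exact: cdom_image.
rewrite tangent_of_chartE//; last exact: charts_compatible.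
rewrite tangent_of_chartE//; last exact: charts_compatible.
rewrite dmapE// dx -/x.
have cA := charts_chart_at A x; have cB := charts_chart_at B (f x).
have yD1 : lrep_dom c (chart_at A x) id y.
  by apply/lrep_domP; split => //; exact: cdom_chart_at.
have yD2 : lrep_dom c (chart_at B (f x)) f y.
  by apply/lrep_domP; split => //; exact: cdom_chart_at.
have idA := smooth_map_id A; have idB := smooth_map_id B.
rewrite -(@derive_lrep_comp _ _ _ _ _ _ A B B f id c d)//.
rewrite -[id \o f]/(f \o id).
rewrite (@derive_lrep_comp _ _ _ _ _ _ A A B id f c (chart_at A x))//.
Qed.

End Manifold.

(** * Maps into products, and descent along submersions *)

Section Manifold2.
Context {R : realType}.
Implicit Types (E F H : normedModType R) (S T V : topologicalType).

Lemma smooth_map_pair E F H S T V (A : atlas E S) (B : atlas F T)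
    (C : atlas H V) f g :
  smooth_map A B f -> smooth_map A C g ->
  smooth_map A (prod_atlas B C) (fun s => (f s, g s)).
Proof.
move=> fS gS; split.
  by move=> x; apply: cvg_pair; [exact: fS.1|exact: gS.1].
move=> c _ Ac [d [e [Bd Ce ->]]] k.
set D := _ @` _.
have oD : open D.
  apply: (@lrep_dom_open R _ _ _ _ c (prod_chart d e)).
  by move=> x; apply: cvg_pair; [exact: fS.1|exact: gS.1].
apply: (@Ck_on_pair _ _ _ _ k D (lrep c d f) (lrep c e g)) => //.
  by apply: Ck_on_sub (smooth_map_lrep fS Ac Bd k) => _ [x [cx [dx ex]] <-]; exists x.
by apply: Ck_on_sub (smooth_map_lrep gS Ac Ce k) => _ [x [cx [dx ex]] <-]; exists x.
Qed.

Lemma derive_pair E F H (f : E -> F) (g : E -> H) x v :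
  differentiable f x -> differentiable g x ->
  'D_v (fun y => (f y, g y)) x = ('D_v f x, 'D_v g x).
Proof.
move=> df dg; rewrite deriveE; last exact: differentiable_pair.
by rewrite diff_pair// !deriveE.
Qed.

Lemma dmap_pair E F H S T V (A : atlas E S) (B : atlas F T)
    (C : atlas H V) f g x u :
  smooth_map A B f -> smooth_map A C g ->
  dmap A (prod_atlas B C) (fun s => (f s, g s)) x u = (dmap A B f x u, dmap A C g x u).
Proof.
move=> fS gS; rewrite !dmapE//; last exact: smooth_map_pair.
apply: (@derive_pair _ _ _ (lrep (chart_at A x) (chart_at B (f x)) f)
  (lrep (chart_at A x) (chart_at C (g x)) g)).
  apply: (lrep_diff fS); [exact: charts_chart_at..|].
  by apply: lrep_dom_cfwd; exact: cdom_chart_at.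
apply: (lrep_diff gS); [exact: charts_chart_at..|].
by apply: lrep_dom_cfwd; exact: cdom_chart_at.
Qed.

Lemma dmap_linear E F S T (A : atlas E S) (B : atlas F T) (f : S -> T) x k u v :
  dmap A B f x (k *: u + v) = k *: dmap A B f x u + dmap A B f x v.
Proof. by rewrite /dmap linearP. Qed.

Lemma dmap0 E F S T (A : atlas E S) (B : atlas F T) (f : S -> T) x :
  dmap A B f x 0 = 0.
Proof. by rewrite /dmap linear0. Qed.

Lemma dmapD E F S T (A : atlas E S) (B : atlas F T) (f : S -> T) x u v :
  dmap A B f x (u + v) = dmap A B f x u + dmap A B f x v.
Proof. by rewrite /dmap linearD. Qed.

Lemma dmapB E F S T (A : atlas E S) (B : atlas F T) (f : S -> T) x u v :
  dmap A B f x (u - v) = dmap A B f x u - dmap A B f x v.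
Proof. by rewrite /dmap linearB. Qed.

(** [local_section] in charts. Surjectivity of [dmap] concerns the preferred chart at p s0, so w is
    first carried there from c, and the solution is carried back by the inverse transition. *)
Lemma submersion_section m k S T (A : atlas 'rV[R]_m S) (B : atlas 'rV[R]_k T)
    (p : S -> T) s0 c :
  submersion A B p -> charts B c -> cdom c (p s0) ->
  let a := chart_at A s0 in
  exists W s, [/\ open W, W (cfwd c (p s0)), smooth_on W s,
    s (cfwd c (p s0)) = cfwd a s0 &
    forall y, W y -> lrep_dom a c p (s y) /\ lrep a c p (s y) = y].
Proof.
move=> [pS psurj] Bc cp a.
have Aa : charts A a by exact: charts_chart_at.
have as0 : cdom a s0 by exact: cdom_chart_at.
have sD : lrep_dom a c p (cfwd a s0) by exact: lrep_dom_cfwd.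
have idB := smooth_map_id B.
pose d := chart_at B (p s0).
have Bd : charts B d by exact: charts_chart_at.
have dp : cdom d (p s0) by exact: cdom_chart_at.
have [|W [s [oW Wx sS sx sW]]] := local_section (lrep_dom_open a c pS.1) sD (smooth_map_lrep pS Aa Bc).
  move=> w.
  have [v vP] := psurj s0 ('D_w (lrep c d id) (cfwd c (p s0))).
  exists v; move: vP; rewrite dmapE// -/a -/d => vP.
  have sD' : lrep_dom a d p (cfwd a s0) by exact: lrep_dom_cfwd.
  rewrite -[p]/(id \o p) (@derive_lrep_comp _ _ _ _ _ _ _ A B B p id a d c)//.
  rewrite vP lrep_cfwd//.
  have pd : cfwd d (p s0) = lrep c d id (cfwd c (p s0)) by rewrite lrep_cfwd.
  have pcd : lrep_dom c d id (cfwd c (p s0)) by exact: lrep_dom_cfwd.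
  rewrite pd -(@derive_lrep_comp _ _ _ _ _ _ _ B B B id id c d c)//; last exact: lrep_dom_cfwd.
  rewrite -[RHS](derive_id (cfwd c (p s0)) w); apply: near_eq_derive.
  have : \forall y \near cfwd c (p s0), (cfwd c @` cdom c) y.
    by apply: open_nbhs_nbhs; split; [exact: ccod_open|exact: cdom_image].
  by apply: filterS => y yc; rewrite /lrep/= cbwdK.
by move: Wx sx; rewrite lrep_cfwd// => Wx sx; exists W, s.
Qed.

Lemma lrep_eq E F S T (a : chart E S) (c : chart F T) p y z :
  lrep_dom a c p y -> lrep a c p y = z -> p (cbwd a y) = cbwd c z.
Proof. by move=> /lrep_domP[ay cy] <-; rewrite /lrep/= cfwdK. Qed.

(** Locally g is g o p after a smooth section of p. This is how maps out of G / G_x are shown to be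
    smooth. *)
Lemma smooth_map_descend m k H S T V (A : atlas 'rV[R]_m S) (B : atlas 'rV[R]_k T)
    (C : atlas H V) (p : S -> T) (g : T -> V) :
  (forall t, exists s, p s = t) ->
  submersion A B p -> smooth_map A C (g \o p) -> smooth_map B C g.
Proof.
move=> psurj pS gpS.
have fac c t : charts B c -> cdom c t -> exists (a : chart 'rV[R]_m S) W s,
   [/\ charts A a, open W, W (cfwd c t), smooth_on W s &
    forall y, W y -> [/\ (cfwd a @` cdom a) (s y), (cfwd c @` cdom c) y &
      p (cbwd a (s y)) = cbwd c y]].
  move=> Bc ct; have [s0 s0t] := psurj t; rewrite -s0t in ct *.
  have [W [s [oW Wx sS sx sW]]] := submersion_section pS Bc ct.
  exists (chart_at A s0), W, s; split => //; first exact: charts_chart_at.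
  move=> y /sW[yD yE]; have /lrep_domP[y1 y2] := yD.
  by split=> //; [rewrite -yE; exact: cdom_image|exact: (lrep_eq yD)].
split.
  move=> t; pose c := chart_at B t.
  have ct : cdom c t by exact: cdom_chart_at.
  have Bc : charts B c by exact: charts_chart_at.
  have [a [W [s [Aa oW Wt sS sW]]]] := fac c t Bc ct.
  pose h := (g \o p) \o cbwd a \o s \o cfwd c.
  have hc : {for t, continuous h}.
    apply: (@continuous_comp _ _ _ (cfwd c)); first exact: cfwd_continuous.
    apply: (@continuous_comp _ _ _ s); first exact: (smooth_on_cont sS).
    apply: (@continuous_comp _ _ _ (cbwd a)); last exact: gpS.1.
    by apply: cbwd_continuous; have [] := sW _ Wt.
  have ht y : cdom c y -> W (cfwd c y) -> h y = g y.
    by move=> cy /sW[_ _]; rewrite /h/= => ->; rewrite cfwdK.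
  rewrite /continuous_at -ht//; apply: cvg_trans hc.
  apply: near_eq_cvg; near=> y; rewrite ht//; near: y.
    by apply: open_nbhs_nbhs; split => //; exact: cdom_open.
  by apply: (cfwd_continuous ct); apply: open_nbhs_nbhs.
move=> c e Bc Ce k'; apply: Ck_on_local => y yD; have /lrep_domP[cy ey] := yD.
have [a [W [s [Aa oW Wt sS sW]]]] := fac c (cbwd c y) Bc (cbwd_cdom cy).
rewrite cbwdK// in Wt.
have sDe z : (W `&` s @^-1` lrep_dom a e (g \o p)) z ->
    lrep a e (g \o p) (s z) = lrep c e g z.
  by move=> [/sW[_ _ pz] _]; rewrite /lrep/= pz.
have oDe := @lrep_dom_open R _ _ _ _ a e _ gpS.1.
have nD : nbhs y (W `&` s @^-1` lrep_dom a e (g \o p)).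
  apply: filterI; first exact: open_nbhs_nbhs.
  apply: (smooth_on_cont sS Wt); apply: open_nbhs_nbhs; split => //.
  have [s1 s2 s3] := sW _ Wt.
  by apply/lrep_domP; split => //=; rewrite s3.
move: nD; rewrite nbhsE => -[D' [oD' D'y] D'P]; exists D' => //.
apply: (@Ck_on_eq _ _ _ k' D' (lrep a e (g \o p) \o s)) => //.
  by move=> z /D'P/sDe.
apply: (@Ck_on_comp _ _ _ _ k' D' (lrep_dom a e (g \o p))) => //.
- exact: framed_rV.
- by move=> z /D'P[].
- by apply: Ck_on_sub (sS k') => z /D'P[].
- exact: (smooth_map_lrep gpS Aa Ce k').
Unshelve. all: by end_near. Qed.

End Manifold2.

(** * Symmetric forms *)

Section Gram.
Context {R : realType}.

Record sym_form (V : lmodType R) (b : V -> V -> R) : Prop := SymForm {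
  form_linear : forall k u v w, b (k *: u + v) w = k * b u w + b v w;
  form_sym : forall u v, b u v = b v u }.

Section Theory.
Variables (V : lmodType R) (b : V -> V -> R) (bS : sym_form b).

Lemma sformDl u v w : b (u + v) w = b u w + b v w.
Proof. by rewrite -[u]scale1r (form_linear bS) mul1r scale1r. Qed.
Lemma sform0l w : b 0 w = 0.
Proof. by apply: (@addrI _ (b 0 w)); rewrite -sformDl !addr0. Qed.
Lemma sformZl k u w : b (k *: u) w = k * b u w.
Proof. by rewrite -[k *: u]addr0 (form_linear bS) sform0l addr0. Qed.
Lemma sformNl u w : b (- u) w = - b u w.
Proof. by rewrite -scaleN1r sformZl mulN1r. Qed.
Lemma sformBl u v w : b (u - v) w = b u w - b v w.
Proof. by rewrite sformDl sformNl. Qed.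
Lemma sformDr u v w : b w (u + v) = b w u + b w v.
Proof. by rewrite !(form_sym bS w) sformDl. Qed.
Lemma sform0r w : b w 0 = 0.
Proof. by rewrite (form_sym bS) sform0l. Qed.
Lemma sformZr k u w : b w (k *: u) = k * b w u.
Proof. by rewrite !(form_sym bS w) sformZl. Qed.
Lemma sformNr u w : b w (- u) = - b w u.
Proof. by rewrite !(form_sym bS w) sformNl. Qed.
Lemma sformBr u v w : b w (u - v) = b w u - b w v.
Proof. by rewrite !(form_sym bS w) sformBl. Qed.
Lemma sform_suml (I : finType) (u : I -> V) w : b (\sum_i u i) w = \sum_i b (u i) w.
Proof.
by apply: (big_morph (fun x => b x w)) => [x y|]; [exact: sformDl|exact: sform0l].
Qed.
Lemma sform_sumr (I : finType) (u : I -> V) w : b w (\sum_i u i) = \sum_i b w (u i).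
Proof.
by rewrite (form_sym bS) sform_suml; apply: eq_bigr => i _; rewrite (form_sym bS).
Qed.
End Theory.

(** The row of l lies in the row space of the Gram matrix M as soon as it kills the columns of
    [cokermx M], and such a column c satisfies b c c = 0. The form b may be degenerate: the main use
    is a metric pulled back by the infinitesimal action, which vanishes on the isotropy algebra. *)
Lemma gram_solve p (b : 'rV[R]_p -> 'rV[R]_p -> R) (l : 'rV[R]_p -> R) :
  sym_form b -> (forall k u v, l (k *: u + v) = k * l u + l v) ->
  (forall c, b c c = 0 -> l c = 0) -> exists x, forall y, b x y = l y.
Proof.
move=> bS lL lb.
have l0 : l 0 = 0.
  have := lL 1 0 0; rewrite scale1r addr0 mul1r => /(congr1 (fun z => z - l 0)).
  by rewrite addrK subrr.
have lZ k u : l (k *: u) = k * l u by have := lL k u 0; rewrite addr0 l0 addr0.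
have lsum (y : 'rV[R]_p) : l y = \sum_j y 0 j * l (delta_mx 0 j).
  rewrite {1}(row_sum_delta y) (big_morph l (id1 := 0) (op1 := +%R)) => [|u v|//].
    by apply: eq_bigr => j _; rewrite lZ.
  by have := lL 1 u v; rewrite scale1r mul1r.
pose M : 'M[R]_p := \matrix_(i, j) b (delta_mx 0 i) (delta_mx 0 j).
pose r : 'rV[R]_p := \row_j l (delta_mx 0 j).
have bM x y : b x y = \sum_j (x *m M) 0 j * y 0 j.
  rewrite {1}(row_sum_delta y) (sform_sumr bS); apply: eq_bigr => j _.
  rewrite (sformZr bS) mulrC; congr (_ * _); rewrite {1}(row_sum_delta x) (sform_suml bS) mxE.
  by apply: eq_bigr => i _; rewrite (sformZl bS) [M i j]mxE.
have : (r <= M)%MS.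
  rewrite submxE; apply/eqP/matrixP => i j; rewrite [RHS]mxE ord1.
  pose c : 'rV[R]_p := (col j (cokermx M))^T.
  have Mc : M *m c^T = 0.
    by rewrite /c trmxK colE mulmxA mulmx_coker mul0mx.
  have bc z : b z c = 0.
    rewrite bM; transitivity ((z *m M *m c^T) 0 0).
      by rewrite [RHS]mxE; apply: eq_bigr => s _; rewrite [c^T _ _]mxE.
    by rewrite -mulmxA Mc mulmx0 mxE.
  have := lb c (bc c); rewrite lsum => lc; rewrite -[RHS]lc mxE.
  by apply: eq_bigr => s _; rewrite /c !mxE mulrC.
move=> /submxP[x xM]; exists x => y.
rewrite bM lsum -xM; apply: eq_bigr => j _; by rewrite mxE mulrC.
Qed.

End Gram.

(** * Orthogonal projection on the image of a linear map *)

Section OrthProj.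
Context {R : realType}.
Variables (m n : nat) (g : 'rV[R]_n -> 'rV[R]_n -> R) (st : 'rV[R]_m -> 'rV[R]_n).
Hypotheses (gS : sym_form g) (g0 : forall u, u != 0 -> 0 < g u u).
Hypothesis stL : forall k u v, st (k *: u + v) = k *: st u + st v.

Let st0 : st 0 = 0.
Proof.
by have := stL (-1) 0 0; rewrite scaler0 addr0 scaleN1r addNr.
Qed.

Lemma pullback_form : sym_form (fun u v => g (st u) (st v)).
Proof.
by split=> [k u v w|u v]; [rewrite stL (form_linear gS)|rewrite (form_sym gS)].
Qed.

Lemma sform_def u : g u u = 0 -> u = 0.
Proof. by move=> gu; apply/eqP/negPn/negP => /g0; rewrite gu ltxx. Qed.

Lemma sform_ge0 u : 0 <= g u u.
Proof. by have [->|/g0/ltW//] := eqVneq u 0; rewrite (sform0l gS). Qed.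

(** The projection is sought in the source of [st], through the pullback form, so that no basis of
    the image is needed. *)
Lemma orth_decomp v : exists x, forall y, g (v - st x) (st y) = 0.
Proof.
have [k u w|c gc|x xP] := gram_solve (l := fun y => g v (st y)) pullback_form.
- by rewrite stL (sformDr gS) (sformZr gS).
- by rewrite (sform_def gc) (sform0r gS).
- by exists x => y; rewrite (sformBl gS) xP subrr.
Qed.

Lemma orth_projP v : range st (orth_proj g (range st) v) /\
  forall w, range st w -> g (v - orth_proj g (range st) v) w = 0.
Proof.
rewrite /orth_proj; case: xgetP => [u _ [uS uP]//|].
have [x xP] := orth_decomp v => /(_ (st x)) [].
by split=> [|_ [y _ <-]]; [exists x|exact: xP].
Qed.

Lemma orth_proj_unique u v : range st u -> (forall w, range st w -> g (v - u) w = 0) ->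
  orth_proj g (range st) v = u.
Proof.
move=> [x _ xu] uP; have [[y _ yv] vP] := orth_projP v.
set P := orth_proj _ _ _ in yv vP *.
have Pu : P - u = st ((-1) *: x + y) by rewrite stL xu yv scaleN1r addrC.
apply/eqP; rewrite -subr_eq0; apply/eqP/sform_def.
have rPu : range st (P - u) by rewrite Pu; exists ((-1) *: x + y).
have := uP _ rPu; have := vP _ rPu; rewrite !(sformBl gS) => /eqP.
by rewrite subr_eq0 => /eqP <-; exact.
Qed.

Lemma orth_proj_linear k u v : orth_proj g (range st) (k *: u + v) =
  k *: orth_proj g (range st) u + orth_proj g (range st) v.
Proof.
have [[x _ xu] uP] := orth_projP u; have [[y _ yv] vP] := orth_projP v.
apply: orth_proj_unique; first by exists (k *: x + y); rewrite // stL xu yv.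
move=> w rw; rewrite opprD addrACA -scalerBr (form_linear gS) uP// vP//.
by rewrite mulr0 addr0.
Qed.

(** [rescaled_metric] at one point, the image of [st] being the tangent space of the orbit. *)
Definition rescaled_form (l : R) (u v : 'rV[R]_n) : R :=
  let P := orth_proj g (range st) in
  l ^- 2 * g (P u) (P v) + g (u - P u) (v - P v).

Lemma rescaled_form_sym_form l : sym_form (rescaled_form l).
Proof.
split=> [k u v w|u v]; rewrite /rescaled_form.
  rewrite orth_proj_linear opprD addrACA -scalerBr !(form_linear gS).
  by ring.
by rewrite !(form_sym gS (orth_proj _ _ u)) (form_sym gS (u - _)).
Qed.

Lemma rescaled_form_tangent l X X' :
  rescaled_form l (st X) (st X') = l ^- 2 * g (st X) (st X').
Proof.
have PX Y : orth_proj g (range st) (st Y) = st Y.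
  apply: orth_proj_unique; first by exists Y.
  by move=> w _; rewrite subrr (sform0l gS).
by rewrite /rescaled_form !PX !subrr (sform0l gS) addr0.
Qed.

Lemma rescaled_form_normal l X N :
  (forall Y, g (st Y) N = 0) -> rescaled_form l (st X) N = 0.
Proof.
move=> NP; have PN : orth_proj g (range st) N = 0.
  apply: orth_proj_unique; first by exists 0; rewrite ?st0.
  by move=> _ [Y _ <-]; rewrite subr0 (form_sym gS) NP.
have PX : orth_proj g (range st) (st X) = st X.
  apply: orth_proj_unique; first by exists X.
  by move=> w _; rewrite subrr (sform0l gS).
by rewrite /rescaled_form PX PN (sform0r gS) mulr0 add0r subrr (sform0l gS).
Qed.

End OrthProj.

(** * Rescaled Cheeger deformations at a point *)

Section Cheeger.
Context {R : realType}.
(* q is the inner product of the Lie algebra, h the metric of M at a point and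
   st the infinitesimal action X |-> X^*. *)
Variables (m n : nat) (q : 'rV[R]_m -> 'rV[R]_m -> R) (h : 'rV[R]_n -> 'rV[R]_n -> R).
Variable st : 'rV[R]_m -> 'rV[R]_n.
Hypotheses (qS : sym_form q) (q0 : forall u, u != 0 -> 0 < q u u).
Hypotheses (hS : sym_form h) (h0 : forall u, u != 0 -> 0 < h u u).
Hypothesis stL : forall k u v, st (k *: u + v) = k *: st u + st v.

Let st0 : st 0 = 0.
Proof.
by have := stL (-1) 0 0; rewrite scaler0 addr0 scaleN1r addNr.
Qed.
Let stB u v : st (u - v) = st u - st v.
Proof. by have := stL (-1) v u; rewrite !scaleN1r addrC => ->; rewrite addrC. Qed.

(* The differential at (1, z) of the action G * M -> M is (X, v) |-> X^* + v, so
   the conditions on (X, v) and (X', v') say that they are horizontal. *)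
Definition cheeger_form (l : R) (g : 'rV[R]_n -> 'rV[R]_n -> R) :=
  forall X v X' v',
    (forall Y, l ^+ 2 * q X Y = h v (st Y)) -> (forall Y, l ^+ 2 * q X' Y = h v' (st Y)) ->
    g (st X + v) (st X' + v') = l ^+ 2 * q X X' + h v v'.

Lemma cheeger_solve (l : R) X : 0 < l -> exists Y, forall Z,
  l ^+ 2 * q X Z = l ^+ 2 * q Y Z + h (st Y) (st Z).
Proof.
move=> l0; have l2 : 0 < l ^+ 2 by rewrite exprn_gt0.
pose b u v := l ^+ 2 * q u v + h (st u) (st v).
have bS : sym_form b.
  split=> [k u v w|u v]; rewrite /b.
    by rewrite stL !(form_linear qS, form_linear hS); ring.
  by rewrite (form_sym qS) (form_sym hS).
have [k u v|c bc|Y YP] := gram_solve (l := fun Z => l ^+ 2 * q X Z) bS.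
- by rewrite (sformDr qS) (sformZr qS); ring.
- suff -> : c = 0 by rewrite (sform0r qS) mulr0.
  apply/eqP/negPn/negP => /q0 qc.
  have := sform_ge0 hS h0 (st c); move: bc; rewrite /b => bc hc.
  have := mulr_gt0 l2 qc; lra.
- by exists Y => Z; rewrite -YP.
Qed.

Lemma cheeger_horizontal l X Y : (forall Z,
  l ^+ 2 * q X Z = l ^+ 2 * q Y Z + h (st Y) (st Z)) ->
  forall Z, l ^+ 2 * q (X - Y) Z = h (st Y) (st Z).
Proof. by move=> YP Z; rewrite (sformBl qS) mulrBr YP addrC addKr. Qed.

(** The squared length of the lift (X - Y, st Y), with |st Y|^2 eliminated by the equation for Y; q
    X Y is the defect to be estimated. *)
Lemma cheeger_tangent (l : R) g X : 0 < l -> cheeger_form l g ->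
  exists Y, (forall Z, l ^+ 2 * q X Z = l ^+ 2 * q Y Z + h (st Y) (st Z)) /\
    l ^- 2 * g (st X) (st X) = q X X - q X Y.
Proof.
move=> l0 gC; have [Y YP] := cheeger_solve X l0; exists Y; split=> //.
have hor := cheeger_horizontal YP.
have := gC _ _ _ _ hor hor; rewrite stB subrK => ->.
have := YP X; have := YP Y; rewrite !(sformBl qS) !(sformBr qS).
rewrite (form_sym qS Y X) => e1 e2.
have -> : h (st Y) (st Y) = l ^+ 2 * q X Y - l ^+ 2 * q Y Y by rewrite e1 addrC addKr.
by field; rewrite gt_eqF.
Qed.

Lemma cheeger_tangent_le (l : R) g X : 0 < l -> cheeger_form l g ->
  l ^- 2 * g (st X) (st X) <= q X X.
Proof.
move=> l0 gC; have [Y [YP ->]] := cheeger_tangent X l0 gC.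
have l2 : 0 < l ^+ 2 by rewrite exprn_gt0.
rewrite gerBl -(pmulr_rge0 _ l2) YP addr_ge0//; last exact: (sform_ge0 hS h0).
by apply: mulr_ge0; [exact: ltW|exact: (sform_ge0 qS q0)].
Qed.

(** Orthogonality to the kernel yields W, independent of l, with q X Z = h (st W) (st Z). Testing
    the equation of Y against W gives the defect q X Y = l^2 (q X W - q Y W). Since |Y|^2 <= q X Y,
    also |Y| <= |X|, and - q Y W is bounded independently of l. *)
Lemma cheeger_tangent_ge X : (forall Z, st Z = 0 -> q X Z = 0) ->
  exists C : R, forall l g, 0 < l -> cheeger_form l g ->
    q X X - C * l ^+ 2 <= l ^- 2 * g (st X) (st X).
Proof.
move=> XP.
have [k u v|c hc|W WP] := gram_solve (l := q X) (pullback_form hS stL).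
- by rewrite (sformDr qS) (sformZr qS).
- exact/XP/(sform_def h0 hc).
exists (q X W + 2^-1 * (q X X + q W W)) => l g l0 gC.
have l2 : 0 < l ^+ 2 by rewrite exprn_gt0.
have [Y [YP ->]] := cheeger_tangent X l0 gC.
have e1 : q X Y = l ^+ 2 * q X W - l ^+ 2 * q Y W.
  by rewrite -WP (form_sym hS) (YP W) [in RHS]addrC addKr.
have qYX : q Y Y <= q X Y.
  rewrite -(ler_pM2l l2) YP lerDl; exact: (sform_ge0 hS h0).
have p1 := sform_ge0 qS q0 (X - Y); have p2 := sform_ge0 qS q0 (Y + W).
move: p1 p2; rewrite !(sformBl qS) !(sformBr qS) !(sformDl qS) !(sformDr qS).
rewrite (form_sym qS Y X) (form_sym qS W Y) => p1 p2.
have : - q Y W <= 2^-1 * (q X X + q W W) by lra.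
rewrite -(ler_pM2l l2) => p3.
by rewrite lerD2l lerN2 e1 (mulrC _ (l ^+ 2)) mulrDr lerD2l -mulrN.
Qed.

(** (0, N) is horizontal, and orthogonal to the lift of [st X]. *)
Lemma cheeger_normal (l : R) g N X : 0 < l -> cheeger_form l g ->
  (forall Y, h N (st Y) = 0) -> g (st X) N = 0.
Proof.
move=> l0 gC NP; have [Y YP] := cheeger_solve X l0.
have hor := cheeger_horizontal YP.
have hor' Z : l ^+ 2 * q 0 Z = h N (st Z) by rewrite NP (sform0l qS) mulr0.
have := gC _ _ _ _ hor hor'; rewrite stB subrK st0 add0r => ->.
by rewrite (sform0r qS) mulr0 add0r (form_sym hS) NP.
Qed.

Variables (gl : R -> 'rV[R]_n -> 'rV[R]_n -> R) (gt : 'rV[R]_n -> 'rV[R]_n -> R).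
Hypotheses (glS : forall l, 0 < l -> sym_form (gl l)).
Hypothesis gl0 : forall l, 0 < l -> forall u, u != 0 -> 0 < gl l u u.
Hypothesis glC : forall l, 0 < l -> cheeger_form l (gl l).
Hypothesis gtlim : forall u v (e : R), 0 < e ->
  \forall l \near (0 : R)^'+, `|rescaled_form (gl l) st l u v - gt u v| < e.

Lemma limit_tangent_le X : gt (st X) (st X) <= q X X.
Proof.
apply/ler_addgt0Pr => e e0.
have : \forall l \near (0 : R)^'+, gt (st X) (st X) <= q X X + e.
  near=> l; have l0 : 0 < l by near: l; exact: nbhs_right_gt.
  have : `|rescaled_form (gl l) st l (st X) (st X) - gt (st X) (st X)| < e.
    by near: l; exact: gtlim.
  rewrite (rescaled_form_tangent (glS l0) (gl0 l0) stL).
  have := cheeger_tangent_le X l0 (glC l0).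
  by rewrite distrC ltr_norml => a1 /andP[_ a2]; lra.
by move=> /filter_ex[].
Unshelve. all: by end_near. Qed.

Lemma limit_tangent_eq X : (forall Z, st Z = 0 -> q X Z = 0) ->
  gt (st X) (st X) = q X X.
Proof.
move=> XP; apply/eqP; rewrite eq_le limit_tangent_le/=.
apply/ler_addgt0Pr => e e0.
have [C CP] := cheeger_tangent_ge XP.
(* For l < 1 and l < d the error C l^2 is at most (|C| + 1) d = e / 2; the other half of e pays for
   the convergence. *)
pose d : R := e / (2 * (`|C| + 1)).
have C1 : 0 < `|C| + 1 by rewrite ltr_wpDl.
have d0 : 0 < d by rewrite divr_gt0// mulr_gt0.
have e2 : 0 < e / 2 by rewrite divr_gt0.
have : \forall l \near (0 : R)^'+, q X X <= gt (st X) (st X) + e.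
  near=> l; have l0 : 0 < l by near: l; exact: nbhs_right_gt.
  have l1 : l < 1 by near: l; exact: nbhs_right_lt.
  have ld : l < d by near: l; exact: nbhs_right_lt.
  have : `|rescaled_form (gl l) st l (st X) (st X) - gt (st X) (st X)| < e / 2.
    by near: l; exact: gtlim.
  rewrite (rescaled_form_tangent (glS l0) (gl0 l0) stL).
  have := CP l _ l0 (glC l0).
  have : C * l ^+ 2 <= e / 2.
    have l2l : l ^+ 2 <= l by rewrite expr2 ler_piMr ?ltW.
    apply: (@le_trans _ _ ((`|C| + 1) * d)).
      apply: (@le_trans _ _ (`|C| * l ^+ 2)).
        by rewrite ler_wpM2r ?sqr_ge0 ?ler_norm.
      apply: ler_pM; rewrite ?sqr_ge0 ?lerDl//.
      exact: (le_trans l2l (ltW ld)).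
    rewrite /d invfM mulrC -!mulrA mulVf ?gt_eqF// mulr1.
    by rewrite lexx.
  by rewrite ltr_norml => a1 a2 /andP[a3 a4]; lra.
by move=> /filter_ex[].
Unshelve. all: by end_near. Qed.

Lemma limit_normal X N : (forall Y, h N (st Y) = 0) -> gt (st X) N = 0.
Proof.
move=> NP; apply/eqP; rewrite -normr_le0; apply/ler_addgt0Pr => e e0.
have : \forall l \near (0 : R)^'+, `|gt (st X) N| <= 0 + e.
  near=> l; have l0 : 0 < l by near: l; exact: nbhs_right_gt.
  have : `|rescaled_form (gl l) st l (st X) N - gt (st X) N| < e.
    by near: l; exact: gtlim.
  rewrite (rescaled_form_normal (glS l0) (gl0 l0) stL).
    by rewrite sub0r normrN add0r => /ltW.
  by move=> Y; exact: (cheeger_normal _ l0 (glC l0) NP).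
by move=> /filter_ex[].
Unshelve. all: by end_near. Qed.

End Cheeger.

(** * Maps of constant rank *)

Section ConstantRank.
Context {R : realType}.
Implicit Types E F : normedModType R.

Lemma derive0_constant n (f : R -> 'rV[R]_n) (r : R) :
  (forall t : R, `|t| < r -> differentiable f t /\ 'D_1 f t = 0) ->
  forall t : R, `|t| < r -> f t = f 0.
Proof.
move=> fP t tr; apply/rowP => j.
have sm (s : R) : 0 <= s <= 1 -> `|0 + s *: t| < r.
  move=> /andP[s0 s1]; rewrite add0r normrZ; apply: le_lt_trans tr.
  by rewrite ler_piMl// ger0_norm.
have fd (s : R) : 0 <= s <= 1 -> differentiable (row_coord j \o f) (0 + s *: t).
  move=> /sm/fP[df _].
  by have [] := @derive_lin_comp R _ _ R^o f (row_coord j) _ (@row_coord_continuous R n j) df.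
have [s /andP[s0 s1]] := @line_mvt R R^o (row_coord j \o f) 0 t 1 ltr01 fd.
have s01 : 0 <= s <= 1 by rewrite !ltW.
have [df d0] := fP _ (sm s s01).
have [_ ->] := @derive_lin_comp R _ _ R^o f (row_coord j) _ (@row_coord_continuous R n j) df.
have -> : 'D_t f (0 + s *: t) = 0.
  have tE : t = \sum_(i < 1) t *: (1 : R^o) by rewrite big_ord1 [RHS]mulr1.
  by rewrite [X in 'D_X _ _]tE derive_sum_dir// big_ord1 d0 scaler0.
rewrite linear0 mulr0 /= add0r scale1r => /eqP; rewrite subr_eq0 => /eqP.
exact.
Qed.

(** P D P improves an inner inverse P. The second identity recovers (O u - O u0) A from H u in
    [constant_rank_curve]. *)
Lemma reflexive_ginverse (K : fieldType) m n (D : 'M[K]_(m, n)) :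
  exists2 A, D *m A *m D = D & A *m D *m A = A.
Proof.
have [P DPD] : exists P, D *m P *m D = D by exists (pinvmx D); rewrite mulmxKpV.
have DAD : D *m (P *m D *m P) *m D = D by rewrite !mulmxA DPD DPD.
exists (P *m D *m P) => //.
have -> : P *m D *m P *m D *m (P *m D *m P) = P *m (D *m (P *m D *m P) *m D) *m P.
  by rewrite !mulmxA.
by rewrite DAD.
Qed.

(* A map whose differentials all factor through the one at u0 has constant
   rank near u0; H straightens the fibre of O through u0. *)
Lemma constant_rank_curve m n (D0 : set 'rV[R]_m) (O : 'rV[R]_m -> 'rV[R]_n)
    u0 (S : 'rV[R]_m -> 'M[R]_n) X :
  open D0 -> D0 u0 -> smooth_on D0 O ->
  (forall u Y, D0 u -> exists Z, 'D_Y O u = Z *m jmx O u0 *m S u) ->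
  (forall i j, Ck_on 0 D0 (fun u => S u i j)) -> S u0 = 1%:M ->
  X *m jmx O u0 = 0 ->
  exists c : R -> 'rV[R]_m, [/\ c 0 = u0, differentiable c 0, 'D_1 c 0 = X &
    \forall t \near (0 : R), D0 (c t) /\ O (c t) = O u0].
Proof.
move=> oD0 D0u0 OS OZ Sc S0 XD.
set D := jmx O u0 in OZ XD.
have [A DAD ADA] := reflexive_ginverse D.
(* If v = Z D and v S A = 0, then v N = v - v A D = 0 by D A D = D. As N is the identity at u0, it
   is invertible nearby and v = 0: a derivative of O killed by A vanishes. *)
pose N u := 1%:M - (1%:M - S u) *m (A *m D).
have [D1 [oD1 D1u0] D1P] : exists2 U, open_nbhs u0 U & U `<=` (fun u => D0 u /\ N u \in unitmx).
  suff : nbhs u0 (fun u => D0 u /\ N u \in unitmx) by rewrite nbhsE.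
  apply: filterI; first exact: open_nbhs_nbhs.
  have NC k : (forall i j, Ck_on k D0 (fun u => S u i j)) ->
      forall i j, Ck_on k D0 (fun u => N u i j).
    move=> SC i j; under eq_fun do rewrite !mxE.
    apply: Ck_on_add => //; first exact: Ck_on_cst.
    under eq_fun do rewrite -mulN1r.
    apply: Ck_on_mul => //; first exact: Ck_on_cst.
    apply: Ck_on_sum => // l; apply: Ck_on_mul => //; last exact: Ck_on_cst.
    under eq_fun do rewrite !mxE -mulN1r.
    apply: Ck_on_add => //; first exact: Ck_on_cst.
    by apply: Ck_on_mul => //; exact: Ck_on_cst.
  have : {for u0, continuous (fun u => \det (N u) : R)}.
    exact: (@Ck_on_det _ _ 0 D0 _ N oD0 (NC 0%N Sc)).
  have N0 : \det (N u0) = 1 by rewrite /N S0 subrr mul0mx subr0 det1.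
  rewrite /prop_for/continuous_at N0 => /cvgrPdist_lt/(_ 1 ltr01).
  apply: filterS => y dy; rewrite unitmxE unitfE; apply: contraPneq dy => ->.
  by rewrite subr0 normr1 ltxx.
have D1D0 u : D1 u -> D0 u by move=> /D1P[].
(* H replaces the component of u - u0 along the projection D A by (O u - O u0) A; its differential
   at u0 is (1 - D A) + D A = 1. *)
pose H u := (u - u0) *m (1%:M - D *m A) + (O u - O u0) *m A.
have oS k : Ck_on k D1 O by apply: Ck_on_sub (OS k) => u /D1D0.
have HS : smooth_on D1 H.
  move=> k; apply: Ck_on_add => //.
    apply: (@Ck_on_lin_comp _ _ _ _ k D1 (fun u => u - u0) (mulmxr (1%:M - D *m A))) => //.
      exact: linear_rV_continuous.
    by apply: Ck_on_add => //; [exact: Ck_on_id|exact: Ck_on_cst].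
  apply: (@Ck_on_lin_comp _ _ _ _ k D1 (fun u => O u - O u0) (mulmxr A)) => //.
    exact: linear_rV_continuous.
  by apply: Ck_on_add => //; exact: Ck_on_cst.
have Od u : D1 u -> differentiable O u by move=> /D1D0; exact: smooth_on_diff.
have lind k l (Lm : 'M[R]_(k, l)) (f : 'rV[R]_m -> 'rV[R]_k) (y0 : 'rV[R]_k) u v : differentiable f u ->
    differentiable (fun u => (f u - y0) *m Lm) u /\
    'D_v (fun u => (f u - y0) *m Lm) u = 'D_v f u *m Lm.
  move=> df.
  have dfy : differentiable (f - cst y0) u by exact: differentiableB.
  have cL := @linear_rV_continuous R k _ (mulmxr Lm).
  have [e1 e2] := derive_lin_comp cL dfy; split; first exact: e1.
  rewrite [LHS](e2 v) deriveB; [|exact: diff_derivable..].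
  by rewrite derive_cst subr0.
have Hd v : 'D_v H u0 = v.
  have did : differentiable (id : 'rV[R]_m -> 'rV[R]_m) u0 by exact: ex_diff.
  have [d1 e1] := @lind _ _ (1%:M - D *m A) id u0 u0 v did.
  have [d2 e2] := @lind _ _ A O (O u0) u0 v (Od _ D1u0).
  rewrite [LHS](deriveD (diff_derivable d1) (diff_derivable d2)) e1 e2 derive_id.
  by rewrite (derive_jmx v (Od _ D1u0)) -/D mulmxBr mulmx1 mulmxA subrK.
have [B [K [oB B0 KS K0 KP]]] := local_inverse oD1 D1u0 HS Hd.
have H0 : H u0 = 0 by rewrite /H !subrr !mul0mx addr0.
rewrite H0 in B0 K0.
have Kd w : B w -> differentiable K w by exact: smooth_on_diff.
(* X D = 0 makes D A kill H (c t) = t X, so (O - O u0) A vanishes along c. *)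
pose c (t : R) := K (0 + t *: X).
have /nbhs_normltP[r r0 rB] := open_nbhs_nbhs (conj oB B0).
pose r' := r / (`|X| + 1).
have X1 : 0 < `|X| + 1 by rewrite ltr_wpDl.
have r'0 : 0 < r' by rewrite divr_gt0.
have tB (t : R) : `|t| < r' -> B (0 + t *: X).
  move=> tr; apply: rB; rewrite add0r subr0 normrZ.
  apply: (@le_lt_trans _ _ (`|t| * (`|X| + 1))); first by rewrite ler_wpM2l// lerDl.
  by rewrite -ltr_pdivlMr.
have cd (t : R) : `|t| < r' -> differentiable c t /\ 'D_1 c t = 'D_X K (0 + t *: X).
  by move=> /tB/Kd; exact: derive_line.
have z0 : `|0 : R| < r' by rewrite normr0.
exists c; split.
- by rewrite /c scale0r addr0.
- by have [] := cd 0 z0.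
- have [_ ->] := cd 0 z0; rewrite scale0r addr0.
  have dK := Kd _ B0; have dH : differentiable H (K 0) by rewrite K0; exact: smooth_on_diff D1u0.
  have : 'D_X (H \o K) 0 = X.
    rewrite -[RHS](derive_id (0 : 'rV[R]_m) X); apply: near_eq_derive.
    by apply: filterS (open_nbhs_nbhs (conj oB B0)) => w /KP[].
  by rewrite derive_comp// K0 Hd.
have HDA u : H u *m (D *m A) = (O u - O u0) *m A.
  have e1 : (1%:M - D *m A) *m (D *m A) = 0 by rewrite mulmxBl mul1mx mulmxA DAD subrr.
  by rewrite /H mulmxDl -(mulmxA (u - u0)) e1 mulmx0 add0r -mulmxA (mulmxA A D A) ADA.
have cP (t : R) : `|t| < r' -> D1 (c t) /\ (O (c t) - O u0) *m A = 0.
  move=> /tB/KP[D1c Hc]; split => //.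
  by rewrite -HDA Hc add0r -scalemxAl (mulmxA X D A) XD mul0mx scaler0.
have Ocd (t : R) : `|t| < r' -> differentiable (O \o c) t /\ 'D_1 (O \o c) t = 0.
  move=> tr; have [D1c _] := cP t tr; have [dc _] := cd t tr.
  have dO := Od _ D1c.
  have dOc : differentiable (O \o c) t by exact: differentiable_comp.
  split=> //.
  have cA := @linear_rV_continuous R n _ (mulmxr A).
  have dOc' : differentiable ((O \o c) - cst (O u0)) t by exact: differentiableB.
  have [_ eA] := derive_lin_comp cA dOc'.
  have : 'D_1 (O \o c) t *m A = 0.
    have := eA 1; rewrite deriveB; [|exact: diff_derivable..].
    rewrite derive_cst subr0 /= => <-.
    rewrite -[RHS](derive_cst (0 : 'rV[R]_m) t 1); apply: near_eq_derive.
    have : \forall s \near t, `|s| < r'.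
      apply/nbhs_normltP; exists (r' - `|t|); first by rewrite subr_gt0.
      by move=> s st; have := ler_normD (s - t) t; rewrite subrK => /le_lt_trans; apply; rewrite -ltrBrDr.
    by apply: filterS => s /cP[].
  rewrite derive_comp//; have [Z ->] := OZ (c t) ('D_1 c t) (D1D0 _ D1c).
  set v := Z *m D => vSA.
  have vN : v *m N (c t) = 0.
    rewrite /N mulmxBr mulmx1 mulmxA mulmxBr mulmx1 mulmxBl [v *m S _ *m _]mulmxA vSA mul0mx subr0.
    by rewrite /v -mulmxA (mulmxA D) DAD subrr.
  have [_ Nu] := D1P _ D1c.
  have -> : v = 0 by rewrite -[v]mulmx1 -(mulmxV Nu) mulmxA vN mul0mx.
  by rewrite mul0mx.
apply/nbhs_normltP; exists r' => // t; rewrite subr0 => tr.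
have [D1c _] := cP t tr; split; first exact: D1D0.
rewrite [LHS](derive0_constant Ocd tr) /=; congr O.
by rewrite /c scale0r addr0.
Qed.

End ConstantRank.

(** * Smooth actions *)

Section ActionCalculus.
Context {R : realType} (m n : nat).
Context (G : topGroupType) (AG : atlas 'rV[R]_m G) (G_lie : lie_group AG).
Context (M : topologicalType) (AM : atlas 'rV[R]_n M).
Context (a : group_action G M) (aS : smooth_action a AG AM).

Let framedGM := framed_prod (@framed_rV R m) (@framed_rV R n).
Let framedGG := framed_prod (@framed_rV R m) (@framed_rV R m).

Definition act (z : G * M) : M := a z.1 z.2.

Lemma act_smooth : smooth_map (prod_atlas AG AM) AM act.
Proof. exact: aS. Qed.

Lemma pairl_smooth (x : M) : smooth_map AG (prod_atlas AG AM) (fun g => (g, x)).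
Proof. exact: smooth_map_pair (smooth_map_id _) (smooth_map_cst _ _ _). Qed.

Lemma pairr_smooth (h : G) : smooth_map AM (prod_atlas AG AM) (fun y => (h, y)).
Proof. exact: smooth_map_pair (smooth_map_cst _ _ _) (smooth_map_id _). Qed.

Definition orb (x : M) (g : G) : M := a g x.

Lemma orb_smooth x : smooth_map AG AM (orb x).
Proof. exact: (smooth_map_comp framedGM (pairl_smooth x) act_smooth). Qed.

Lemma tr_smooth h : smooth_map AM AM (a h).
Proof. exact: (smooth_map_comp framedGM (pairr_smooth h) act_smooth). Qed.

Definition lmul (h g : G) : G := (h * g)%g.
Definition rmul (h g : G) : G := (g * h)%g.

Lemma lmul_smooth h : smooth_map AG AG (lmul h).
Proof.
have [_ mS _] := G_lie.
exact: (smooth_map_comp framedGG (smooth_map_pair (smooth_map_cst _ _ _) (smooth_map_id _)) mS).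
Qed.

Lemma rmul_smooth h : smooth_map AG AG (rmul h).
Proof.
have [_ mS _] := G_lie.
exact: (smooth_map_comp framedGG (smooth_map_pair (smooth_map_id _) (smooth_map_cst _ _ _)) mS).
Qed.

Definition star (x : M) (X : 'rV[R]_m) : 'rV[R]_n := dmap AG AM (orb x) 1%g X.

Lemma star_linear x k u v : star x (k *: u + v) = k *: star x u + star x v.
Proof. exact: dmap_linear. Qed.

Lemma a1_id : a 1%g = id :> (M -> M).
Proof. by apply/funext => x; rewrite gact1. Qed.

Lemma dmap_act x X v :
  dmap (prod_atlas AG AM) AM act (1%g, x) (X, v) = star x X + v.
Proof.
have -> : (X, v) = (X, 0) + (0, v) by congr pair; rewrite /= ?addr0 ?add0r.
rewrite dmapD; congr (_ + _).
  rewrite /star (@dmap_comp R _ _ _ _ _ _ AG (prod_atlas AG AM) AM (fun g => (g, x)) act 1%g X framedGM).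
  - rewrite dmap_pair; [|exact: smooth_map_id|exact: smooth_map_cst].
    by rewrite dmap_id dmap_cst.
  - exact: pairl_smooth.
  - exact: act_smooth.
transitivity (dmap AM AM (a 1%g) x v); last by rewrite a1_id dmap_id.
rewrite (@dmap_comp R _ _ _ _ _ _ AM (prod_atlas AG AM) AM (fun y => (1%g, y)) act x v framedGM).
- rewrite dmap_pair; [|exact: smooth_map_cst|exact: smooth_map_id].
  by rewrite dmap_id dmap_cst.
- exact: pairr_smooth.
- exact: act_smooth.
Qed.

(** Two descriptions of the tangent space of the orbit at h x: right translation gives the fields
    [star] at h x, left translation ([dorb_left]) the images under h of those at x. *)
Lemma dorb_right h x Z :
  dmap AG AM (orb x) h (dmap AG AG (rmul h) 1%g Z) = star (a h x) Z.
Proof.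
have e : orb (a h x) = orb x \o rmul h.
  by apply/funext => g; rewrite /orb /rmul/= gactM.
rewrite /star e (dmap_comp _ _ (framed_rV m) (rmul_smooth h) (orb_smooth x)).
by rewrite /rmul mul1g.
Qed.

Lemma dorb_left h x Z :
  dmap AG AM (orb x) h (dmap AG AG (lmul h) 1%g Z) = dmap AM AM (a h) x (star x Z).
Proof.
have e : orb x \o lmul h = a h \o orb x.
  by apply/funext => g; rewrite /orb /lmul/= gactM.
have := dmap_comp 1%g Z (framed_rV m) (lmul_smooth h) (orb_smooth x).
rewrite e (dmap_comp _ _ (framed_rV n) (orb_smooth x) (tr_smooth h)).
by rewrite /lmul mulg1 /orb gact1.
Qed.

Lemma drmulK h (X : 'rV[R]_m) : exists Z, dmap AG AG (rmul h) 1%g Z = X.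
Proof.
exists (dmap AG AG (rmul h^-1%g) h X).
have e : rmul h \o rmul h^-1%g = id by apply/funext => g; rewrite /rmul/= -mulgA mulVg mulg1.
have := dmap_comp h X (framed_rV m) (rmul_smooth h^-1%g) (rmul_smooth h).
by rewrite e dmap_id /rmul mulgV => <-.
Qed.

Lemma dlmulK h (X : 'rV[R]_m) : exists Z, dmap AG AG (lmul h) 1%g Z = X.
Proof.
exists (dmap AG AG (lmul h^-1%g) h X).
have e : lmul h \o lmul h^-1%g = id by apply/funext => g; rewrite /lmul/= mulgA mulgV mul1g.
have := dmap_comp h X (framed_rV m) (lmul_smooth h^-1%g) (lmul_smooth h).
by rewrite e dmap_id /lmul mulVg => <-.
Qed.

Lemma dtr_inj h x v : dmap AM AM (a h) x v = 0 -> v = 0.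
Proof.
move=> dv.
have e : a h^-1%g \o a h = id by apply/funext => y; rewrite /= -gactM mulVg gact1.
have := dmap_comp x v (framed_rV n) (tr_smooth h) (tr_smooth h^-1%g).
by rewrite e dmap_id dv dmap0.
Qed.

Lemma derive_partial2 (E F H : normedModType R) (B : (E * F)%type -> H) u z w :
  differentiable B (u, z) -> 'D_w (fun z => B (u, z)) z = 'D_(0, w) B (u, z).
Proof.
move=> dB.
have d1 : differentiable (cst u : F -> E) z by exact: differentiable_cst.
have d2 : differentiable (id : F -> F) z by exact: ex_diff.
rewrite (@derive_comp R F _ H (fun z => (u, z)) B _ _ (differentiable_pair d1 d2) dB).
by rewrite (@derive_pair R _ _ _ (cst u) id)// derive_cst derive_id.
Qed.

Lemma derive_partial1 (E F H : normedModType R) (B : (E * F)%type -> H) u z w :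
  differentiable B (u, z) -> 'D_w (fun u => B (u, z)) u = 'D_(w, 0) B (u, z).
Proof.
move=> dB.
have d1 : differentiable (cst z : E -> F) u by exact: differentiable_cst.
have d2 : differentiable (id : E -> E) u by exact: ex_diff.
rewrite (@derive_comp R E _ H (fun u => (u, z)) B _ _ (differentiable_pair d2 d1) dB).
by rewrite (@derive_pair R _ _ _ id (cst z))// derive_cst derive_id.
Qed.

(* X is tangent to the isotropy group: it is the velocity of a curve in G_x. *)
Lemma isotropy_tangent (H : normedModType R) (T : topologicalType) (C : atlas H T)
    (f : G -> T) x X :
  smooth_map AG C f -> (forall h, a h x = x -> f h = f 1%g) ->
  star x X = 0 -> dmap AG C f 1%g X = 0.
Proof.
move=> fS fx sX.
pose eta := chart_at AG 1%g; pose kap := chart_at AM x.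
have Ae : charts AG eta by exact: charts_chart_at.
have Ak : charts AM kap by exact: charts_chart_at.
have e1 : cdom eta 1%g by exact: cdom_chart_at.
have kx : cdom kap x by exact: cdom_chart_at.
pose u0 := cfwd eta 1%g; pose z0 := cfwd kap x.
pose O := lrep eta kap (orb x).
pose D0 := lrep_dom eta kap (orb x).
have oD0 : open D0 by apply: lrep_dom_open; exact: (orb_smooth x).1.
have ox1 : orb x 1%g = x by rewrite /orb gact1.
have D0u0 : D0 u0 by apply: lrep_dom_cfwd => //; rewrite ox1.
have OS : smooth_on D0 O by exact: smooth_map_lrep (orb_smooth x) Ae Ak.
have Ou0 : O u0 = z0 by rewrite /O lrep_cfwd// ox1.
pose S u := jmx (lrep kap kap (a (cbwd eta u))) z0.
pose B := lrep (prod_chart eta kap) kap act.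
pose DB := lrep_dom (prod_chart eta kap) kap act.
have BS : smooth_on DB B.
  apply: (smooth_map_lrep act_smooth) => //.
  by exists eta, kap.
have oDB : open DB by apply: lrep_dom_open; exact: act_smooth.1.
have D0B u : D0 u -> DB (u, z0).
  move=> [g [ge gk] <-]; exists (g, x) => //.
have Sdom u : D0 u -> lrep_dom kap kap (a (cbwd eta u)) z0.
  by move=> [g [ge gk] <-]; rewrite cfwdK//; exact: lrep_dom_cfwd.
have Sd u : D0 u -> differentiable (lrep kap kap (a (cbwd eta u))) z0.
  by move=> /Sdom; exact: (lrep_diff (tr_smooth _)).
(* The entries of S are partial derivatives of the action map in its second variable, hence
   continuous in u. *)
have SC i j : Ck_on 0 D0 (fun u => S u i j).
  apply: (@Ck_on_eq _ _ _ 0 D0 (fun u => ('D_(0, delta_mx 0 i) B (u, z0)) 0 j)) => //.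
    move=> u D0u; rewrite /S jmxE.
    have dB : differentiable B (u, z0) by apply: (smooth_on_diff BS); exact: D0B.
    by rewrite -(derive_partial2 _ dB).
  apply: Ck_on_coord => //.
  apply: (@Ck_on_comp _ _ _ _ 0 D0 DB (fun u => (u, z0)) ('D_(0, delta_mx 0 i) B)) => //.
  - by apply: Ck_on_pair => //; [exact: Ck_on_id|exact: Ck_on_cst].
  - exact: smooth_on_derive BS 0%N.
have S0 : S u0 = 1%:M.
  rewrite /S /u0 cfwdK// a1_id; apply/row_matrixP => i.
  rewrite rowE -derive_jmx; last first.
    apply: (lrep_diff (smooth_map_id AM)) => //; exact: lrep_dom_cfwd.
  rewrite rowE mulmx1 -[RHS](derive_id z0); apply: near_eq_derive.
  by apply: filterS (near_chart_cod AM x) => y yc; rewrite /lrep/= cbwdK.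
(* Equivariance: with h the group element of coordinate u, the orbit map is itself preceded by left
   translation by the inverse of h and followed by the action of h. *)
have OZ u Y : D0 u -> exists Z, 'D_Y O u = Z *m jmx O u0 *m S u.
  move=> D0u; have /lrep_domP[ue uk] := D0u.
  pose h := cbwd eta u.
  have e : (a h \o orb x) \o lmul h^-1%g = orb x.
    by apply/funext => g; rewrite /orb /lmul/= -gactM mulgA mulgV mul1g.
  have Le : lrep_dom eta eta (lmul h^-1%g) u.
    by apply/lrep_domP; split => //; rewrite /lmul -/h mulVg.
  have Lu : lrep eta eta (lmul h^-1%g) u = u0 by rewrite /lrep/= /lmul -/h mulVg.
  exists ('D_Y (lrep eta eta (lmul h^-1%g)) u).
  rewrite /O -{1}e.
  have hoS := smooth_map_comp (framed_rV n) (orb_smooth x) (tr_smooth h).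
  have D0u' : lrep_dom eta kap ((a h \o orb x) \o lmul h^-1%g) u by rewrite e.
  rewrite (derive_lrep_comp Y (lmul_smooth h^-1%g) hoS Ae Ae Ak Le D0u') Lu.
  have hx1 : lrep_dom eta kap (a h \o orb x) u0.
    by apply/lrep_domP; rewrite /u0 cfwdK//= ox1; split => //; exact: cdom_image.
  rewrite (derive_lrep_comp _ (orb_smooth x) (tr_smooth h) Ae Ak Ak D0u0 hx1).
  rewrite -/O Ou0 (derive_jmx _ (Sd _ D0u)) (derive_jmx _ (smooth_on_diff OS D0u0)).
  by [].
have XO : X *m jmx O u0 = 0.
  rewrite -derive_jmx; last exact: smooth_on_diff D0u0.
  by move: sX; rewrite /star dmapE ?ox1//; exact: orb_smooth.
have [c [c0 cd cX cO]] := constant_rank_curve oD0 D0u0 OS OZ SC S0 XO.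
rewrite dmapE// -/eta -/u0.
set F := lrep _ _ f.
have dF : differentiable F u0.
  apply: (lrep_diff fS) => //; first exact: charts_chart_at.
  by apply: lrep_dom_cfwd => //; exact: cdom_chart_at.
have : 'D_1 (F \o c) 0 = 'D_X F u0 by rewrite derive_comp ?c0 ?cX.
move=> <-; rewrite -[RHS](derive_cst (F u0) (0 : R) 1); apply: near_eq_derive.
apply: filterS cO => t [/lrep_domP[ct kt] Ot].
have ax : a (cbwd eta (c t)) x = x.
  rewrite -[LHS](cfwdK kt) -[RHS](cfwdK kx); congr (cbwd kap).
  by move: Ot; rewrite Ou0.
by rewrite /F /lrep/= (fx _ ax) /u0 cfwdK.
Qed.

End ActionCalculus.

(** * Vectors orthogonal to a kernel, and limits of forms in a frame *)

Section MoreForms.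
Context {R : realType}.

(** Subtracts from X its projection on the kernel, which is presented as the image of [kermx] so
    that [orth_decomp] applies. *)
Lemma perp_kernel p n (q : 'rV[R]_p -> 'rV[R]_p -> R) (st : {linear 'rV[R]_p -> 'rV[R]_n}) X :
  sym_form q -> (forall u, u != 0 -> 0 < q u u) ->
  exists2 Z, st Z = st X & forall W, st W = 0 -> q Z W = 0.
Proof.
move=> qS q0; pose A := lin1_mx st.
have AE v : v *m A = st v by rewrite mul_rV_lin1.
have [|y yP] := @orth_decomp R p p q (mulmxr (kermx A)) qS q0 _ X.
  by move=> k u v; rewrite linearP.
exists (X - y *m kermx A).
  by rewrite linearB /= -(AE (y *m _)) -mulmxA mulmx_ker mulmx0 subr0.
move=> W sW; have /sub_kermxP/submxP[w ->] : W *m A = 0 by rewrite AE.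
exact: yP.
Qed.

Lemma polarize (V : lmodType R) (b b' : V -> V -> R) : sym_form b -> sym_form b' ->
  (forall u, b u u = b' u u) -> forall u v, b u v = b' u v.
Proof.
move=> bS bS' bb u v; have := bb (u + v).
rewrite !(sformDl bS, sformDl bS', sformDr bS, sformDr bS') !bb.
rewrite (form_sym bS v u) (form_sym bS' v u) => e; lra.
Qed.

Lemma metric_form (E : normedModType R) (T : topologicalType) (A : atlas E T) W g x :
  riemannian_metric A W g -> W x -> sym_form (g x).
Proof. by move=> gR Wx; split; [exact: (metric_linear gR)|exact: (Defs.metric_sym gR)]. Qed.

Lemma tangent_of_chart_surj (E : normedModType R) (T : topologicalType) (A : atlas E T) c y w :
  compatible A c -> (cfwd c @` cdom c) y -> exists u, tangent_of_chart A c y u = w.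
Proof.
move=> cA cy; set x := cbwd c y; pose d := chart_at A x.
have [cdS dcS] := cA d (charts_chart_at A x).
have cx : cdom c x by exact: cbwd_cdom.
have dx : cdom d x by exact: cdom_chart_at.
have yE : y = cfwd c x by rewrite cbwdK.
have d1 : differentiable (lrep c d id) y.
  by apply: (smooth_on_diff cdS); apply/cfwd_image.
have d2 : differentiable (lrep d c id) (cfwd d x).
  by apply: (smooth_on_diff dcS); exists x.
have e1 : lrep d c id (cfwd d x) = y by rewrite /lrep/= cfwdK.
exists ('D_w (lrep d c id) (cfwd d x)); rewrite tangent_of_chartE// -/x -/d.
rewrite -[in LHS]e1 -derive_comp//; last by rewrite e1.
rewrite -[RHS](derive_id (cfwd d x) w); apply: near_eq_derive.
have : \forall z \near cfwd d x, (cfwd d @` (cdom d `&` cdom c)) z.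
  apply: open_nbhs_nbhs; split; last by exists x.
  by apply: cfwd_open; exact: cdom_open.
by apply: filterS => _ [z [dz cz] <-]; rewrite /lrep/= !cfwdK.
Qed.

(** Bilinearity: an error below d on each pair of frame vectors becomes at most s d on the pair (u,
    v), with s the sum of the products of their coordinates in absolute value. *)
Lemma chart_frame_limit n (gl : R -> 'rV[R]_n -> 'rV[R]_n -> R) (g : 'rV[R]_n -> 'rV[R]_n -> R)
    (T : {linear 'rV[R]_n -> 'rV[R]_n}) :
  (forall w, exists u, T u = w) -> sym_form g ->
  (forall l, 0 < l -> sym_form (gl l)) ->
  (forall j k (e : R), 0 < e -> \forall l \near (0 : R)^'+,
     `|gl l (T (delta_mx 0 j)) (T (delta_mx 0 k)) - g (T (delta_mx 0 j)) (T (delta_mx 0 k))| < e) ->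
  forall u v (e : R), 0 < e -> \forall l \near (0 : R)^'+, `|gl l u v - g u v| < e.
Proof.
move=> Ts gS glS lim u v e e0.
have [u' <-] := Ts u; have [v' <-] := Ts v.
pose s := \sum_j \sum_k `|u' 0 j| * `|v' 0 k|.
have s0 : 0 <= s by apply: sumr_ge0 => j _; apply: sumr_ge0 => k _; rewrite mulr_ge0.
pose d := e / (s + 1).
have s1 : 0 < s + 1 by rewrite ltr_wpDl.
have d0 : 0 < d by rewrite divr_gt0.
have gridE b : sym_form b -> b (T u') (T v') =
    \sum_j \sum_k u' 0 j * (v' 0 k * b (T (delta_mx 0 j)) (T (delta_mx 0 k))).
  move=> bS; rewrite {1}(row_sum_delta u') linear_sum (sform_suml bS).
  apply: eq_bigr => j _; rewrite linearZ (sformZl bS) -mulr_sumr; congr (_ * _).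
  rewrite {1}(row_sum_delta v') linear_sum (sform_sumr bS).
  by apply: eq_bigr => k _; rewrite linearZ (sformZr bS).
near=> l.
have l0 : 0 < l by near: l; exact: nbhs_right_gt.
have P : forall j k, `|gl l (T (delta_mx 0 j)) (T (delta_mx 0 k)) - g (T (delta_mx 0 j)) (T (delta_mx 0 k))| < d.
  near: l; apply: filter_forall => j; apply: filter_forall => k; exact: lim.
rewrite (gridE _ (glS l l0)) (gridE _ gS) -sumrB.
apply: le_lt_trans (ler_norm_sum _ _ _) _.
apply: (@le_lt_trans _ _ (s * d)); last first.
  by rewrite /d mulrCA gtr_pMr// ltr_pdivrMr// mul1r ltrDl.
rewrite /s mulr_suml; apply: ler_sum => j _; rewrite -sumrB.
apply: le_trans (ler_norm_sum _ _ _) _.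
rewrite mulr_suml; apply: ler_sum => k _.
by rewrite -mulrBr -mulrBr !normrM mulrA ler_wpM2l ?mulr_ge0// ltW.
Unshelve. all: by end_near. Qed.

End MoreForms.

(** * The limit metric compared with the bi-invariant metric *)

Section LimitMetric.
Context {R : realType} (m n : nat).
Context (G : topGroupType) (AG : atlas 'rV[R]_m G) (G_lie : lie_group AG).
Context (gbi : G -> 'rV[R]_m -> 'rV[R]_m -> R) (gbi_metric : riemannian_metric AG setT gbi).
Context (M : topologicalType) (AM : atlas 'rV[R]_n M).
Context (gM : M -> 'rV[R]_n -> 'rV[R]_n -> R) (gM_metric : riemannian_metric AM setT gM).
Context (a : group_action G M) (aS : smooth_action a AG AM).
Context (gl : R -> M -> 'rV[R]_n -> 'rV[R]_n -> R).
Hypothesis gl_metric : forall l : R, 0 < l -> riemannian_metric AM setT (gl l).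
Hypothesis gl_cheeger : forall l : R, 0 < l ->
  riemannian_submersion (prod_atlas AG AM) AM (fun z : G * M => a z.1 z.2)
    (scaled_prod_metric l gbi gM) (gl l).
Context (U : set M) (gt : M -> 'rV[R]_n -> 'rV[R]_n -> R) (gt_metric : riemannian_metric AM U gt).
Context (N : nat) (c : 'I_N -> chart 'rV[R]_n M) (c_atlas : finite_atlas AM U c).
Hypothesis gt_limit : forall p : nat,
  Cp_converges AM U c p (fun l => rescaled_metric a AG AM l (gl l)) gt.

Local Notation star := (star AG AM a).

(** The submersion condition at (1, z): by [dmap_act] the kernel of the differential consists of the
    pairs (Z, - star z Z), so the hypotheses of [cheeger_form] express horizontality. *)
Lemma cheeger_form_at l z : 0 < l ->
  cheeger_form (gbi 1%g) (gM z) (star z) l (gl l z).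
Proof.
move=> l0 X v X' v' hX hX'.
have hor Y w : (forall Z, l ^+ 2 * gbi 1%g Y Z = gM z w (star z Z)) ->
    horizontal (prod_atlas AG AM) AM (act a) (scaled_prod_metric l gbi gM) (1%g, z) (Y, w).
  move=> hY [Z w'] /=; rewrite (dmap_act aS) => /eqP; rewrite addr_eq0 => /eqP sZ.
  rewrite /scaled_prod_metric/= hY sZ.
  have gS : sym_form (gM z) by exact: metric_form gM_metric _.
  by rewrite (sformNr gS) addNr.
have [_ /(_ _ _ _ (hor _ _ hX) (hor _ _ hX'))] := gl_cheeger l0.
rewrite -[dmap _ _ _ _ (X, v)]/(dmap (prod_atlas AG AM) AM (act a) (1%g, z) (X, v)).
rewrite -[dmap _ _ (fun z => _) _ (X', v')]/(dmap (prod_atlas AG AM) AM (act a) (1%g, z) (X', v')).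
by rewrite !(dmap_act aS) /= gact1.
Qed.

Lemma limit_at z : U z -> forall u v (e : R), 0 < e ->
  \forall l \near (0 : R)^'+, `|rescaled_form (gl l z) (star z) l u v - gt z u v| < e.
Proof.
move=> Uz.
have [cA /(_ z Uz)[i _ ciz]] := c_atlas.
have yU : (cfwd (c i) @` (cdom (c i) `&` U)) (cfwd (c i) z) by exists z.
have yc : (cfwd (c i) @` cdom (c i)) (cfwd (c i) z) by exists z.
have gtS : sym_form (gt z) by exact: metric_form gt_metric _.
pose T : {linear _ -> _} := 'd (cfwd (chart_at AM (cbwd (c i) (cfwd (c i) z))) \o cbwd (c i)) (cfwd (c i) z).
apply: (@chart_frame_limit R n (fun l => rescaled_form (gl l z) (star z) l) (gt z) T).
- by move=> w; have [u <-] := tangent_of_chart_surj w (cA i) yc; exists u.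
- exact: gtS.
- move=> l l0; apply: rescaled_form_sym_form; first exact: metric_form (gl_metric l0) _.
    exact: (metric_gt0 (gl_metric l0)).
  exact: star_linear.
move=> j k e e0.
(* Order 0 with the empty list of derivatives is convergence of the components themselves. *)
have := @gt_limit 0%N i j k [::] isT e e0.
apply: filterS => l /(_ _ yU); rewrite /partial_derivs/= /chart_metric cfwdK//.
Qed.

Lemma limit_metric_facts z : U z ->
  [/\ forall X, gt z (star z X) (star z X) <= gbi 1%g X X,
      forall X, (forall Z, star z Z = 0 -> gbi 1%g X Z = 0) ->
        gt z (star z X) (star z X) = gbi 1%g X X &
      forall X N, (forall Y, gM z N (star z Y) = 0) -> gt z (star z X) N = 0].
Proof.
move=> Uz.
have qS : sym_form (gbi 1%g) by exact: metric_form gbi_metric _.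
have q0 : forall u, u != 0 -> 0 < gbi 1%g u u by exact: (metric_gt0 gbi_metric).
have hS : sym_form (gM z) by exact: metric_form gM_metric _.
have h0 : forall u, u != 0 -> 0 < gM z u u by exact: (metric_gt0 gM_metric).
have glS l : 0 < l -> sym_form (gl l z) by move=> l0; exact: metric_form (gl_metric l0) _.
have gl0 l : 0 < l -> forall u, u != 0 -> 0 < gl l z u u.
  by move=> l0; exact: (metric_gt0 (gl_metric l0)).
have sL := @star_linear R m n G AG M AM a z.
have glC l := @cheeger_form_at l z.
split.
- by move=> X; exact: (limit_tangent_le qS q0 hS h0 sL glS gl0 glC (limit_at Uz)).
- by move=> X; exact: (limit_tangent_eq qS q0 hS h0 sL glS gl0 glC (limit_at Uz)).
- by move=> X N'; exact: (limit_normal qS q0 hS h0 sL glS gl0 glC (limit_at Uz)).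
Qed.

End LimitMetric.

(** * The orbit as a Riemannian submanifold *)

Section Coset.
Context {R : realType} (m n k : nat).
Context (G : topGroupType) (AG : atlas 'rV[R]_m G) (G_lie : lie_group AG).
Context (M : topologicalType) (AM : atlas 'rV[R]_n M).
Context (a : group_action G M) (aS : smooth_action a AG AM).
Context (x : M) (AQ : atlas 'rV[R]_k (coset_space a x)).
Hypothesis pS : submersion AG AQ (coset_proj a x).

Local Notation pi := (coset_proj a x).
Local Notation Phi := (orbit_map a x).
Local Notation star := (star AG AM a).

Lemma coset_proj_surj q : exists g, pi g = q.
Proof. by exists (repr q); rewrite /coset_proj reprK. Qed.

Lemma coset_proj_eq g h : a g x = a h x -> pi g = pi h.
Proof.
move=> e; rewrite /coset_proj; apply/(@eqmodP _ (coset_equiv a x)).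
exact/coset_relP.
Qed.

Lemma orbit_map_comp_proj : Phi \o pi = orb a x.
Proof. by apply/funext => g; rewrite /= orbit_map_proj. Qed.

Lemma orbit_map_smooth : smooth_map AQ AM Phi.
Proof.
apply: (smooth_map_descend coset_proj_surj pS).
by rewrite orbit_map_comp_proj; exact: orb_smooth.
Qed.

Lemma orbit_map_inj : injective Phi.
Proof.
move=> q q'; have [g <-] := coset_proj_surj q; have [g' <-] := coset_proj_surj q'.
by rewrite !orbit_map_proj; exact: coset_proj_eq.
Qed.

Lemma dorbit_map_proj g X :
  dmap AQ AM Phi (pi g) (dmap AG AQ pi g X) = dmap AG AM (orb a x) g X.
Proof.
by rewrite -orbit_map_comp_proj (dmap_comp _ _ (framed_rV k) pS.1 orbit_map_smooth).
Qed.

(** Left translation moves the vector to 1, where [isotropy_tangent] applies to the projection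
    preceded by left translation by g, a map constant on G_x. *)
Lemma ker_dorb g X : dmap AG AM (orb a x) g X = 0 -> dmap AG AQ pi g X = 0.
Proof.
have [Z <-] := dlmulK G_lie g X.
rewrite (dorb_left G_lie aS) => /(dtr_inj aS) sZ.
have fS := smooth_map_comp (framed_rV m) (lmul_smooth G_lie g) pS.1.
have := isotropy_tangent G_lie aS fS _ sZ.
rewrite (dmap_comp _ _ (framed_rV m) (lmul_smooth G_lie g) pS.1) /lmul mulg1.
apply=> h hx /=; apply: coset_proj_eq.
by rewrite !gactM hx gact1.
Qed.

Lemma dorbit_map_inj q : injective (dmap AQ AM Phi q).
Proof.
move=> u v uv; apply/eqP; rewrite -subr_eq0; apply/eqP.
have {uv} : dmap AQ AM Phi q (u - v) = 0 by rewrite dmapB uv subrr.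
have [g <-] := coset_proj_surj q; have [X <-] := pS.2 g (u - v).
by rewrite dorbit_map_proj; exact: ker_dorb.
Qed.

(** G / G_x is compact and M is Hausdorff, so closed sets have closed images; O is cut out by the
    complement of the image of its complement. *)
Lemma orbit_map_embedding : compact [set: G] -> hausdorff_space M ->
  embedding AQ AM Phi.
Proof.
move=> Gc Mh; split.
- exact: orbit_map_smooth.
- exact: dorbit_map_inj.
- exact: orbit_map_inj.
move=> O oO; have Pc := orbit_map_smooth.1.
have Qc : compact [set: coset_space a x].
  have -> : [set: coset_space a x] = pi @` [set: G].
    by apply/seteqP; split => // q _; have [g <-] := coset_proj_surj q; exists g.
  by apply: continuous_compact => //; apply: continuous_subspaceT; exact: pS.1.1.
have Cc : compact (Phi @` (~` O)).
  apply: continuous_compact; first by apply: continuous_subspaceT; exact: Pc.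
  by apply: (subclosed_compact _ Qc) => //; exact: open_closedC.
exists (~` (Phi @` (~` O))); first by apply: closed_openC; exact: compact_closed.
apply/seteqP; split => [_ [q Oq <-]|_ [[q _ <-] nq]].
  by split; [exists q|move=> [q' nO /orbit_map_inj e]; apply: nO; rewrite e].
by apply: contrapT => nO; apply: nq; exists q => // Oq; apply: nO; exists q.
Qed.

Context (gbi : G -> 'rV[R]_m -> 'rV[R]_m -> R) (gbi_metric : riemannian_metric AG setT gbi).
Hypothesis gbi_inv : bi_invariant AG gbi.
Context (gnh : coset_space a x -> 'rV[R]_k -> 'rV[R]_k -> R)
  (gnh_metric : riemannian_metric AQ setT gnh)
  (gnh_submersion : riemannian_submersion AG AQ pi gbi gnh).
Context (U : set M) (gt : M -> 'rV[R]_n -> 'rV[R]_n -> R) (gt_metric : riemannian_metric AM U gt).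
Hypothesis orbU : forall g, U (a g x).
Hypothesis gt_eq : forall z X, U z -> (forall Z, star z Z = 0 -> gbi 1%g X Z = 0) ->
        gt z (star z X) (star z X) = gbi 1%g X X.

(** By polarization only norms matter. A tangent vector is lifted to a horizontal X at g, written as
    the right translate of some Z at 1. Right invariance gives |X| = |Z| and makes Z orthogonal to
    the isotropy algebra of g x, so [gt_eq] applies at g x. *)
Lemma orbit_map_isometric : isometric AQ AM Phi gnh gt.
Proof.
move=> q; have [g <-] := coset_proj_surj q.
have zU := orbU g; have gtS : sym_form (gt (a g x)) by exact: metric_form gt_metric _.
have nhS : sym_form (gnh (pi g)) by exact: metric_form gnh_metric _.
have pbS : sym_form (pullback_metric AQ AM Phi gt (pi g)).
  rewrite /pullback_metric orbit_map_proj.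
  by split=> [l u v w|u v]; rewrite ?dmap_linear ?(form_linear gtS)// (form_sym gtS).
apply: (polarize pbS nhS) => u.
have [X0 <-] := pS.2 g u.
have gS : sym_form (gbi g) by exact: metric_form gbi_metric _.
pose T : {linear _ -> _} := 'd (cfwd (chart_at AQ (pi g)) \o pi \o cbwd (chart_at AG g)) (cfwd (chart_at AG g) g).
have [X TX Xh] := @perp_kernel R m k (gbi g) T X0 gS (metric_gt0 gbi_metric I).
have -> : dmap AG AQ pi g X0 = dmap AG AQ pi g X by rewrite /dmap -TX.
have hX : horizontal AG AQ pi gbi g X by move=> W; exact: Xh.
rewrite (gnh_submersion.2 g X X hX hX) /pullback_metric orbit_map_proj dorbit_map_proj.
have [Z ZX] := drmulK G_lie g X.
have bi W : gbi g X (dmap AG AG (rmul g) 1%g W) = gbi 1%g Z W.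
  have [_ /(_ 1%g Z W)] := gbi_inv g; rewrite /pullback_metric.
  by rewrite -/(rmul g) ZX {1}mul1g.
have -> : gbi g X X = gbi 1%g Z Z by rewrite -bi ZX.
rewrite -ZX (dorb_right G_lie aS); apply: gt_eq => // W sW.
rewrite -bi; apply: Xh; rewrite -[T _]/(dmap AG AQ pi g _); apply: ker_dorb.
by rewrite (dorb_right G_lie aS).
Qed.

End Coset.

(** * The geodesic equation *)

Section MetricField.
Context {R : realType}.
Implicit Types E F H : normedModType R.

Lemma derive_sum_fun E F (I : finType) (f : I -> E -> F) x :
  (forall i, differentiable (f i) x) ->
  differentiable (fun y => \sum_i f i y) x /\
  forall v, 'D_v (fun y => \sum_i f i y) x = \sum_i 'D_v (f i) x.
Proof.
move=> fd; elim: (index_enum I) => [|i s [d1 e1]].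
  under eq_fun do rewrite big_nil.
  split; first exact: differentiable_cst.
  by move=> v; rewrite derive_cst big_nil.
have -> : (fun y => \sum_(j <- i :: s) f j y) = f i + (fun y => \sum_(j <- s) f j y).
  by apply/funext => y; rewrite big_cons.
split; first exact: differentiableD.
by move=> v; rewrite deriveD; [|exact: diff_derivable..]; rewrite e1 big_cons.
Qed.

(** The direction in D_(c') F moves, so it is expanded in the standard basis and the product rule is
    applied. E is general because c is a curve in one use and a map from a chart of G in the
    other. *)
Lemma derive2_comp E k n (D : set 'rV[R]_k) (F : 'rV[R]_k -> 'rV[R]_n)
    (c : E -> 'rV[R]_k) e0 v :
  open D -> D (c e0) -> Ck_on 2 D F ->
  (\forall e \near e0, D (c e) /\ differentiable c e) -> differentiable ('D_v c) e0 ->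
  let V := 'D_v c e0 in
  'D_v ('D_v (F \o c)) e0 =
    'D_('D_v ('D_v c) e0) F (c e0) + 'D_V ('D_V F) (c e0).
Proof.
move=> oD Dc [Fd FD] nc dc2 V.
have dc : differentiable c e0 by have [] := nbhs_singleton nc.
pose Fi i := 'D_(delta_mx 0 i) F.
have dFi i y : D y -> differentiable (Fi i) y by have [+ _] := FD (delta_mx 0 i); exact.
have DF y u : D y -> 'D_u F y = \sum_i u 0 i *: Fi i y.
  by move=> Dy; rewrite [in LHS](row_sum_delta u) derive_sum_dir//; exact: Fd.
rewrite (@near_eq_derive _ _ _ _ (fun e => \sum_i ('D_v c e) 0 i *: (Fi i \o c) e)); last first.
  apply: filterS nc => e [Dce dce]; rewrite derive_comp//; last exact: Fd.
  exact: DF.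
have dV i : differentiable (fun e => ('D_v c e) 0 i : R) e0 /\
    'D_v (fun e => ('D_v c e) 0 i : R) e0 = ('D_v ('D_v c) e0) 0 i.
  have [d1 e1] := @derive_lin_comp R _ _ R^o ('D_v c) (row_coord i) e0 (@row_coord_continuous R k i) dc2.
  by split; [exact: d1|exact: e1].
have dFc i : differentiable (Fi i \o c) e0 by apply: differentiable_comp => //; exact: dFi.
have dsum i := derive_scalar_mul (dV i).1 (dFc i).
have [_ ->] := derive_sum_fun (fun i => (dsum i).1).
have -> : 'D_V ('D_V F) (c e0) = \sum_i V 0 i *: 'D_V (Fi i) (c e0).
  rewrite (@near_eq_derive _ _ _ _ (fun y => \sum_i V 0 i *: Fi i y)); last first.
    by apply: filterS (open_nbhs_nbhs (conj oD Dc)) => y Dy; exact: DF.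
  have dZ i : differentiable (V 0 i \*: Fi i) (c e0) by apply: differentiableZ; exact: dFi.
  have [_ ->] := derive_sum_fun dZ.
  by apply: eq_bigr => i _; rewrite deriveZ//; exact/diff_derivable/dFi.
rewrite (DF _ _ Dc) -big_split/=; apply: eq_bigr => i _.
have e := @derive_comp R _ _ _ c (Fi i) e0 v dc (dFi i _ Dc).
apply: (etrans ((dsum i).2 v)).
exact: (congr2 (fun s t => s *: Fi i (c e0) + V 0 i *: t) (dV i).2 e).
Qed.

(* For the metric g in a chart and a curve at z with velocity vel and second
   derivative acc, this is g(nabla_vel vel, w). *)
Definition euler_lagrange n (g : 'rV[R]_n -> 'rV[R]_n -> 'rV[R]_n -> R) (z acc vel w : 'rV[R]_n) : R :=
  g z acc w + 'D_vel (fun y => g y vel w) z - 2^-1 * 'D_w (fun y => g y vel vel) z.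

Section Field.
Variables (n : nat) (g : 'rV[R]_n -> 'rV[R]_n -> 'rV[R]_n -> R) (DU : set 'rV[R]_n).
Hypotheses (oDU : open DU) (gS : forall y, DU y -> sym_form (g y)).
Hypothesis gd : forall u v y, DU y -> differentiable (fun y => g y u v) y.

Let gE y u v : DU y ->
  g y u v = \sum_(ij : 'I_n * 'I_n) u 0 ij.1 * (v 0 ij.2 * g y (delta_mx 0 ij.1) (delta_mx 0 ij.2)).
Proof.
move=> /gS bS; rewrite -(pair_bigA _ (fun i j => u 0 i * (v 0 j * g y (delta_mx 0 i) (delta_mx 0 j))))/=.
rewrite {1}(row_sum_delta u) (sform_suml bS).
apply: eq_bigr => j _; rewrite (sformZl bS) -mulr_sumr; congr (_ * _).
rewrite {1}(row_sum_delta v) (sform_sumr bS).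
by apply: eq_bigr => k _; rewrite (sformZr bS).
Qed.

(** Differentiability is only given for the components of g with fixed vectors, so the form is
    expanded in coordinates before the product rule. *)
Lemma derive_metric E (b p r : E -> 'rV[R]_n) e0 v :
  DU (b e0) -> differentiable b e0 -> differentiable p e0 -> differentiable r e0 ->
  differentiable (fun e => g (b e) (p e) (r e)) e0 /\
  'D_v (fun e => g (b e) (p e) (r e)) e0 =
    'D_('D_v b e0) (fun y => g y (p e0) (r e0)) (b e0) +
    g (b e0) ('D_v p e0) (r e0) + g (b e0) (p e0) ('D_v r e0).
Proof.
move=> Db db dp dr.
pose gij (ij : 'I_n * 'I_n) y : R := g y (delta_mx 0 ij.1) (delta_mx 0 ij.2).
have dg ij : differentiable (gij ij \o b) e0.
  by apply: differentiable_comp => //; exact: gd.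
have dcoord (f : E -> 'rV[R]_n) i : differentiable f e0 ->
   differentiable (fun e => f e 0 i : R) e0 /\ 'D_v (fun e => f e 0 i : R) e0 = ('D_v f e0) 0 i.
  move=> df.
  have [d1 e1] := @derive_lin_comp R _ _ R^o f (row_coord i) e0 (@row_coord_continuous R n i) df.
  by split; [exact: d1|exact: e1].
have d1 ij := derive_scalar_mul (dcoord r ij.2 dr).1 (dg ij : differentiable (gij ij \o b : E -> R^o) e0).
have d2 ij := derive_scalar_mul (dcoord p ij.1 dp).1 (d1 ij).1.
have [d3 e3] := derive_sum_fun (fun ij => (d2 ij).1).
have nE : \forall e \near e0, \sum_ij p e 0 ij.1 *: (r e 0 ij.2 *: ((gij ij \o b) e : R^o)) =
    g (b e) (p e) (r e).
  have nD : \forall e \near e0, DU (b e).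
    by apply: (differentiable_continuous db); exact: open_nbhs_nbhs.
  by apply: filterS nD => e De; rewrite [RHS]gE.
split; first exact: near_eq_differentiable nE d3.
rewrite -(near_eq_derive v nE) e3.
have -> : 'D_('D_v b e0) (fun y => g y (p e0) (r e0)) (b e0) =
    \sum_ij p e0 0 ij.1 * (r e0 0 ij.2 * 'D_('D_v b e0) (gij ij) (b e0)).
  have dgij ij : differentiable (fun y => p e0 0 ij.1 *: (r e0 0 ij.2 *: (gij ij y : R^o))) (b e0).
    have dgy : differentiable (gij ij : _ -> R^o) (b e0) by exact: gd.
    exact: differentiableZ (differentiableZ (r e0 0 ij.2) dgy).
  have [_ e4] := derive_sum_fun dgij.
  rewrite (@near_eq_derive _ _ _ _ (fun y => \sum_ij p e0 0 ij.1 *: (r e0 0 ij.2 *: (gij ij y : R^o)))); last first.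
    by apply: filterS (open_nbhs_nbhs (conj oDU Db)) => y Dy; rewrite [LHS]gE.
  rewrite e4; apply: eq_bigr => ij _.
  have dgy : differentiable (gij ij : _ -> R^o) (b e0) by exact: gd.
  rewrite (deriveZ (f := fun y => r e0 0 ij.2 *: (gij ij y : R^o))); last first.
    exact/diff_derivable/differentiableZ.
  by rewrite deriveZ//; exact: diff_derivable.
rewrite (gE ('D_v p e0) _ Db) (gE _ ('D_v r e0) Db) -!big_split/=.
apply: eq_bigr => ij _.
rewrite (d2 ij).2 (d1 ij).2 (dcoord r ij.2 dr).2 (dcoord p ij.1 dp).2.
have dgy : differentiable (gij ij : _ -> R^o) (b e0) by exact: gd.
rewrite (@derive_comp R _ _ _ b (gij ij) e0 v db dgy).
have alg (x1 x2 x3 x4 gg d : R) :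
    x1 * (x2 * gg) + x3 * (x4 * gg + x2 * d) = x3 * (x2 * d) + x1 * (x2 * gg) + x3 * (x4 * gg).
  by ring.
exact: alg.
Qed.

Lemma el_linear z acc vel k w w' : DU z ->
  euler_lagrange g z acc vel (k *: w + w') = k * euler_lagrange g z acc vel w + euler_lagrange g z acc vel w'.
Proof.
move=> Dz; have bS := gS Dz; rewrite /euler_lagrange (sformDr bS) (sformZr bS).
have -> : 'D_vel (fun y => g y vel (k *: w + w')) z =
    k * 'D_vel (fun y => g y vel w) z + 'D_vel (fun y => g y vel w') z.
  have dw u : differentiable (fun y => g y vel u : R^o) z by exact: gd.
  rewrite (@near_eq_derive _ _ _ _ ((k \*: (fun y => g y vel w : R^o)) + (fun y => g y vel w' : R^o))); last first.
    apply: filterS (open_nbhs_nbhs (conj oDU Dz)) => y /gS yS.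
    by rewrite (sformDr yS) (sformZr yS).
  rewrite deriveD; [|apply: diff_derivable; exact: differentiableZ|exact: diff_derivable].
  by rewrite deriveZ//; exact: diff_derivable.
have -> : 'D_(k *: w + w') (fun y => g y vel vel) z =
    k * 'D_w (fun y => g y vel vel) z + 'D_w' (fun y => g y vel vel) z.
  by rewrite !deriveE ?linearP//; exact: gd.
by ring.
Qed.

(** By [derive2_comp], D_A F + D_V D_V F is the acceleration of the image curve. In the pulled back
    expression the terms with D_V D_w F and D_w D_V F cancel by Schwarz's theorem. *)
Lemma el_pullback k (D : set 'rV[R]_k) (F : 'rV[R]_k -> 'rV[R]_n) z A V w :
  open D -> D z -> Ck_on 2 D F -> DU (F z) ->
  euler_lagrange g (F z) ('D_A F z + 'D_V ('D_V F) z) ('D_V F z) ('D_w F z) =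
  euler_lagrange (fun y u v => g (F y) ('D_u F y) ('D_v F y)) z A V w.
Proof.
move=> oD Dz FC Dg; have [Fd FD] := FC.
have dF : differentiable F z by exact: Fd.
have dD u : differentiable ('D_u F) z by have [+ _] := FD u; exact.
have bS := gS Dg.
have m1 := (derive_metric V Dg dF (dD V) (dD w)).2.
have m2 := (derive_metric w Dg dF (dD V) (dD V)).2.
have e := schwarz w V oD Dz FC.
rewrite /euler_lagrange m1 m2 e; clear m1 m2 e.
move: ('D_V ('D_V F) z) ('D_V ('D_w F) z) ('D_A F z) ('D_V F z) ('D_w F z) => a1 a2 a3 a4 a5.
move: ('D_a4 _ (F z)) ('D_a5 _ (F z)) => d1 d2.
rewrite (sformDl bS) (form_sym bS a2 a4).
by field.
Qed.

End Field.
End MetricField.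

(** * The normal part of the geodesic equation *)

Section TotallyGeodesic.
Context {R : realType}.

Lemma el_near n (g g' : 'rV[R]_n -> 'rV[R]_n -> 'rV[R]_n -> R) z acc vel w :
  (\forall y \near z, forall u v, g y u v = g' y u v) ->
  euler_lagrange g z acc vel w = euler_lagrange g' z acc vel w.
Proof.
move=> gg'; rewrite /euler_lagrange (nbhs_singleton gg').
rewrite (@near_eq_derive _ _ _ (fun y => g y vel w) (fun y => g' y vel w)); last first.
  by apply: filterS gg' => y.
rewrite (@near_eq_derive _ _ _ (fun y => g y vel vel) (fun y => g' y vel vel))//.
by apply: filterS gg' => y.
Qed.

(** With both velocity arguments equal, the first two terms of [christoffel] coincide. *)
Lemma el_christoffel n (T : topologicalType) (A : atlas 'rV[R]_n T) g x acc vel w :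
  g x acc w + christoffel A g x vel vel w =
  euler_lagrange (chart_metric A (chart_at A x) g) (cfwd (chart_at A x) x) acc vel w.
Proof.
rewrite /euler_lagrange chart_metric_at /christoffel; move: ('D_vel _ _) ('D_w _ _) (g x acc w) => d1 d2 e.
by field.
Qed.

(** b2 and b2' are the mixed second derivatives in either order. The first equation differentiates
    g(V, N) = 0 along V, the second |V|^2 along N at its maximum; subtracting half of the second
    eliminates g V b2. *)
Lemma el_eq0 n (g : 'rV[R]_n -> 'rV[R]_n -> 'rV[R]_n -> R) z b1 b2 b2' V N :
  sym_form (g z) -> b2' = b2 ->
  0 = 'D_V (fun y => g y V N) z + g z b1 N + g z V b2' ->
  0 = 'D_N (fun y => g y V V) z + g z b2 V + g z V b2 ->
  euler_lagrange g z b1 V N = 0.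
Proof.
move=> zS ->; rewrite (form_sym zS b2 V) /euler_lagrange.
move: ('D_V _ z) ('D_N _ z) (g z b1 N) (g z V b2) => x1 x2 x3 x4 h1 h2; lra.
Qed.

Context (m n : nat).
Context (G : topGroupType) (AG : atlas 'rV[R]_m G) (G_lie : lie_group AG).
Context (gbi : G -> 'rV[R]_m -> 'rV[R]_m -> R).
Context (M : topologicalType) (AM : atlas 'rV[R]_n M).
Context (gM : M -> 'rV[R]_n -> 'rV[R]_n -> R).
Context (a : group_action G M) (aS : smooth_action a AG AM).
Hypothesis a_isometric : acts_by_isometries a AM gM.
Context (U : set M) (U_open : open U) (U_inv : invariant_set a U).
Context (gt : M -> 'rV[R]_n -> 'rV[R]_n -> R) (gt_metric : riemannian_metric AM U gt).

Local Notation star := (star AG AM a).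

Hypothesis gt_le : forall z X, U z -> gt z (star z X) (star z X) <= gbi 1%g X X.
Hypothesis gt_eq : forall z X, U z -> (forall Z, star z Z = 0 -> gbi 1%g X Z = 0) ->
  gt z (star z X) (star z X) = gbi 1%g X X.
Hypothesis gt_normal : forall z X N, U z -> (forall Y, gM z N (star z Y) = 0) ->
  gt z (star z X) N = 0.

Section AtPoint.
Variables (y : M) (Uy : U y).
Let kap := chart_at AM y.
Let z1 := cfwd kap y.
Let g := chart_metric AM kap gt.
Let DU := cfwd kap @` (cdom kap `&` U).

Lemma chart_dom_open : open DU. Proof. exact: cfwd_open. Qed.

Lemma chart_metric_form z : DU z -> sym_form (g z).
Proof.
move=> /cfwd_image[_ Uz]; have zS : sym_form (gt (cbwd kap z)) by exact: metric_form gt_metric _.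
split=> [l u v w|u v]; rewrite /g /chart_metric; last by rewrite (form_sym zS).
by rewrite /tangent_of_chart linearP (form_linear zS).
Qed.

Lemma chart_metric_diff u v z : DU z -> differentiable (fun z => g z u v) z.
Proof.
move=> Dz; apply: smooth_on_diff Dz.
exact: (metric_smooth gt_metric (charts_chart_at AM y)).
Qed.

Lemma chart_dom_at : DU z1.
Proof. by exists y => //; split => //; exact: cdom_chart_at. Qed.

Let ks : cdom kap y := cdom_chart_at AM y.
Let Ak : charts AM kap := charts_chart_at AM y.
Let eta := chart_at AG 1%g.
Let e1 : cdom eta 1%g := cdom_chart_at AG 1%g.
Let Ae : charts AG eta := charts_chart_at AG 1%g.
Let u0 := cfwd eta 1%g.

(** The isometry [a h] preserves orbits, so it sends gM-normal vectors at y to gM-normal vectors at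
    h y, where [gt_normal] applies. *)
Lemma normal_translate h X' N : (forall Y, gM y N (star y Y) = 0) ->
  gt (a h y) (dmap AG AM (orb a y) h X') (dmap AM AM (a h) y N) = 0.
Proof.
move=> hN; have [Z <-] := drmulK G_lie h X'; rewrite (dorb_right G_lie aS).
apply: gt_normal; first exact: U_inv.
move=> Y; rewrite -(dorb_right G_lie aS).
have [Y' <-] := dlmulK G_lie h (dmap AG AG (rmul h) 1%g Y).
by rewrite (dorb_left G_lie aS); have := a_isometric h y N (star y Y'); rewrite hN.
Qed.

(* The curve with velocity X^* swept by a chart line of G has no
   acceleration normal to the orbit: |X^*|^2 <= |X|^2 with equality at y makes
   the derivative of |X^*|^2 vanish at y. *)
Lemma normal_el X N :
  (forall Z, star y Z = 0 -> gbi 1%g X Z = 0) ->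
  (forall Y, gM y N (star y Y) = 0) ->
  euler_lagrange g z1 ('D_X ('D_X (lrep eta kap (orb a y))) u0) (star y X) N = 0.
Proof.
move=> hX hN.
pose B := lrep (prod_chart eta kap) kap (act a).
pose DB := lrep_dom (prod_chart eta kap) kap (act a).
have BS : smooth_on DB B.
  by apply: (smooth_map_lrep (act_smooth aS)) => //; exists eta, kap.
have oDB : open DB by apply: lrep_dom_open; exact: (act_smooth aS).1.
have z1K : cbwd kap z1 = y by exact: cfwdK ks.
have uE : cbwd eta u0 = 1%g by exact: cfwdK e1.
have tN : tangent_of_chart AM kap z1 N = N by exact: tangent_of_chart_at.
have tX : tangent_of_chart AG eta u0 X = X by exact: tangent_of_chart_at.
pose p0 : 'rV[R]_m * 'rV[R]_n := (u0, z1).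
have DBp0 : DB p0 by exists (1%g, y) => //; split => //=; rewrite /act/= gact1.
have BE u : B (u, z1) = lrep eta kap (orb a y) u by rewrite /B /lrep/= cfwdK.
(* W moves the group element and V' the base point: at p0 the action map B has derivatives
   [star y X] along W and N along V'. *)
pose W : 'rV[R]_m * 'rV[R]_n := (X, 0); pose V' : 'rV[R]_m * 'rV[R]_n := (0, N).
have Bd p : DB p -> differentiable B p by exact: smooth_on_diff.
have BDd w p : DB p -> differentiable ('D_w B) p.
  by apply: smooth_on_diff; exact: smooth_on_derive.
have pW (t : R) : p0 + t *: W = (u0 + t *: X, z1).
  by rewrite /p0 /W; congr pair; rewrite /= scaler0 addr0.
have pV (t : R) : p0 + t *: V' = (u0, z1 + t *: N).
  by rewrite /p0 /V'; congr pair; rewrite /= scaler0 addr0.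
have nearline (w : 'rV[R]_m * 'rV[R]_n) : \forall t \near (0 : R), DB (p0 + t *: w).
  have cw : {for 0, continuous (fun t : R => p0 + t *: w)}.
    apply: differentiable_continuous.
    have dl : is_diff (0 : R) (fun s : R => p0 + s *: w) (0 + *:%R^~ w) by exact: is_diffD.
    exact: ex_diff.
  by apply: cw; rewrite scale0r addr0; exact: open_nbhs_nbhs.
have Bp0 : B p0 = z1 by rewrite BE lrep_cfwd// /orb gact1.
have BN : 'D_V' B p0 = N.
  rewrite -(@derive_partial2 R _ _ _ B u0 z1 N (Bd _ DBp0)).
  rewrite -[RHS](derive_id z1 N); apply: near_eq_derive.
  apply: filterS (near_chart_cod AM y) => z zc.
  by rewrite /B /lrep/= /act/= cfwdK// gact1 cbwdK.
have BX : 'D_W B p0 = star y X.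
  rewrite -(@derive_partial1 R _ _ _ B u0 z1 X (Bd _ DBp0)).
  rewrite /star dmapE; last exact: orb_smooth.
  rewrite {1}/orb gact1; apply: near_eq_derive; near=> u; exact: BE.
have BXX : 'D_X ('D_X (lrep eta kap (orb a y))) u0 = 'D_W ('D_W B) p0.
  rewrite -(@derive_partial1 R _ _ _ ('D_W B) u0 z1 X (BDd W _ DBp0)).
  apply: near_eq_derive.
  have cp : {for u0, continuous (fun u : 'rV[R]_m => (u, z1))}.
    apply: (@differentiable_continuous _ _ _ u0 (fun u : 'rV[R]_m => (u, z1))).
    by apply: differentiable_pair; [exact: ex_diff|exact: differentiable_cst].
  have : \forall u \near u0, DB (u, z1) by apply: cp; exact: open_nbhs_nbhs.
  apply: filterS => u Du.
  rewrite -(@derive_partial1 R _ _ _ B u z1 X (Bd _ Du)).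
  by congr ('D_X _ u); apply/funext => v; rewrite BE.
have Dz1 := chart_dom_at.
have linedB (w : 'rV[R]_m * 'rV[R]_n) : differentiable (fun t : R => B (p0 + t *: w)) 0 /\
    'D_1 (fun t : R => B (p0 + t *: w)) 0 = 'D_w B p0.
  exact/derive_line0/Bd.
have p00 (w : 'rV[R]_m * 'rV[R]_n) : p0 + 0 *: w = p0 by rewrite scale0r addr0.
(* Along W the point runs in the orbit of y: D_W B stays tangent to it and D_V' B is the translate
   of N. *)
have perp : \forall t \near (0 : R),
    g (B (p0 + t *: W)) ('D_W B (p0 + t *: W)) ('D_V' B (p0 + t *: W)) = 0.
  apply: filterS (nearline W) => t; rewrite pW; move: (u0 + t *: X) => u Du.
  have /lrep_domP[[[h y'] [/= he ky'] [hu y'1]] /= hk] := Du.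
  have {}uE : cbwd eta u = h by rewrite -hu; exact: cfwdK.
  have {}hk : cdom kap (a h y) by move: hk; rewrite /act/= uE z1K.
  have ud : lrep_dom eta kap (orb a y) u by exact: (ex_intro2 _ _ h (conj he hk) hu).
  have zd : lrep_dom kap kap (a h) z1 by exact: (lrep_dom_cfwd ks hk).
  have E1 := tangent_lrep X (framed_rV m) (framed_rV n) (orb_smooth aS y) Ae Ak ud.
  have E2 := tangent_lrep N (framed_rV n) (framed_rV n) (tr_smooth aS h) Ak Ak zd.
  have lz : lrep kap kap (a h) z1 = cfwd kap (a h y) := lrep_cfwd _ _ ks.
  rewrite z1K tN lz in E2.
  have lu : lrep eta kap (orb a y) u = cfwd kap (a h y) by rewrite -hu; exact: lrep_cfwd.
  rewrite uE lu in E1.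
  have BuE : B (u, z1) = cfwd kap (a h y) by rewrite BE.
  rewrite BuE -(@derive_partial1 R _ _ _ B u z1 X (Bd _ Du)) -(@derive_partial2 R _ _ _ B u z1 N (Bd _ Du)).
  have hK : cbwd kap (cfwd kap (a h y)) = a h y by exact: cfwdK.
  rewrite /g /chart_metric hK.
  have -> : (fun u => B (u, z1)) = lrep eta kap (orb a y) by apply/funext => v; rewrite BE.
  have -> : (fun z => B (u, z)) = lrep kap kap (a h) by apply/funext => z; rewrite /B /lrep/= /act/= uE.
  rewrite -E1 -E2; exact: normal_translate.
(* Along V' the group element stays 1, so B (u0, z) = z and D_W B is the field [star] of the fixed X
   at the moving point, to which [gt_le] applies. *)
have le_max : \forall s \near (0 : R),
    g (B (p0 + s *: V')) ('D_W B (p0 + s *: V')) ('D_W B (p0 + s *: V')) <= gbi 1%g X X.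
  have nU : \forall s \near (0 : R), DU (B (p0 + s *: V')).
    have cB : {for 0, continuous (fun s : R => B (p0 + s *: V'))}.
      exact: (differentiable_continuous (linedB V').1).
    have nDU : nbhs (B (p0 + 0 *: V')) DU.
      by rewrite p00 Bp0; exact: (open_nbhs_nbhs (conj chart_dom_open Dz1)).
    exact: (cB DU nDU).
  apply: filterS2 (nearline V') nU => s; rewrite pV; move: (z1 + s *: N) => z Dz.
  have /lrep_domP[[[h y'] [/= he ky'] [hu y'z]] /= hk] := Dz.
  have zE : cbwd kap z = y' by rewrite -y'z cfwdK.
  have BzE : B (u0, z) = z by rewrite /B /lrep/= /act/= uE gact1 zE y'z.
  rewrite BzE => /cfwd_image[_]; rewrite zE => Uy'.
  have ud : lrep_dom eta kap (orb a y') u0 by apply: lrep_dom_cfwd; rewrite /orb ?gact1.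
  have E1 := tangent_lrep X (framed_rV m) (framed_rV n) (orb_smooth aS y') Ae Ak ud.
  have lu : lrep eta kap (orb a y') u0 = z.
    by apply: (etrans (lrep_cfwd _ _ e1)); rewrite /orb gact1.
  rewrite uE tX lu in E1.
  rewrite -(@derive_partial1 R _ _ _ B u0 z X (Bd _ Dz)) /g /chart_metric zE.
  have -> : (fun u => B (u, z)) = lrep eta kap (orb a y') by apply/funext => v; rewrite /B /lrep/= /act/= zE.
  rewrite -E1; exact: gt_le.
have eq_max : g (B (p0 + 0 *: V')) ('D_W B (p0 + 0 *: V')) ('D_W B (p0 + 0 *: V')) = gbi 1%g X X.
  by rewrite p00 Bp0 BX /g chart_metric_at gt_eq.
pose f1 p := g (B p) ('D_W B p) ('D_V' B p).
pose f2 p := g (B p) ('D_W B p) ('D_W B p).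
have DBp : DU (B p0) by rewrite Bp0.
have [d1 m1] : differentiable f1 p0 /\ _ := derive_metric chart_dom_open chart_metric_form chart_metric_diff
  W DBp (Bd _ DBp0) (BDd W _ DBp0) (BDd V' _ DBp0).
have [d2 m2] : differentiable f2 p0 /\ _ := derive_metric chart_dom_open chart_metric_form chart_metric_diff
  V' DBp (Bd _ DBp0) (BDd W _ DBp0) (BDd W _ DBp0).
have z1E : 'D_W f1 p0 = 0.
  by have [_ <-] := derive_line0 W d1; rewrite (near_eq_derive _ perp) derive_cst.
have z2E : 'D_V' f2 p0 = 0.
  have [d3 <-] := derive_line0 V' d2.
  have le2 : \forall s \near (0 : R), f2 (p0 + s *: V') <= f2 (p0 + 0 *: V').
    by apply: filterS le_max => s; rewrite -eq_max.
  exact: (derive0_at_max d3 le2).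
have K := schwarz W V' oDB DBp0 (BS 2%N).
have {}m1 := etrans (esym z1E) m1; have {}m2 := etrans (esym z2E) m2.
apply: etrans (el_eq0 (chart_metric_form DBp) K m1 m2).
exact: (f_equal4 (euler_lagrange g) (esym Bp0) BXX (esym BX) (esym BN)).
Unshelve. all: by end_near. Qed.

End AtPoint.
End TotallyGeodesic.

(** * Geodesics of an orbit *)

Section Final.
Context {R : realType}.

Lemma open_curve_preimage (T : topologicalType) (I : set R) (gam : R -> T) (D : set T) :
  open I -> (forall t, I t -> {for t, continuous gam}) -> open D ->
  open (I `&` gam @^-1` D : set R^o).
Proof.
move=> oI gc oD; rewrite openE => t [It Dt]; apply: filterI.
  by apply: open_nbhs_nbhs.
by apply: (gc t It); exact: open_nbhs_nbhs.
Qed.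

Lemma smooth_curve_comp k n (S T : topologicalType) (A : atlas 'rV[R]_k S)
    (B : atlas 'rV[R]_n T) (f : S -> T) (I : set R) (gam : R -> S) :
  open I -> smooth_map A B f -> smooth_curve A I gam -> smooth_curve B I (f \o gam).
Proof.
move=> oI fS [gc gS]; split=> [t It|c Bc l].
  by apply: continuous_comp; [exact: gc|exact: fS.1].
apply: Ck_on_local => t [It ct]; pose d := chart_at A (gam t).
have Ad : charts A d by exact: charts_chart_at.
have dt : cdom d (gam t) by exact: cdom_chart_at.
pose D' := I `&` gam @^-1` (cdom d `&` f @^-1` cdom c).
have oD' : open (D' : set R^o).
  apply: open_curve_preimage => //; apply: openI; first exact: cdom_open.
  by apply: open_comp; [move=> x _; exact: fS.1|exact: cdom_open].
exists D'; first by [].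
apply: (@Ck_on_eq _ R^o _ l D' (lrep d c f \o (cfwd d \o gam))) => //.
  by move=> s [Is [ds cs]]; rewrite /lrep/= cfwdK.
apply: (@Ck_on_comp _ R^o _ _ l D' (lrep_dom d c f)) => //.
- exact: framed_rV.
- by move=> s [Is [ds cs]]; exact: lrep_dom_cfwd.
- by apply: Ck_on_sub (gS d Ad l) => s [Is [ds cs]].
- exact: (smooth_map_lrep fS Ad Bc l).
Qed.

Lemma el_acc_eq n (g : 'rV[R]_n -> 'rV[R]_n -> 'rV[R]_n -> R) z b b' c vel N :
  sym_form (g z) -> g z b N = 0 -> g z b' N = 0 ->
  euler_lagrange g z (b + c) vel N = euler_lagrange g z (b' + c) vel N.
Proof. by move=> zS b0 b'0; rewrite /euler_lagrange !(sformDl zS) b0 b'0. Qed.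

Context (m n k : nat).
Context (G : topGroupType) (AG : atlas 'rV[R]_m G) (G_lie : lie_group AG).
Context (gbi : G -> 'rV[R]_m -> 'rV[R]_m -> R) (gbi_metric : riemannian_metric AG setT gbi).
Context (M : topologicalType) (AM : atlas 'rV[R]_n M).
Context (gM : M -> 'rV[R]_n -> 'rV[R]_n -> R) (gM_metric : riemannian_metric AM setT gM).
Context (a : group_action G M) (aS : smooth_action a AG AM).
Hypothesis a_isometric : acts_by_isometries a AM gM.
Context (U : set M) (U_open : open U) (U_inv : invariant_set a U).
Context (gt : M -> 'rV[R]_n -> 'rV[R]_n -> R) (gt_metric : riemannian_metric AM U gt).
Local Notation star := (star AG AM a).
Hypothesis gt_le : forall z X, U z -> gt z (star z X) (star z X) <= gbi 1%g X X.
Hypothesis gt_eq : forall z X, U z -> (forall Z, star z Z = 0 -> gbi 1%g X Z = 0) ->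
  gt z (star z X) (star z X) = gbi 1%g X X.
Hypothesis gt_normal : forall z X N, U z -> (forall Y, gM z N (star z Y) = 0) ->
  gt z (star z X) N = 0.
Context (x : M) (Ux : U x) (AQ : atlas 'rV[R]_k (coset_space a x)).
Hypothesis pS : submersion AG AQ (coset_proj a x).
Local Notation pi := (coset_proj a x).
Local Notation Phi := (orbit_map a x).

Lemma star_dorbit_map g X : exists w,
  dmap AQ AM Phi (pi g) w = star (a g x) X.
Proof.
exists (dmap AG AQ pi g (dmap AG AG (rmul g) 1%g X)).
by rewrite (dorbit_map_proj aS pS) (dorb_right G_lie aS).
Qed.

(* A enters only through a vector tangent to the orbit, hence can be replaced by
   the second derivative of the curve of [normal_el] with velocity V. *)
Lemma normal_el_orbit q y (V A : 'rV[R]_k) N : Phi q = y ->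
  (forall Y, gM y N (star y Y) = 0) ->
  let d := chart_at AQ q in let kap := chart_at AM y in
  let F := lrep d kap Phi in let z := cfwd d q in
  euler_lagrange (chart_metric AM kap gt) (F z) ('D_A F z + 'D_V ('D_V F) z) ('D_V F z) N = 0.
Proof.
move=> qy hN d kap F z.
have PS := orbit_map_smooth aS pS.
have [g0 g0q] := coset_proj_surj q.
have yE : y = a g0 x by rewrite -qy -g0q orbit_map_proj.
have Uy : U y by rewrite yE; exact: U_inv.
have Ad : charts AQ d by exact: charts_chart_at.
have Ak : charts AM kap by exact: charts_chart_at.
have dq : cdom d q by exact: cdom_chart_at.
have ky : cdom kap (Phi q) by rewrite qy; exact: cdom_chart_at.
have zD : lrep_dom d kap Phi z by exact: lrep_dom_cfwd.
have oDF : open (lrep_dom d kap Phi) by exact: lrep_dom_open PS.1.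
have FS : smooth_on (lrep_dom d kap Phi) F by exact: smooth_map_lrep PS Ad Ak.
have Fz : F z = cfwd kap y by rewrite /F lrep_cfwd// qy.
have dF u : 'D_u F z = dmap AQ AM Phi q u by rewrite dmapE// qy.
(* f lifts the orbit map of y = g0 x to G / G_x, so the curve of [normal_el] becomes the image under
   F of a curve in a chart of G / G_x. *)
pose f := pi \o rmul g0.
have f1 : f 1%g = q by rewrite /f /= /rmul mul1g.
have fS : smooth_map AG AQ f := smooth_map_comp (framed_rV m) (rmul_smooth G_lie g0) pS.1.
have Pf : Phi \o f = orb a y.
  by apply/funext => h; rewrite /f /= orbit_map_proj /orb yE /rmul gactM.
have dPf X : dmap AQ AM Phi q (dmap AG AQ f 1%g X) = star y X.
  have := dmap_comp 1%g X (framed_rV k) fS PS; rewrite f1 => <-.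
  by rewrite Pf.
have [X0 X0V] : exists X0, dmap AG AQ f 1%g X0 = V.
  have [X' X'V] := pS.2 g0 V; have [X0 X0X'] := drmulK G_lie g0 X'; exists X0.
  rewrite (dmap_comp 1%g X0 (framed_rV m) (rmul_smooth G_lie g0) pS.1) X0X'.
  by rewrite /rmul mul1g.
have qS : sym_form (gbi 1%g) by exact: metric_form gbi_metric _.
have q0 : forall u, u != 0 -> 0 < gbi 1%g u u by exact: (metric_gt0 gbi_metric).
pose st : {linear _ -> _} := 'd (cfwd (chart_at AM (orb a y 1%g)) \o orb a y \o cbwd (chart_at AG 1%g)) (cfwd (chart_at AG 1%g) 1%g).
(* [normal_el] requires X orthogonal to the isotropy algebra. The change keeps [star y X0], hence
   also the velocity V because Phi is an immersion. *)
have [X sX hX] : exists2 X, star y X = star y X0 & forall Z, star y Z = 0 -> gbi 1%g X Z = 0.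
  exact: (@perp_kernel R m n (gbi 1%g) st X0 qS q0).
have XV : dmap AG AQ f 1%g X = V.
  by apply: (dorbit_map_inj G_lie aS pS) (q) _ _ _; rewrite -X0V !dPf.
have := normal_el G_lie aS a_isometric U_open U_inv gt_metric gt_le gt_eq gt_normal Uy hX hN.
set eta := chart_at AG 1%g; set u0 := cfwd eta 1%g; rewrite -/kap.
have Ae : charts AG eta by exact: charts_chart_at.
have e1 : cdom eta 1%g by exact: cdom_chart_at.
pose P := lrep eta d f.
have df1 : cdom d (f 1%g) by rewrite f1.
have ud : lrep_dom eta d f u0 by exact: lrep_dom_cfwd.
have PSm : smooth_on (lrep_dom eta d f) P by exact: smooth_map_lrep fS Ae Ad.
have oP : open (lrep_dom eta d f) by exact: lrep_dom_open fS.1.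
have Pu0 : P u0 = z by rewrite /P lrep_cfwd// f1.
have DP : 'D_X P u0 = V by rewrite -XV dmapE// f1.
have nFP : \forall u \near u0, (F \o P) u = lrep eta kap (orb a y) u.
  by rewrite -Pf; exact: near_lrep_comp fS.1 ud.
have nP : \forall u \near u0, lrep_dom d kap Phi (P u) /\ differentiable P u.
  apply: filterI.
    have cP : {for u0, continuous P} by exact: smooth_on_cont PSm ud.
    by apply: cP; rewrite Pu0; exact: open_nbhs_nbhs.
  apply: filterS (open_nbhs_nbhs (conj oP ud)) => u; exact: smooth_on_diff.
have D2 : 'D_X ('D_X (lrep eta kap (orb a y))) u0 =
    'D_('D_X ('D_X P) u0) F z + 'D_V ('D_V F) z.
  rewrite -DP -Pu0 -(derive2_comp oDF _ (FS 2%N) nP); last 2 first.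
  - by rewrite Pu0.
  - by apply: smooth_on_diff ud; exact: smooth_on_derive.
  apply/esym/near_eq_derive.
  have : nbhs u0 (fun u => \forall v \near u, (F \o P) v = lrep eta kap (orb a y) v).
    exact/nbhs_interior.
  by apply: filterS => u; exact: near_eq_derive.
have VX : star y X = 'D_V F z by rewrite dF -XV dPf.
rewrite D2 VX -Fz.
have DFz : (cfwd kap @` (cdom kap `&` U)) (F z).
  by rewrite Fz; exists y => //; split => //; exact: cdom_chart_at.
have zS := chart_metric_form gt_metric DFz.
have Nperp B : chart_metric AM kap gt (F z) ('D_B F z) N = 0.
  rewrite dF Fz chart_metric_at -g0q.
  have [B' <-] := pS.2 g0 B; have [Z <-] := drmulK G_lie g0 B'.
  rewrite (dorbit_map_proj aS pS) (dorb_right G_lie aS) -yE.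
  exact: gt_normal.
move=> e; apply: (etrans _ e).
by apply: el_acc_eq; [exact: zS|exact: Nperp|exact: Nperp].
Qed.

Lemma orbit_totally_geodesic : totally_geodesic_image AQ AM Phi gt.
Proof.
move=> I gam oI _ [gS geq].
have PS := orbit_map_smooth aS pS.
split; first exact: smooth_curve_comp PS gS.
move=> t It w.
rewrite el_christoffel.
set q := gam t; pose y := Phi q.
rewrite -[(Phi \o gam) t]/y.
set d := chart_at AQ q; set kap := chart_at AM y.
pose F := lrep d kap Phi; pose z := cfwd d q.
have Ad : charts AQ d by exact: charts_chart_at.
have Ak : charts AM kap by exact: charts_chart_at.
have dq : cdom d q by exact: cdom_chart_at.
have ky : cdom kap y by exact: cdom_chart_at.
have zD : lrep_dom d kap Phi z by exact: lrep_dom_cfwd.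
have oDF : open (lrep_dom d kap Phi) by exact: lrep_dom_open PS.1.
have FS : smooth_on (lrep_dom d kap Phi) F by exact: smooth_map_lrep PS Ad Ak.
have Fz : F z = cfwd kap y by rewrite /F lrep_cfwd.
pose c := cfwd d \o gam.
pose J := I `&` gam @^-1` (cdom d `&` Phi @^-1` cdom kap).
have oJ : open (J : set R^o).
  apply: open_curve_preimage => //; first exact: gS.1.
  apply: openI; first exact: cdom_open.
  by apply: open_comp; [move=> s _; exact: PS.1|exact: cdom_open].
have Jt : J t by [].
have cS l : Ck_on l (J : set R^o) c.
  by apply: Ck_on_sub (gS.2 d Ad l) => s [Is [ds cs]].
have nJ : \forall s \near t, J s by exact: (open_nbhs_nbhs (conj oJ Jt)).
have nc : \forall s \near t, lrep_dom d kap Phi (c s) /\ differentiable c s.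
  apply: filterS nJ => s Js; split; last by have [+ _] := cS 1%N; exact.
  by case: Js => Is [ds cs]; exact: lrep_dom_cfwd.
have nFc : \forall s \near t, (F \o c) s = (cfwd kap \o (Phi \o gam)) s.
  by apply: filterS nJ => s [Is [ds cs]]; rewrite /F /c /lrep/= cfwdK.
pose V := 'D_1 c t; pose A := 'D_1 ('D_1 c) t.
have velE : velocity AQ gam t = V by rewrite /velocity derive1E.
have accE : acceleration AQ gam t = A.
  rewrite /acceleration derive1nS derive1n1 derive1E.
  by congr ('D_1 _ t); apply/funext => s; rewrite derive1E.
have dc : differentiable c t by have [_] := nbhs_singleton nc.
have dF : differentiable F z by exact: smooth_on_diff FS zD.
have vel'E : velocity AM (Phi \o gam) t = 'D_V F z.
  rewrite /velocity derive1E -[chart_at _ _]/kap -(near_eq_derive _ nFc).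
  by rewrite derive_comp.
have acc'E : acceleration AM (Phi \o gam) t = 'D_A F z + 'D_V ('D_V F) z.
  rewrite /acceleration derive1nS derive1n1 derive1E -[chart_at _ _]/kap.
  rewrite -(derive2_comp (c := c) oDF zD (FS 2%N) nc); last first.
    exact: (@smooth_on_diff R R^o _ J ('D_1 c) t (@smooth_on_derive R R^o _ J c 1 cS) Jt).
  apply/esym/near_eq_derive.
  have : nbhs t (fun s => \forall r \near s, (F \o c) r = (cfwd kap \o (Phi \o gam)) r).
    exact/nbhs_interior.
  by apply: filterS => s e; rewrite derive1E; exact: near_eq_derive.
rewrite vel'E acc'E -Fz.
have [g0 g0q] := coset_proj_surj q.
have yE : y = a g0 x by rewrite /y -g0q orbit_map_proj.
have Uy : U y by rewrite yE; exact: U_inv.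
have DFz : (cfwd kap @` (cdom kap `&` U)) (F z) by rewrite Fz; exact: chart_dom_at Uy.
have oDU := @chart_dom_open R n M AM U U_open y.
have gF := @chart_metric_form R n M AM U gt gt_metric y.
have gD := @chart_metric_diff R n M AM U gt gt_metric y.
have hS : sym_form (gM y) by exact: metric_form gM_metric _.
have h0 : forall u, u != 0 -> 0 < gM y u u by exact: (metric_gt0 gM_metric).
(* The test vector is split by gM, since the normal part of the equation is known for gM-normal
   vectors. *)
have [X Xw] := orth_decomp hS h0 (@star_linear R m n G AG M AM a y) w.
have [w' w'X] := star_dorbit_map g0 X.
have -> : w = 1 *: 'D_w' F z + (w - star y X).
  rewrite g0q -yE in w'X.
  have -> : 'D_w' F z = star y X by exact: (etrans (esym (dmapE q w' PS)) w'X).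
  by rewrite scale1r addrC subrK.
have norm : euler_lagrange (chart_metric AM kap gt) (F z) ('D_A F z + 'D_V ('D_V F) z)
    ('D_V F z) (w - star y X) = 0 by exact: (@normal_el_orbit q y V A _ erefl Xw).
suff tang : euler_lagrange (chart_metric AM kap gt) (F z) ('D_A F z + 'D_V ('D_V F) z)
    ('D_V F z) ('D_w' F z) = 0.
  have lin := el_linear oDU gF gD ('D_A F z + 'D_V ('D_V F) z) ('D_V F z) 1 ('D_w' F z) (w - star y X) DFz.
  have e0 : 1 * 0 + 0 = 0 :> R by rewrite mulr0 addr0.
  exact: (etrans lin (etrans (congr2 (fun s r => 1 * s + r) tang norm) e0)).
apply: (etrans (el_pullback oDU gF gD A V w' oDF zD (FS 2%N) DFz)).
have := geq t It w'; rewrite el_christoffel velE accE -/q -/d -/z => eQ.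
(* It remains to see that, near z, the induced metric read in the chart d is the pullback by F of gt
   read in the chart [kap]. *)
apply: etrans eQ; apply: el_near; apply: filterS (open_nbhs_nbhs (conj oDF zD)) => s sD u v.
rewrite {2}/chart_metric /pullback_metric.
rewrite !(tangent_lrep _ (framed_rV k) (framed_rV n) PS Ad Ak sD).
have -> : Phi (cbwd d s) = cbwd kap (F s).
  by have /lrep_domP[ds ks] := sD; rewrite /F /lrep/= cfwdK.
by [].
Qed.

End Final.

Theorem theoremB (R : realType) (m n : nat)
    (* the compact Lie group (G, g_bi) *)
    (G : topGroupType) (AG : atlas 'rV[R]_m G)
    (gbi : G -> 'rV[R]_m -> 'rV[R]_m -> R)
    (G_lie : lie_group AG) (G_compact : compact [set: G])
    (gbi_metric : riemannian_metric AG setT gbi)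
    (gbi_inv : bi_invariant AG gbi)
    (* the complete Riemannian manifold (M, g_M) *)
    (M : topologicalType) (AM : atlas 'rV[R]_n M)
    (gM : M -> 'rV[R]_n -> 'rV[R]_n -> R)
    (M_manifold : manifold_space M)
    (gM_metric : riemannian_metric AM setT gM)
    (gM_complete : complete_metric AM gM)
    (* the isometric action *)
    (a : group_action G M)
    (a_smooth : smooth_action a AG AM)
    (a_isometric : acts_by_isometries a AM gM)
    (* the Cheeger deformations g_l *)
    (gl : R -> M -> 'rV[R]_n -> 'rV[R]_n -> R)
    (gl_metric : forall l : R, 0 < l -> riemannian_metric AM setT (gl l))
    (gl_cheeger : forall l : R, 0 < l ->
      riemannian_submersion (prod_atlas AG AM) AM (fun z : G * M => a z.1 z.2)
        (scaled_prod_metric l gbi gM) (gl l))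
    (* the invariant precompact open subset U of the regular part *)
    (U : set M) (U_open : open U) (U_reg : U `<=` principal a)
    (U_inv : invariant_set a U)
    (U_precompact : compact (closure U `&` principal a))
    (* the limit metric on U of the rescaled Cheeger deformations *)
    (gt : M -> 'rV[R]_n -> 'rV[R]_n -> R)
    (gt_metric : riemannian_metric AM U gt)
    (N : nat) (c : 'I_N -> chart 'rV[R]_n M) (c_atlas : finite_atlas AM U c)
    (gt_limit : forall p : nat,
      Cp_converges AM U c p (fun l => rescaled_metric a AG AM l (gl l)) gt)
    (* the point x, the smooth structure of G / G_x, and g_nh,x *)
    (x : M) (Ux : U x)
    (k : nat) (AQ : atlas 'rV[R]_k (coset_space a x))
    (Q_manifold : manifold_space (coset_space a x))
    (proj_submersion : submersion AG AQ (coset_proj a x))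
    (gnh : coset_space a x -> 'rV[R]_k -> 'rV[R]_k -> R)
    (gnh_metric : riemannian_metric AQ setT gnh)
    (gnh_submersion :
      riemannian_submersion AG AQ (coset_proj a x) gbi gnh) :
  riemannian_embedding AQ AM U (orbit_map a x) gnh gt /\
  totally_geodesic_image AQ AM (orbit_map a x) gt.
Proof.
have facts := limit_metric_facts gbi_metric gM_metric a_smooth gl_metric
  gl_cheeger gt_metric c_atlas gt_limit.
have gt_le z X : U z ->
    gt z (star AG AM a z X) (star AG AM a z X) <= gbi 1%g X X.
  by move=> /facts[].
have gt_eq z X : U z ->
    (forall Z, star AG AM a z Z = 0 -> gbi 1%g X Z = 0) ->
    gt z (star AG AM a z X) (star AG AM a z X) = gbi 1%g X X.
  by move=> /facts[_ + _]; exact.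
have gt_normal z X N' : U z -> (forall Y, gM z N' (star AG AM a z Y) = 0) ->
    gt z (star AG AM a z X) N' = 0.
  by move=> /facts[_ _]; exact.
have orbU g : U (a g x) by exact: U_inv.
split; last first.
  exact: (orbit_totally_geodesic G_lie gbi_metric gM_metric a_smooth
    a_isometric U_open U_inv gt_metric gt_le gt_eq gt_normal Ux proj_submersion).
split.
- exact: (orbit_map_embedding G_lie a_smooth proj_submersion G_compact M_manifold.1).
- by move=> _ [q _ <-]; have [g <-] := coset_proj_surj q; rewrite orbit_map_proj.
- exact: (orbit_map_isometric G_lie a_smooth proj_submersion gbi_metric gbi_inv
    gnh_metric gnh_submersion gt_metric orbU gt_eq).
Qed.
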